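(* (i) Let $N$ and $M$ be arbitrary non-negative integers. Let $z$ be a positive real number and $\mu$ and $\nu$ be arbitrary real numbers such that $\mu<2N-M+\frac12$ and $|\nu|<M+\frac12$. Then $$R_{N,M}^{(S)}(z,\mu,\nu)=a_M(\nu)\,\Gamma\left(2N-M-\mu+\tfrac12\right)\Pi_{2N-M-\mu+\frac12}(z)\,\Theta_{N,M}^{(S)}(z,\mu,\nu),$$ where $0<\Theta_{N,M}^{(S)}(z,\mu,\nu)<1$ is an appropriate number that depends on $z$, $\mu$, $\nu$, $N$ and $M$. (ii) Let $N$ be an arbitrary non-negative integer and $M$ be an arbitrary positive integer. Let $z$ be a positive real number and $\mu$ and $\nu$ be arbitrary real numbers such that $\mu<2N-M+\frac32$ and $|\nu|<M-\frac12$. Then $$R_{N,M}^{(S')}(z,\mu,\nu)=b_M(\nu)\,\Gamma\left(2N-M-\mu+\tfrac32\right)\Pi_{2N-M-\mu+\frac32}(z)\,\Theta_{N,M}^{(S')}(z,\mu,\nu),$$ where $0<\Theta_{N,M}^{(S')}(z,\mu,\nu)<1$ is an appropriate number that depends on $z$, $\mu$, $\nu$, $N$ and $M$.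
   Context: Lommel function: for complex $\mu,\nu$, $S_{\mu,\nu}(z)$ (analytic in $|\arg z|<\pi$) is the unique solution of $w''(z)+\frac1z w'(z)+\left(1-\frac{\nu^2}{z^2}\right)w(z)=z^{\mu-1}$ with $S_{\mu,\nu}(z)\sim z^{\mu-1}$ as $z\to\infty$ in $|\arg z|\le\pi-\delta$, for every fixed $\delta>0$. $S'_{\mu,\nu}$ is its derivative in $z$. Powers of $z$ are principal; empty sums are zero. Two-argument coefficients: $a_n(\mu,\nu)=\prod_{k=1}^n\left((\mu+2k-1)^2-\nu^2\right)$ and $b_n(\mu,\nu)=-a_n(\mu,\nu)(\mu+2n+1)$. First-level remainders ($|\arg z|<\pi$, $N\ge0$): $$S_{\mu,\nu}(z)=z^{\mu-1}\left(\sum_{n=0}^{N-1}(-1)^n\frac{a_n(-\mu,\nu)}{z^{2n}}+R_N^{(S)}(z,\mu,\nu)\right),\quad S'_{\mu,\nu}(z)=z^{\mu-2}\left(\sum_{n=0}^{N-1}(-1)^n\frac{b_n(-\mu,\nu)}{z^{2n}}+R_N^{(S')}(z,\mu,\nu)\right).$$ One-argument coefficients: $a_m(\nu)$ and $b_m(\nu)$ are the coefficients of the large-$z$ asymptotic expansions $K_\nu(z)\sim\left(\frac{\pi}{2z}\right)^{\frac12}e^{-z}\sum_{m\ge0}\frac{a_m(\nu)}{z^m}$ and $K'_\nu(z)\sim-\left(\frac{\pi}{2z}\right)^{\frac12}e^{-z}\sum_{m\ge0}\frac{b_m(\nu)}{z^m}$ of the modified Bessel function and its derivative, namely $a_m(\nu)=\frac{(4\nu^2-1^2)(4\nu^2-3^2)\cdots(4\nu^2-(2m-1)^2)}{m!\,8^m}$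 with $a_0(\nu)=1$, and $b_0(\nu)=1$, $b_1(\nu)=\frac{4\nu^2+3}{8}$, $b_m(\nu)=\frac{(4\nu^2-1^2)(4\nu^2-3^2)\cdots(4\nu^2-(2m-3)^2)(4\nu^2+4m^2-1)}{m!\,8^m}$ for $m\ge2$. Basic terminant: $\Pi_p(w)=\frac{w^p}{2}\left(e^{\frac\pi2 ip}e^{iw}\Gamma(1-p,we^{\frac\pi2 i})+e^{-\frac\pi2 ip}e^{-iw}\Gamma(1-p,we^{-\frac\pi2 i})\right)$ with $\Gamma(1-p,\cdot)$ the upper incomplete gamma function; for $\Re(p)>0$ and $|\arg w|<\frac\pi2$, $\Pi_p(w)=\frac{1}{\Gamma(p)}\int_0^{+\infty}\frac{t^{p-1}e^{-t}}{1+(t/w)^2}dt$. Re-expansion remainders: $R_{N,M}^{(S)}$ (for $M<2N-\Re(\mu)+\frac12$) and $R_{N,M}^{(S')}$ (for $M<2N-\Re(\mu)+\frac32$) are defined by $$R_N^{(S)}(z,\mu,\nu)=(-1)^N\frac{2^{\mu+\frac12}\pi^{\frac12}}{\Gamma\left(\frac{-\mu+\nu+1}{2}\right)\Gamma\left(\frac{-\mu-\nu+1}{2}\right)}\frac{1}{z^{2N}}\left(\sum_{m=0}^{M-1}a_m(\nu)\Gamma\left(2N-m-\mu+\tfrac12\right)\Pi_{2N-m-\mu+\frac12}(z)+R_{N,M}^{(S)}(z,\mu,\nu)\right),$$ $$R_N^{(S')}(z,\mu,\nu)=(-1)^{N+1}\frac{2^{\mu+\frac12}\pi^{\frac12}}{\Gamma\left(\frac{-\mu+\nu+1}{2}\right)\Gamma\left(\frac{-\mu-\nu+1}{2}\right)}\frac{1}{z^{2N}}\left(\sum_{m=0}^{M-1}b_m(\nu)\Gamma\left(2N-m-\mu+\tfrac32\right)\Pi_{2N-m-\mu+\frac32}(z)+R_{N,M}^{(S')}(z,\mu,\nu)\right).$$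 If one of $\mu\pm\nu$ is a positive odd integer, so that the prefactor vanishes, $R_{N,M}^{(S)}$ and $R_{N,M}^{(S')}$ are understood by continuity in $\mu$. *)

(* Defs.v *)
From HB Require Import structures.
From mathcomp Require Import all_boot all_order all_algebra.
From mathcomp Require Import complex.
From mathcomp Require Import all_classical all_reals all_analysis.

Set Implicit Arguments.
Unset Strict Implicit.
Unset Printing Implicit Defensive.

Import Order.TTheory GRing.Theory Num.Theory.
Import numFieldNormedType.Exports.

Local Open Scope classical_set_scope.
Local Open Scope ring_scope.
Local Open Scope complex_scope.

(* With all_analysis loaded, Re and Im would denote 'Re and 'Im. *)
Local Notation Re := complex.Re.
Local Notation Im := complex.Im.

Section ComplexFunctions.
Variable R : realType.
Implicit Types z w a s p : R[i].

Definition cexp z : R[i] :=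
  (expR (Re z))%:C * (cos (Im z) +i* sin (Im z)).

Definition cmod z : R := Num.sqrt (Re z ^+ 2 + Im z ^+ 2).

(* Principal argument, with values in ]-pi, pi] for z != 0. *)
Definition carg z : R :=
  if 0 <= Im z then acos (Re z / cmod z) else - acos (Re z / cmod z).

Definition clog z : R[i] := ln (cmod z) +i* carg z.

(* Principal power; only used for z != 0. *)
Definition cpow z a : R[i] := cexp (a * clog z).

(* The sectors |arg z| < pi and |arg z| <= pi - delta. *)
Definition slit_plane : set R[i] := [set z | z != 0 /\ `|carg z| < pi].
Definition sector (delta : R) : set R[i] :=
  [set z | z != 0 /\ `|carg z| <= pi - delta].

Definition cintegral (D : set R) (f : R -> R[i]) : R[i] :=
  (\int[@lebesgue_measure R]_(t in D) Re (f t)) +i*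
  (\int[@lebesgue_measure R]_(t in D) Im (f t)).

Definition gamma_int s : R[i] :=
  cintegral `]0, +oo[ (fun t => cpow t%:C (s - 1) * (expR (- t))%:C).

(* Gamma function: Euler's integral for 0 < Re s, continued to Re s <= 0 by
   Gamma (s + k) = s (s + 1) ... (s + k - 1) Gamma s with Re s + k > 0.
   At the poles s = 0, -1, -2, ... the value is the junk value x / 0 = 0. *)
Definition gamma s : R[i] :=
  let k := if 0 < Re s then 0%N else (Num.truncn (- Re s)).+1 in
  gamma_int (s + k%:R) / \prod_(0 <= j < k) (s + j%:R).

(* Upper incomplete Gamma function on its principal branch |arg z| < pi:
   the integral of u^(a-1) e^(-u) along the horizontal ray u = z + t, t > 0,
   which does not meet the cut. *)
Definition inc_gamma a z : R[i] :=
  cintegral `]0, +oo[ (fun t => cpow (z + t%:C) (a - 1) * cexp (- (z + t%:C))).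

(* Basic terminant. As inc_gamma is the principal branch and the arguments
   w e^(pi i/2), w e^(-pi i/2) are formed as complex numbers, this is Pi_p(w)
   only for |arg w| < pi/2. *)
Definition terminant p w : R[i] :=
  cpow w p / 2%:R *
  (cexp ((pi / 2%:R)%:C * 'i%C * p) * cexp ('i%C * w) *
     inc_gamma (1 - p) (w * cexp ((pi / 2%:R)%:C * 'i%C)) +
   cexp (- ((pi / 2%:R)%:C * 'i%C * p)) * cexp (- ('i%C * w)) *
     inc_gamma (1 - p) (w * cexp (- ((pi / 2%:R)%:C * 'i%C)))).

End ComplexFunctions.

Section Coefficients.
Variable F : fieldType.

(* The two-argument coefficients a_n(mu, nu) and b_n(mu, nu). *)
Definition lommel_a (n : nat) (mu nu : F) : F :=
  \prod_(1 <= k < n.+1) ((mu + 2%:R * k%:R - 1) ^+ 2 - nu ^+ 2).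
Definition lommel_b (n : nat) (mu nu : F) : F :=
  - lommel_a n mu nu * (mu + 2%:R * n%:R + 1).

(* The coefficients a_m(nu) and b_m(nu) of the large-z expansions of K_nu and
   -K'_nu; b_1(nu) = (4 nu^2 + 3) / 8 is the case of an empty
   product. *)
Definition bessel_a (m : nat) (nu : F) : F :=
  (\prod_(1 <= k < m.+1) (4%:R * nu ^+ 2 - (2%:R * k%:R - 1) ^+ 2)) /
  (m`!%:R * 8%:R ^+ m).
Definition bessel_b (m : nat) (nu : F) : F :=
  if m == 0%N then 1 else
  (\prod_(1 <= k < m) (4%:R * nu ^+ 2 - (2%:R * k%:R - 1) ^+ 2)) *
  (4%:R * nu ^+ 2 + 4%:R * m%:R ^+ 2 - 1) / (m`!%:R * 8%:R ^+ m).

End Coefficients.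

Section Lommel.
Variable R : realType.
Implicit Types mu nu z : R[i].

(* The complex derivative: R[i]^o is R[i] as a normed space over itself. *)
Definition cderiv (w : R[i] -> R[i]) (z : R[i]) : R[i] :=
  'D_1 (w : R[i]^o -> R[i]^o) z.
Definition cderivable (w : R[i] -> R[i]) (z : R[i]) : Prop :=
  derivable (w : R[i]^o -> R[i]^o) z 1.

(* w is S_{mu,nu} on |arg z| < pi. The four clauses determine w there; nothing
   is required of the values of w on the cut. *)
Record is_lommel mu nu (w : R[i] -> R[i]) : Prop := IsLommel {
  lommel_derivable : forall z, slit_plane z -> cderivable w z ;
  lommel_derivable2 : forall z, slit_plane z -> cderivable (cderiv w) z ;
  lommel_ode : forall z, slit_plane z ->
    cderiv (cderiv w) z + z^-1 * cderiv w z + (1 - nu ^+ 2 / z ^+ 2) * w z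
    = cpow z (mu - 1) ;
  lommel_asymptotic : forall delta eps : R, 0 < delta -> 0 < eps ->
    exists A : R, forall z, sector delta z -> A <= cmod z ->
      cmod (w z / cpow z (mu - 1) - 1) <= eps
}.

Variable S : R[i] -> R[i] -> R[i] -> R[i].

(* R_N^(S) and R_N^(S'), i.e. the equations
   S  = z^(mu-1) (\sum_(n < N) (-1)^n a_n(-mu,nu) / z^(2n) + R_N^(S)),
   S' = z^(mu-2) (\sum_(n < N) (-1)^n b_n(-mu,nu) / z^(2n) + R_N^(S'))
   solved for the remainders. *)
Definition lommel_rem (N : nat) z mu nu : R[i] :=
  S mu nu z / cpow z (mu - 1) -
  \sum_(0 <= n < N) (-1) ^+ n * lommel_a n (- mu) nu / z ^+ (2 * n).
Definition lommel_rem' (N : nat) z mu nu : R[i] :=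
  cderiv (S mu nu) z / cpow z (mu - 2%:R) -
  \sum_(0 <= n < N) (-1) ^+ n * lommel_b n (- mu) nu / z ^+ (2 * n).

Definition prefactor mu nu : R[i] :=
  cpow 2%:R (mu + 2%:R^-1) * (Num.sqrt pi)%:C /
  (gamma ((- mu + nu + 1) / 2%:R) * gamma ((- mu - nu + 1) / 2%:R)).

Definition expS (N m : nat) mu : R[i] := (2 * N)%:R - m%:R - mu + 2%:R^-1.
Definition expS' (N m : nat) mu : R[i] := (2 * N)%:R - m%:R - mu + 3%:R / 2%:R.

(* The re-expansion remainders when the prefactor does not vanish, i.e.
   R_N^(S) = (-1)^N prefactor / z^(2N)
     * (\sum_(m < M) a_m(nu) Gamma(p_m) Pi_(p_m)(z) + R_{N,M}^(S)),
   p_m = 2N - m - mu + 1/2, solved for R_{N,M}^(S), and likewise for S'. *)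
Definition reexp_rem_gen (N M : nat) z mu nu : R[i] :=
  lommel_rem N z mu nu / ((-1) ^+ N * prefactor mu nu / z ^+ (2 * N)) -
  \sum_(0 <= m < M)
    bessel_a m nu * gamma (expS N m mu) * terminant (expS N m mu) z.
Definition reexp_rem_gen' (N M : nat) z mu nu : R[i] :=
  lommel_rem' N z mu nu / ((-1) ^+ N.+1 * prefactor mu nu / z ^+ (2 * N)) -
  \sum_(0 <= m < M)
    bessel_b m nu * gamma (expS' N m mu) * terminant (expS' N m mu) z.

(* One of mu + nu, mu - nu is a positive odd integer. *)
Definition exceptional mu nu : Prop :=
  exists k : nat, mu + nu = (2 * k + 1)%:R \/ mu - nu = (2 * k + 1)%:R.

(* R_{N,M}^(S)(z, mu, nu) and R_{N,M}^(S')(z, mu, nu); in the exceptional case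
   the limit is over complex mu' -> mu, mu' != mu. *)
Definition reexp_rem (N M : nat) z mu nu : R[i] :=
  if `[< exceptional mu nu >] then
    lim ((reexp_rem_gen N M z mu' nu : R[i]^o) @[mu' --> (mu : R[i]^o)^'])
  else reexp_rem_gen N M z mu nu.
Definition reexp_rem' (N M : nat) z mu nu : R[i] :=
  if `[< exceptional mu nu >] then
    lim ((reexp_rem_gen' N M z mu' nu : R[i]^o) @[mu' --> (mu : R[i]^o)^'])
  else reexp_rem_gen' N M z mu nu.

End Lommel.

(* Main.v *)
(** Let [F z] be the integral over the plane of
    [exp ((1 - mu) v + nu u - z e^v cosh u) / (1 + e^(2 v))], with [mu] shifted down by [2 N].
    It satisfies [z^2 F'' + z F' + (z^2 - nu^2) F = z^2 H], where [H] is the same integral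
    without the denominator; [H] is homogeneous, so [H z = H 1 * z^(mu - 1)], and [H 1] is a
    product of two Gamma values.  Hence the first [N] terms of the asymptotic series plus a
    multiple of [F] solve the Lommel equation, and they equal [S]: the difference [d] solves
    Bessel's equation on [Re z > 0] with polynomial growth on vertical lines, while far
    enough to the right [|d|^2] is bounded by its second derivative along such a line, which
    forces exponential growth unless [d = 0].
    On the positive axis the [u]-integral is [2 K_nu (e^v)], so the remainder is the transform
    of [K_nu] with kernel [1 / (1 + e^(2 v) / z^2)].  The large-argument expansion of [K_nu]
    is enveloping, because [K_nu] is a positive average of a binomial [(1 + y)^(nu - 1/2)]
    whose Taylor remainder lies strictly between [0] and the first omitted term.  Integrating
    term by term gives the terminants.  After division by the prefactor the transform is
    continuous in [mu], which settles the exceptional case. *)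

(* Although the theorem takes [mu] real, the identities are proved for complex [mu]: the value at an
   exceptional [mu] is a limit over complex neighbours, so they must hold on a punctured complex
   disc. Likewise [z] has to run over Re z > 0, not only over the positive axis. On the axis every
   solution of Bessel's equation is O(z^(-1/2)), so the asymptotic condition there cannot single out
   S when Re mu is large; vertical lines, which the sector condition reaches, can. Removing N terms
   serves convergence. With p = 1 - mu + 2 N the plane integral needs |nu| < Re p, and in both parts
   the bounds on mu and nu combine to exactly this. Integrals over (0, oo) are moved to the line by
   t = exp v. Dilations become translations, integrands decay like exp (- d |v|), and one lemma on
   Laplace transforms, [lap_cdiff], gives differentiability of Gamma integrals, of K_nu, of F, and
   of the dependence on mu. No contour is rotated: homogeneity under real scaling plus
   differentiability determines a function on the half-plane. *)
Require Import Defs.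
From mathcomp Require Import all_boot all_order all_algebra.
From mathcomp Require Import complex.
From mathcomp Require Import all_classical all_reals all_analysis.
From mathcomp Require Import measurable_realfun gauss_integral.
From mathcomp Require Import ring lra.

Set Implicit Arguments.
Unset Strict Implicit.
Unset Printing Implicit Defensive.

Import Order.TTheory GRing.Theory Num.Theory.
Import numFieldNormedType.Exports.

Local Open Scope classical_set_scope.
Local Open Scope ring_scope.
Local Open Scope complex_scope.

Local Notation Re := complex.Re.
Local Notation Im := complex.Im.

(** * Complex exponential *)

Section ComplexBasics.
Variable R : realType.
Implicit Types (x y t : R) (z w h : R[i]).

Lemma ReD z w : Re (z + w) = Re z + Re w. Proof. by case: z; case: w. Qed.
Lemma ImD z w : Im (z + w) = Im z + Im w. Proof. by case: z; case: w. Qed.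
Lemma ReN z : Re (- z) = - Re z. Proof. by case: z. Qed.
Lemma ImN z : Im (- z) = - Im z. Proof. by case: z. Qed.
Lemma ReB z w : Re (z - w) = Re z - Re w. Proof. by rewrite ReD ReN. Qed.
Lemma ImB z w : Im (z - w) = Im z - Im w. Proof. by rewrite ImD ImN. Qed.
Lemma Re_mul z w : Re (z * w) = Re z * Re w - Im z * Im w.
Proof. by case: z; case: w. Qed.
Lemma Im_mul z w : Im (z * w) = Re z * Im w + Im z * Re w.
Proof. by case: z => a b; case: w => c d /=. Qed.
Lemma Re_real x : Re x%:C = x. Proof. by []. Qed.
Lemma Im_real x : Im x%:C = 0. Proof. by []. Qed.

Lemma Re_C x y : Re (x +i* y) = x. Proof. by []. Qed.
Lemma Im_C x y : Im (x +i* y) = y. Proof. by []. Qed.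
Lemma Re_nat n : Re (n%:R : R[i]) = n%:R.
Proof. by elim: n => // n IH; rewrite -addn1 !natrD ReD IH. Qed.
Lemma Im_nat n : Im (n%:R : R[i]) = 0.
Proof. by elim: n => // n IH; rewrite -addn1 !natrD ImD IH addr0. Qed.
Lemma Re1 : Re (1 : R[i]) = 1. Proof. by []. Qed.
Lemma Im1 : Im (1 : R[i]) = 0. Proof. by []. Qed.
Lemma Re0 : Re (0 : R[i]) = 0. Proof. by []. Qed.
Lemma Im0 : Im (0 : R[i]) = 0. Proof. by []. Qed.

Definition ReImE := (Re_C, Im_C, Re_real, Im_real, Re1, Im1, Re0, Im0, Re_nat,
  Im_nat, ReD, ImD, ReN, ImN, Re_mul, Im_mul).

Lemma complex_ext z w : Re z = Re w -> Im z = Im w -> z = w.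
Proof. by case: z => a b; case: w => c d /= -> ->. Qed.

Lemma cmod_normc z : cmod z = ComplexField.Normc.normc z.
Proof. by case: z. Qed.

Lemma cmod_ge0 z : 0 <= cmod z. Proof. exact: sqrtr_ge0. Qed.
Lemma cmodM z w : cmod (z * w) = cmod z * cmod w.
Proof. by rewrite !cmod_normc ComplexField.Normc.normcM. Qed.
Lemma cmodV z : cmod z^-1 = (cmod z)^-1.
Proof. by rewrite !cmod_normc ComplexField.Normc.normcV. Qed.
Lemma cmodD z w : cmod (z + w) <= cmod z + cmod w.
Proof. by rewrite !cmod_normc le_normcD. Qed.
Lemma cmodN z : cmod (- z) = cmod z.
Proof. by rewrite !cmod_normc normcN. Qed.
Lemma cmodB z w : cmod (z - w) <= cmod z + cmod w.
Proof. by rewrite -(cmodN w) cmodD. Qed.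
Lemma cmod_real x : cmod x%:C = `|x|.
Proof. by rewrite /cmod /= expr0n /= addr0 sqrtr_sqr. Qed.
Lemma cmod0 : cmod (0 : R[i]) = 0.
Proof. by rewrite -[0]/((0:R)%:C) cmod_real normr0. Qed.
Lemma cmod1 : cmod (1 : R[i]) = 1.
Proof. by rewrite -[1]/((1:R)%:C) cmod_real normr1. Qed.
Lemma cmod_eq0 z : (cmod z == 0) = (z == 0).
Proof.
apply/eqP/eqP => [|->]; last exact: cmod0.
by rewrite cmod_normc => /ComplexField.Normc.eq0_normc.
Qed.
Lemma cmod_gt0 z : (0 < cmod z) = (z != 0).
Proof. by rewrite lt_def cmod_ge0 andbT cmod_eq0. Qed.
Lemma cmodX z n : cmod (z ^+ n) = cmod z ^+ n.
Proof.
by elim: n => [|n IH]; rewrite ?expr0 ?cmod1// !exprS cmodM IH.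
Qed.
Lemma sqr_cmod z : cmod z ^+ 2 = Re z ^+ 2 + Im z ^+ 2.
Proof. by rewrite sqr_sqrtr// addr_ge0 ?sqr_ge0. Qed.
Lemma Re_cmod z : `|Re z| <= cmod z.
Proof. by rewrite -(sqrtr_sqr (Re z)) ler_sqrt ?addr_ge0 ?sqr_ge0// lerDl sqr_ge0. Qed.
Lemma Im_cmod z : `|Im z| <= cmod z.
Proof. by rewrite -(sqrtr_sqr (Im z)) ler_sqrt ?addr_ge0 ?sqr_ge0// lerDr sqr_ge0. Qed.
Lemma cmod_ReIm z : cmod z <= `|Re z| + `|Im z|.
Proof.
rewrite -(ler_pXn2r (n := 2)) ?nnegrE ?cmod_ge0 ?addr_ge0//.
rewrite sqr_cmod sqrrD !real_normK ?num_real// lerD2r lerDl.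
by rewrite mulrn_wge0// mulr_ge0.
Qed.
Lemma cmodMi z : cmod ('i%C * z) = cmod z.
Proof. by rewrite cmodM /cmod /= expr0n expr1n add0r sqrtr1 mul1r. Qed.

Lemma i_real_sqr : 'i%C * 'i%C = - 1 :> R[i].
Proof. by rewrite -expr2 sqr_i. Qed.

Lemma cexpD z w : cexp (z + w) = cexp z * cexp w.
Proof.
rewrite /cexp ReD ImD expRD.
by apply: complex_ext; rewrite !ReImE ?sinD ?cosD; ring.
Qed.

Lemma cexp_real x : cexp x%:C = (expR x)%:C.
Proof. by rewrite /cexp /= cos0 sin0 mulr1. Qed.

Lemma cexp0 : cexp 0 = 1 :> R[i].
Proof. by rewrite -[0]/((0:R)%:C) cexp_real expR0. Qed.

Lemma cmod_cexp z : cmod (cexp z) = expR (Re z).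
Proof.
rewrite cmodM cmod_real ger0_norm ?expR_ge0// /cmod /=.
by rewrite cos2Dsin2 sqrtr1 mulr1.
Qed.

Lemma cexp_neq0 z : cexp z != 0.
Proof. by rewrite -cmod_gt0 cmod_cexp expR_gt0. Qed.

Lemma cexpN z : cexp (- z) = (cexp z)^-1.
Proof.
apply: (mulfI (cexp_neq0 z)); rewrite divff ?cexp_neq0//.
by rewrite -cexpD subrr cexp0.
Qed.

Lemma cexpX z n : cexp (n%:R * z) = cexp z ^+ n.
Proof.
elim: n => [|n IH]; first by rewrite mul0r cexp0 expr0.
by rewrite exprS -IH -cexpD -[n.+1]add1n natrD mulrDl mul1r.
Qed.

Lemma sin_le_id x : `|sin x| <= `|x|.
Proof.
wlog x0 : x / 0 <= x => [hw|].
  have [/hw //|/ltW x0] := leP 0 x.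
  by rewrite -normrN -sinN -[`|x|]normrN hw// oppr_ge0.
have [] := @MVT_segment R (@sin R) (@cos R) 0 x x0.
  by apply: continuous_subspaceT => y; exact: continuous_sin.
move=> c _; rewrite sin0 !subr0 => ->; rewrite normrM ler_piMl//.
by rewrite ler_norml cos_geN1 cos_le1.
Qed.

Lemma cos_sub1 x : `|cos x - 1| <= x ^+ 2.
Proof.
have -> : cos x - 1 = - (2 * sin (x / 2) ^+ 2).
  have hx : x = x / 2 *+ 2 by rewrite -mulr_natr; field.
  rewrite [in LHS]hx cos_mulr2n.
  by have := cos2Dsin2 (x / 2); rewrite -mulr_natr; lra.
rewrite normrN ger0_norm; last by rewrite mulr_ge0 ?sqr_ge0.
have : sin (x / 2) ^+ 2 <= (x / 2) ^+ 2.
  have := sin_le_id (x / 2).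
  by rewrite -(ler_pXn2r (n := 2)) ?nnegrE ?normr_ge0// !real_normK ?num_real.
by have := sqr_ge0 x; rewrite exprMn expr2 !exprVn; lra.
Qed.

Lemma cos_sub1_id x : `|cos x - 1| <= `|x|.
Proof.
wlog x0 : x / 0 <= x => [hw|].
  have [/hw //|/ltW x0] := leP 0 x.
  by rewrite -cosN -[`|x|]normrN hw// oppr_ge0.
have [] := @MVT_segment R (@cos R) (fun y => - sin y) 0 x x0.
  by apply: continuous_subspaceT => y; exact: continuous_cos.
move=> c _; rewrite cos0 subr0 => ->; rewrite normrM ler_piMl// normrN.
by rewrite ler_norml sin_geN1 sin_le1.
Qed.

Lemma sin_sub_id x : `|sin x - x| <= x ^+ 2.
Proof.
wlog x0 : x / 0 <= x => [hw|].
  have [/hw //|/ltW x0] := leP 0 x.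
  by rewrite -normrN opprD -sinN -[x ^+ 2]sqrrN hw// oppr_ge0.
have [] := @MVT_segment R (fun y => sin y - y) (fun y => cos y - 1) 0 x x0.
  apply: continuous_subspaceT => y; apply: cvgB; first exact: continuous_sin.
  exact: cvg_id.
move=> c; rewrite in_itv /= => /andP[c0 cx]; rewrite sin0 !subr0 => ->.
rewrite normrM (ger0_norm x0) expr2 ler_wpM2r//.
by rewrite (le_trans (cos_sub1_id c))// ger0_norm.
Qed.

Lemma expR_sub1 x : `|expR x - 1| <= `|x| * expR `|x|.
Proof.
have [x0|x0] := leP 0 x.
  have h : expR x - 1 <= x * expR x.
    have := expR_ge1Dx (- x); rewrite expRN => h.
    have e0 := expR_gt0 x.
    have : (1 + - x) * expR x <= 1 by rewrite -ler_pdivlMr// div1r.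
    by lra.
  rewrite (ger0_norm x0) ger0_norm// subr_ge0.
  by rewrite -expR0 ler_expR.
have := expR_ge1Dx x; have : expR x < 1 by rewrite -expR0 ltr_expR.
move=> h1 h2; rewrite (ltr0_norm x0) ler0_norm; last by rewrite subr_le0 ltW.
have : - x <= - x * expR (- x) by rewrite ler_peMr ?oppr_ge0 1?ltW// -expR0 ltr_expR oppr_gt0.
move=> h3; have h4 : - (expR x - 1) <= - x by lra.
exact: le_trans h4 h3.
Qed.

Lemma expR_sub1_id x : `|expR x - 1 - x| <= x ^+ 2 * expR `|x|.
Proof.
have h0 := expR_ge1Dx x.
rewrite ger0_norm; last by lra.
have h1 : expR x - 1 - x <= x * (expR x - 1).
  have := expR_ge1Dx (- x); rewrite expRN => h.
  have e0 := expR_gt0 x.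
  have : (1 + - x) * expR x <= 1 by rewrite -ler_pdivlMr// div1r.
  by lra.
rewrite (le_trans h1)// (le_trans (ler_norm _))// normrM expr2.
rewrite -[x * x]ger0_norm; last by rewrite -expr2 sqr_ge0.
by rewrite normrM -mulrA ler_wpM2l// expR_sub1.
Qed.

(** The bound holds for all [w], not only small ones, because [lap_cdiff] integrates it over
    unbounded values of the phase. The remainder splits into three terms, each controlled by
    one-variable remainders of exp, cos and sin. *)
Lemma cexp_sub1_id w :
  cmod (cexp w - 1 - w) <= 3 * cmod w ^+ 2 * expR (cmod w).
Proof.
pose a := Re w; pose b := Im w.
have -> : cexp w - 1 - w = (expR a - 1 - a)%:C +
   (expR a)%:C * ((cos b - 1) +i* (sin b - b)) + 'i%C * (b * (expR a - 1))%:C.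
  apply: complex_ext; rewrite /cexp !ReImE -/a -/b; ring.
have eE : 0 < expR (cmod w) by exact: expR_gt0.
have aw : `|a| <= cmod w by exact: Re_cmod.
have bw : `|b| <= cmod w by exact: Im_cmod.
have ea : expR `|a| <= expR (cmod w) by rewrite ler_expR.
have e1 : expR a <= expR (cmod w) by rewrite ler_expR (le_trans (ler_norm _)).
rewrite (le_trans (cmodD _ _))//.
have h1 : cmod ('i * (b * (expR a - 1))%:C)
    <= `|a| * `|b| * expR (cmod w).
  rewrite cmodMi cmod_real normrM [`|a| * _]mulrC -mulrA ler_wpM2l//.
  by rewrite (le_trans (expR_sub1 a))// ler_wpM2l.
have h2 : cmod (expR a - 1 - a)%:C <= a ^+ 2 * expR (cmod w).
  by rewrite cmod_real (le_trans (expR_sub1_id a))// ler_wpM2l ?sqr_ge0.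
have h3 : cmod ((expR a)%:C * ((cos b - 1) +i* (sin b - b)))
    <= (b ^+ 2 + b ^+ 2) * expR (cmod w).
  rewrite cmodM cmod_real ger0_norm ?expR_ge0// mulrC ler_pM ?cmod_ge0 ?expR_ge0//.
  by rewrite (le_trans (cmod_ReIm _))//= lerD ?cos_sub1 ?sin_sub_id.
have := cmodD (expR a - 1 - a)%:C ((expR a)%:C * ((cos b - 1) +i* (sin b - b))).
have hab : `|a| * `|b| <= (a ^+ 2 + b ^+ 2) / 2.
  rewrite -(real_normK (num_real a)) -(real_normK (num_real b)).
  by have := sqr_ge0 (`|a| - `|b|); rewrite sqrrB; lra.
have : `|a| * `|b| * expR (cmod w) <= (a ^+ 2 + b ^+ 2) / 2 * expR (cmod w).
  by rewrite ler_wpM2r// ltW.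
have := sqr_cmod w; rewrite -/a -/b => ->.
have : 0 <= a ^+ 2 * expR (cmod w) by rewrite mulr_ge0 ?sqr_ge0// ltW.
have : 0 <= b ^+ 2 * expR (cmod w) by rewrite mulr_ge0 ?sqr_ge0// ltW.
lra.
Qed.

End ComplexBasics.

(** * Complex derivatives *)

Section ComplexDiff.
Variable R : realType.
Implicit Types (x y t : R) (z w h l : R[i]) (f g : R[i] -> R[i]).

(** Complex derivative phrased with real-valued moduli, so that integral estimates yield it
    directly. [cdiff_cderiv] obtains it from the derivative used for the Lommel function. *)
Definition cdiff f z l := forall e : R, 0 < e -> exists2 d : R, 0 < d &
  forall h, cmod h < d -> cmod (f (z + h) - f z - l * h) <= e * cmod h.

Lemma cdiff_quad f z l (K d : R) : 0 < d ->
  (forall h, cmod h < d -> cmod (f (z + h) - f z - l * h) <= K * cmod h ^+ 2) ->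
  cdiff f z l.
Proof.
move=> d0 H e e0; pose K' := `|K| + 1.
have sqrt_2pi : 0 < K' by rewrite ltr_wpDl.
exists (Num.min d (e / K')); first by rewrite lt_min d0 divr_gt0.
move=> h; rewrite lt_min => /andP[hd he]; rewrite (le_trans (H h hd))//.
rewrite expr2 mulrA ler_wpM2r ?cmod_ge0//.
have : cmod h * K' <= e by rewrite -ler_pdivlMr// ltW.
apply: le_trans; rewrite mulrC ler_wpM2l ?cmod_ge0// /K'.
by rewrite (le_trans (ler_norm _))// lerDl.
Qed.

Lemma cdiff_lip f z l : cdiff f z l -> exists d : R, 0 < d /\
  forall h, cmod h < d -> cmod (f (z + h) - f z) <= (cmod l + 1) * cmod h.
Proof.
move=> /(_ 1 ltr01)[d d0 H]; exists d; split => // h /H hh.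
have -> : f (z + h) - f z = (f (z + h) - f z - l * h) + l * h by rewrite subrK.
rewrite (le_trans (cmodD _ _))// cmodM mulrDl mul1r addrC lerD2l.
by rewrite (le_trans hh)// mul1r.
Qed.

Lemma cdiff_ext f g z l (d : R) : 0 < d ->
  (forall h, cmod h < d -> f (z + h) = g (z + h)) -> cdiff f z l -> cdiff g z l.
Proof.
move=> d0 fg H e e0; have [d' d'0 H'] := H e e0.
exists (Num.min d d'); first by rewrite lt_min d0.
move=> h; rewrite lt_min => /andP[hd hd']; rewrite -fg// -[in g z](addr0 z) -fg ?cmod0//.
by rewrite addr0 H'.
Qed.

Lemma cdiff_cst c z : cdiff (fun=> c) z 0.
Proof.
by apply: (@cdiff_quad _ _ _ 0 1) => // h _; rewrite subrr mul0r subr0 cmod0 mul0r.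
Qed.

Lemma cdiff_id z : cdiff id z 1.
Proof.
apply: (@cdiff_quad _ _ _ 0 1) => // h _.
by rewrite mul1r [z + h]addrC addrK subrr cmod0 mul0r.
Qed.

Lemma cdiffD f g z l l' : cdiff f z l -> cdiff g z l' ->
  cdiff (fun w => f w + g w) z (l + l').
Proof.
move=> Hf Hg e e0.
have e2 : 0 < e / 2 by rewrite divr_gt0.
have [d d0 H] := Hf _ e2; have [d' d'0 H'] := Hg _ e2.
exists (Num.min d d'); first by rewrite lt_min d0.
move=> h; rewrite lt_min => /andP[/H {}H /H' {}H'].
have -> : f (z + h) + g (z + h) - (f z + g z) - (l + l') * h =
  (f (z + h) - f z - l * h) + (g (z + h) - g z - l' * h) by ring.
by rewrite (le_trans (cmodD _ _))// (splitr e) mulrDl lerD.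
Qed.

Lemma cdiffM f g z l l' : cdiff f z l -> cdiff g z l' ->
  cdiff (fun w => f w * g w) z (l * g z + f z * l').
Proof.
move=> Hf Hg e e0.
pose K := cmod (f z) + cmod (g z) + cmod l + cmod l' + 1.
have K1 : 1 <= K by rewrite lerDr !addr_ge0 ?cmod_ge0.
have sqrt_2pi : 0 < K by exact: lt_le_trans K1.
pose e' := e / (3 * K ^+ 2).
have e'0 : 0 < e' by rewrite divr_gt0 ?mulr_gt0 ?exprn_gt0.
have [d d0 H] := Hf _ e'0; have [d' d'0 H'] := Hg _ e'0.
have [d1 [d10 L]] := cdiff_lip Hf; have [d2 [d20 L']] := cdiff_lip Hg.
exists (Num.min (Num.min d d') (Num.min (Num.min d1 d2) e')).
  by rewrite !lt_min d0 d'0 d10 d20.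
move=> h; rewrite !lt_min => /and3P[/andP[/H {}H /H' {}H'] /andP[/L {}L /L' {}L'] he].
have -> : f (z + h) * g (z + h) - f z * g z - (l * g z + f z * l') * h =
  (f (z + h) - f z - l * h) * g z + f z * (g (z + h) - g z - l' * h)
  + (f (z + h) - f z) * (g (z + h) - g z) by ring.
have h0 := cmod_ge0 h.
have fz : cmod (f z) <= K by rewrite /K -!addrA lerDl !addr_ge0 ?cmod_ge0.
have gz : cmod (g z) <= K 
  by rewrite /K; have := cmod_ge0 (f z); have := cmod_ge0 l; have := cmod_ge0 l'; lra.
have lz : cmod l + 1 <= K.
  by rewrite /K; have := cmod_ge0 (f z); have := cmod_ge0 (g z); have := cmod_ge0 l'; lra.
have lz' : cmod l' + 1 <= K.
  by rewrite /K; have := cmod_ge0 (f z); have := cmod_ge0 (g z); have := cmod_ge0 l; lra.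
have a1 : cmod ((f (z + h) - f z - l * h) * g z) <= e' * K ^+ 2 * cmod h.
  rewrite cmodM; apply: (@le_trans _ _ ((e' * cmod h) * K)).
    by apply: ler_pM; rewrite ?cmod_ge0.
  rewrite [e' * cmod h * K]mulrAC ler_wpM2r// ler_wpM2l ?(ltW e'0)//.
  by rewrite expr2 ler_peMr// ltW.
have a2 : cmod (f z * (g (z + h) - g z - l' * h)) <= e' * K ^+ 2 * cmod h.
  rewrite cmodM; apply: (@le_trans _ _ (K * (e' * cmod h))).
    by apply: ler_pM; rewrite ?cmod_ge0.
  rewrite mulrA [K * e']mulrC ler_wpM2r// ler_wpM2l ?(ltW e'0)//.
  by rewrite expr2 ler_peMr// ltW.
have a3 : cmod ((f (z + h) - f z) * (g (z + h) - g z)) <= e' * K ^+ 2 * cmod h.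
  rewrite cmodM; apply: (@le_trans _ _ ((K * cmod h) * (K * e'))).
    apply: ler_pM; rewrite ?cmod_ge0//.
      by rewrite (le_trans L)// ler_wpM2r.
    rewrite (le_trans L')// ler_pM ?addr_ge0 ?cmod_ge0//.
    by rewrite ltW.
  by rewrite le_eqVlt; apply/orP; left; apply/eqP; ring.
have e3 : e = e' * K ^+ 2 + e' * K ^+ 2 + e' * K ^+ 2.
  by rewrite /e'; field; rewrite gt_eqF.
have -> : e * cmod h = e' * K ^+ 2 * cmod h + e' * K ^+ 2 * cmod h
    + e' * K ^+ 2 * cmod h by rewrite {1}e3 !mulrDl.
rewrite (le_trans (cmodD _ _))// lerD//.
by rewrite (le_trans (cmodD _ _))// lerD.
Qed.

Lemma cdiffZ c f z l : cdiff f z l -> cdiff (fun w => c * f w) z (c * l).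
Proof. by move=> /(cdiffM (cdiff_cst c z)); rewrite mul0r add0r. Qed.

Lemma cdiffB f g z l l' : cdiff f z l -> cdiff g z l' ->
  cdiff (fun w => f w - g w) z (l - l').
Proof.
move=> Hf /(cdiffZ (-1)) Hg.
have := cdiffD Hf Hg; rewrite mulN1r.
by under [X in cdiff X]eq_fun do rewrite mulN1r.
Qed.

Lemma cdiff_sum (I : Type) (s : seq I) (F : I -> R[i] -> R[i]) z (L : I -> R[i]) :
  (forall i, cdiff (F i) z (L i)) ->
  cdiff (fun w => \sum_(i <- s) F i w) z (\sum_(i <- s) L i).
Proof.
move=> H; elim: s => [|i s IH].
  rewrite big_nil; under [X in cdiff X]eq_fun do rewrite big_nil.
  exact: cdiff_cst.
rewrite big_cons; under [X in cdiff X]eq_fun do rewrite big_cons.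
exact: (cdiffD (H i) IH).
Qed.

Lemma cdiff_comp f g z l l' : cdiff f (g z) l -> cdiff g z l' ->
  cdiff (fun w => f (g w)) z (l * l').
Proof.
move=> Hf Hg e e0.
have [d1 [d10 L]] := cdiff_lip Hg.
pose K := cmod l + cmod l' + 1.
have sqrt_2pi : 0 < K by rewrite ltr_wpDl ?addr_ge0 ?cmod_ge0.
have K1 : cmod l' + 1 <= K by rewrite /K -addrA lerDr cmod_ge0.
have K2 : cmod l <= K by rewrite /K -addrA lerDl addr_ge0 ?cmod_ge0.
pose e' := e / (2 * K).
have e'0 : 0 < e' by rewrite divr_gt0 ?mulr_gt0.
have [d d0 H] := Hf _ e'0; have [d' d'0 H'] := Hg _ e'0.
exists (Num.min (Num.min d' d1) (d / K)); first by rewrite !lt_min d'0 d10 divr_gt0.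
move=> h; rewrite !lt_min => /andP[/andP[/H' {}H' /L {}L] hd].
pose k := g (z + h) - g z.
have gk : g (z + h) = g z + k by rewrite /k [RHS]addrC subrK.
have kh : cmod k <= K * cmod h by rewrite (le_trans L)// ler_wpM2r ?cmod_ge0.
have kd : cmod k < d.
  by rewrite (le_lt_trans kh)// mulrC -ltr_pdivlMr.
have -> : f (g (z + h)) - f (g z) - l * l' * h =
   (f (g z + k) - f (g z) - l * k) + l * (g (z + h) - g z - l' * h).
  by rewrite gk -/k; ring.
have a1 := H _ kd.
have a2 : cmod (l * (g (z + h) - g z - l' * h)) <= K * (e' * cmod h).
  by rewrite cmodM ler_pM ?cmod_ge0.
rewrite (le_trans (cmodD _ _))//.
have -> : e * cmod h = e' * (K * cmod h) + K * (e' * cmod h).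
  by rewrite /e'; field; rewrite gt_eqF.
by rewrite lerD// (le_trans a1)// ler_wpM2l// ltW.
Qed.

Lemma cdiff_cexp z : cdiff (@cexp R) z (cexp z).
Proof.
apply: (@cdiff_quad _ _ _ (cmod (cexp z) * (3 * expR 1)) 1) => // h h1.
have -> : cexp (z + h) - cexp z - cexp z * h = cexp z * (cexp h - 1 - h).
  by rewrite cexpD; ring.
rewrite cmodM -mulrA ler_wpM2l ?cmod_ge0// (le_trans (cexp_sub1_id _))//.
rewrite mulrAC ler_wpM2r ?sqr_ge0// ler_wpM2l//.
by rewrite ler_expR ltW.
Qed.

(** With k = g (z + h) - g z, differentiability of f at g z says h - l k = o(k). The Lipschitz bound
    on g turns o(k) into o(h), and one divides by l. The case in view is the logarithm as inverse of
    the exponential. *)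
Lemma cdiff_inverse f g z l (K d : R) : 0 < d -> l != 0 ->
  (forall h, cmod h < d -> cmod (g (z + h) - g z) <= K * cmod h) ->
  (forall h, cmod h < d -> f (g (z + h)) = z + h) ->
  cdiff f (g z) l -> cdiff g z l^-1.
Proof.
move=> d0 l0 gL fg Hf e e0.
have cl0 : 0 < cmod l by rewrite cmod_gt0.
pose K' := `|K| + 1; have K'0 : 0 < K' by rewrite ltr_wpDl.
pose e' := e * cmod l / K'; have e'0 : 0 < e' by rewrite !mulr_gt0 ?invr_gt0.
have [d' d'0 H] := Hf _ e'0.
exists (Num.min d (d' / K')); first by rewrite lt_min d0 divr_gt0.
move=> h; rewrite lt_min => /andP[hd hd'].
pose k := g (z + h) - g z.
have kh : cmod k <= K' * cmod h.
  rewrite (le_trans (gL _ hd))// ler_wpM2r ?cmod_ge0//.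
  by rewrite (le_trans (ler_norm _))// lerDl.
have kd : cmod k < d' by rewrite (le_lt_trans kh)// mulrC -ltr_pdivlMr.
have := H k kd; rewrite [g z + k]addrC subrK fg//.
have := fg 0; rewrite cmod0 addr0 => ->//.
rewrite {1}[z + h]addrC addrK => Hk.
have -> : g (z + h) - g z - l^-1 * h = - l^-1 * (h - l * k).
  by rewrite /k; field.
rewrite cmodM cmodN cmodV mulrC ler_pdivrMr// (le_trans Hk)//.
have -> : e * cmod h * cmod l = e' * (K' * cmod h).
  by rewrite /e'; field; rewrite gt_eqF.
by rewrite ler_wpM2l// ltW.
Qed.

Lemma cdiff_inv z : z != 0 -> cdiff (fun w => w^-1) z (- z ^- 2).
Proof.
move=> z0; have cz0 : 0 < cmod z by rewrite cmod_gt0.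
apply: (@cdiff_quad _ _ _ (2 / cmod z ^+ 3) (cmod z / 2)); first by rewrite divr_gt0.
move=> h hz.
have zh : cmod z / 2 <= cmod (z + h).
  have := cmodB (z + h) h; rewrite addrK => ?; lra.
have zh0 : z + h != 0 by rewrite -cmod_gt0 (lt_le_trans _ zh)// divr_gt0.
have -> : (z + h)^-1 - z^-1 - - z ^- 2 * h = h ^+ 2 / (z ^+ 2 * (z + h)).
  by field; rewrite z0 zh0.
rewrite cmodM cmodV cmodM !cmodX mulrC ler_wpM2r ?exprn_ge0 ?cmod_ge0//.
rewrite -[2]invrK -invfM lef_pV2 ?posrE ?mulr_gt0 ?exprn_gt0 ?cmod_gt0 ?invr_gt0//.
by rewrite exprSr mulrCA ler_wpM2l ?exprn_ge0 ?cmod_ge0// mulrC.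
Qed.

End ComplexDiff.

(** * Logarithm and powers on the right half-plane *)

Section ComplexLog.
Variable R : realType.
Implicit Types (x y t : R) (z w h l : R[i]).

Lemma carg_cexp w : `|Im w| < pi -> carg (cexp w) = Im w.
Proof.
rewrite ltr_norml => /andP[h1 h2]; rewrite /carg cmod_cexp /cexp !ReImE.
have e0 : expR (Re w) != 0 by rewrite gt_eqF ?expR_gt0.
rewrite !mul0r subr0 addr0 mulrAC divff// mul1r pmulr_rge0 ?expR_gt0//.
have [w0|w0] := leP 0 (Im w).
  by rewrite sin_ge0_pi ?cosK// ?in_itv /= w0 ltW.
have -> : (0 <= sin (Im w)) = false.
  apply/negP; apply/negP; rewrite -ltNge -oppr_gt0 -sinN sin_gt0_pi//.
  by rewrite oppr_gt0 w0 ltrNl.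
by rewrite cosKN ?opprK// ltW//= ltW.
Qed.

Lemma clog_cexp w : `|Im w| < pi -> clog (cexp w) = w.
Proof.
move=> w1; rewrite /clog carg_cexp// cmod_cexp expRK.
by case: w w1.
Qed.

Lemma pi2_lt_pi : pi / 2 < pi :> R.
Proof. by have := pi_gt0 R; lra. Qed.

(** The logarithm on Re z > 0 through [atan], which is Lipschitz; the [acos] in [carg] has infinite
    slope at 1, the value met on the positive axis. *)
Definition clog_right z : R[i] := ln (cmod z) +i* atan (Im z / Re z).

Lemma Im_clog_right z : `|Im (clog_right z)| < pi / 2.
Proof. by rewrite /= ltr_norml atan_gtNpi2 atan_ltpi2. Qed.

Lemma cexp_clog_right z : 0 < Re z -> cexp (clog_right z) = z.
Proof.
move=> z0.
have cz0 : 0 < cmod z.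
  by rewrite (lt_le_trans z0)// (le_trans (ler_norm _))// Re_cmod.
have cosE : cos (atan (Im z / Re z)) = Re z / cmod z.
  have -> : cmod z = Num.sqrt ((Re z) ^+ 2 * (1 + (Im z / Re z) ^+ 2)).
    by rewrite /cmod; congr Num.sqrt; field; rewrite gt_eqF.
  rewrite cos_atan sqrtrM ?sqr_ge0// sqrtr_sqr gtr0_norm//.
  by rewrite invfM mulrA divff ?mul1r ?gt_eqF.
have sinE : sin (atan (Im z / Re z)) = Im z / cmod z.
  have := atanK (Im z / Re z); rewrite /tan cosE => /(congr1 ( *%R^~ (Re z / cmod z))).
  rewrite divfK; last by rewrite mulf_neq0 ?invr_neq0 ?gt_eqF.
  move=> ->; field; rewrite !gt_eqF//.
by apply: complex_ext; rewrite /cexp !ReImE lnK ?posrE// cosE sinE; field; rewrite gt_eqF.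
Qed.

Lemma clogE z : 0 < Re z -> clog z = clog_right z.
Proof.
move=> z0; rewrite -{1}(cexp_clog_right z0) clog_cexp//.
by rewrite (lt_trans (Im_clog_right z))// pi2_lt_pi.
Qed.

Lemma cexp_clog z : 0 < Re z -> cexp (clog z) = z.
Proof. by move=> z0; rewrite clogE// cexp_clog_right. Qed.

Lemma Im_clog z : 0 < Re z -> `|Im (clog z)| < pi / 2.
Proof. by move=> z0; rewrite clogE// Im_clog_right. Qed.

Lemma carg_right z : 0 < Re z -> `|carg z| < pi / 2.
Proof. by move=> /Im_clog. Qed.

Lemma clog_real x : 0 < x -> clog x%:C = (ln x)%:C.
Proof.
by move=> x0; rewrite clogE// /clog_right /= mul0r atan0 cmod_real gtr0_norm.
Qed.

Lemma ln_lip x y : 0 < x -> x / 2 <= y -> `|ln y - ln x| <= 2 / x * `|y - x|.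
Proof.
move=> x0 xy; have y0 : 0 < y by rewrite (lt_le_trans _ xy)// divr_gt0.
have H (a b : R) : 0 < a -> 0 < b -> ln b - ln a <= (b - a) / a.
  move=> a0 b0; rewrite -ln_div ?posrE//.
  have := @le_ln1Dx R ((b - a) / a).
  have -> : 1 + (b - a) / a = b / a by field; rewrite gt_eqF.
  apply; rewrite mulrBl divff ?gt_eqF// ltrBrDl subrr.
  by rewrite divr_gt0.
rewrite ler_norml; apply/andP; split; last first.
  rewrite (le_trans (H x y x0 y0))// mulrC.
  rewrite (le_trans (ler_norm _))// normrM [`|x^-1|]gtr0_norm ?invr_gt0//.
  by rewrite ler_wpM2r// ler_peMl ?ler1n ?invr_ge0 ?(ltW x0).
rewrite lerNl opprB (le_trans (H y x y0 x0))// mulrC.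
rewrite (le_trans (ler_norm _))// normrM [`|y^-1|]gtr0_norm ?invr_gt0//.
rewrite distrC ler_wpM2r//.
by rewrite -[2]invrK -invfM lef_pV2 ?posrE ?mulr_gt0 ?invr_gt0// mulrC.
Qed.

Lemma atan_lip x y : `|atan y - atan x| <= `|y - x|.
Proof.
wlog xy : x y / x <= y => [hw|].
  have [/hw //|/ltW yx] := leP x y.
  by rewrite distrC [leRHS]distrC hw.
have [] := @MVT_segment R (@atan R) (fun c => (1 + c ^+ 2)^-1) x y xy.
  by apply: continuous_subspaceT => c; exact: continuous_atan.
move=> c _ ->; rewrite normrM ler_piMl// ger0_norm ?invr_ge0 ?addr_ge0 ?sqr_ge0//.
by rewrite invf_le1 ?ltr_pwDl ?sqr_ge0// lerDl sqr_ge0.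
Qed.

Lemma clog_lip z : 0 < Re z -> exists (K d : R), [/\ 0 < d,
  forall h, cmod h < d -> 0 < Re (z + h) &
  forall h, cmod h < d -> cmod (clog (z + h) - clog z) <= K * cmod h].
Proof.
move=> z0; pose a := Re z; pose b := Im z.
have cz0 : 0 < cmod z.
  by rewrite (lt_le_trans z0)// (le_trans (ler_norm _))// Re_cmod.
have hR h : cmod h < a / 2 -> a / 2 < Re (z + h).
  move=> ha; rewrite ReD -/a; have := Re_cmod h; rewrite ler_norml => /andP[? _].
  lra.
exists (2 / cmod z + (a + `|b|) * 2 / a ^+ 2), (a / 2); split.
- by rewrite divr_gt0.
- by move=> h /hR; apply: lt_trans; rewrite divr_gt0.
move=> h ha; have zh0 := hR _ ha.
have zh : 0 < Re (z + h) by rewrite (lt_trans _ zh0)// divr_gt0.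
rewrite !clogE// (le_trans (cmod_ReIm _))// mulrDl ReB ImB /= lerD//.
  have hz : `|cmod (z + h) - cmod z| <= cmod h.
    have := cmodD z h; have := cmodB (z + h) h; rewrite addrK => h1 h2.
    by rewrite ler_norml; apply/andP; split; lra.
  apply: (le_trans (ln_lip cz0 _)).
    have : a <= cmod z by rewrite (le_trans (ler_norm _))// Re_cmod.
    by move: hz; rewrite ler_norml => /andP[h1 _] ?; lra.
  by rewrite ler_wpM2l// divr_ge0 ?ltW.
rewrite (le_trans (atan_lip _ _))//.
rewrite ReD ImD -/a -/b; rewrite ReD -/a in zh zh0.
have a0 : 0 < a by [].
have -> : (b + Im h) / (a + Re h) - b / a = (a * Im h - b * Re h) / (a * (a + Re h)).
  by field; rewrite !gt_eqF.
rewrite normrM [`|_^-1|]gtr0_norm ?invr_gt0 ?mulr_gt0// ler_pdivrMr ?mulr_gt0//.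
have t1 : `|a * Im h - b * Re h| <= (a + `|b|) * cmod h.
  rewrite (le_trans (ler_normB _ _))// mulrDl !normrM (gtr0_norm a0).
  by rewrite lerD// ler_wpM2l ?Im_cmod ?Re_cmod// ltW.
rewrite (le_trans t1)//.
have -> : (a + `|b|) * 2 / a ^+ 2 * cmod h * (a * (a + Re h)) =
  ((a + `|b|) * cmod h) * ((a + Re h) / (a / 2)) by field; rewrite gt_eqF.
rewrite ler_peMr ?mulr_ge0 ?cmod_ge0 ?addr_ge0 ?(ltW a0)//.
by rewrite ler_pdivlMr ?mul1r ?ltW// divr_gt0.
Qed.

Lemma cdiff_clog z : 0 < Re z -> cdiff (@clog R) z z^-1.
Proof.
move=> z0; have [K [d [d0 hd hK]]] := clog_lip z0.
have zn0 : z != 0 by apply: contraTneq z0 => ->; rewrite ltxx.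
apply: (cdiff_inverse (f := @cexp R) d0 zn0 hK) => [h /hd|].
  exact: cexp_clog.
by have := cdiff_cexp (clog z); rewrite cexp_clog.
Qed.

Lemma cpowD z p q : cpow z (p + q) = cpow z p * cpow z q.
Proof. by rewrite /cpow mulrDl cexpD. Qed.

Lemma cpow0 z : cpow z 0 = 1.
Proof. by rewrite /cpow mul0r cexp0. Qed.

Lemma cpowN z p : cpow z (- p) = (cpow z p)^-1.
Proof. by rewrite /cpow mulNr cexpN. Qed.

Lemma cpowB z p q : cpow z (p - q) = cpow z p / cpow z q.
Proof. by rewrite cpowD cpowN. Qed.

Lemma cpow_neq0 z p : cpow z p != 0.
Proof. exact: cexp_neq0. Qed.

Lemma cpow_nat z n : 0 < Re z -> cpow z n%:R = z ^+ n.
Proof. by move=> z0; rewrite /cpow cexpX cexp_clog. Qed.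

Lemma cpow1 z : 0 < Re z -> cpow z 1 = z.
Proof. by move=> z0; rewrite -[1]/(1%:R) cpow_nat ?expr1. Qed.

Lemma cpow_real x y : 0 < x -> cpow x%:C y%:C = (expR (y * ln x))%:C.
Proof. by move=> x0; rewrite /cpow clog_real// -rmorphM cexp_real. Qed.

(** A positive factor leaves the argument unchanged, so the sum of the two logarithms stays in the
    principal strip. *)
Lemma cpow_realM x z p : 0 < x -> 0 < Re z ->
  cpow (x%:C * z) p = cpow x%:C p * cpow z p.
Proof.
move=> x0 z0; rewrite /cpow -cexpD -mulrDr; congr (cexp (p * _)).
rewrite -[in LHS](cexp_clog z0) -[in LHS](@cexp_clog x%:C)// -cexpD clog_cexp//.
rewrite ImD clog_real//= add0r.
by rewrite (lt_trans (Im_clog z0))// pi2_lt_pi.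
Qed.

Lemma cdiff_cpow p z : 0 < Re z -> cdiff (fun w => cpow w p) z (p * cpow z (p - 1)).
Proof.
move=> z0; have zn0 : z != 0 by apply: contraTneq z0 => ->; rewrite ltxx.
have -> : p * cpow z (p - 1) = cpow z p * (p * z^-1).
  by rewrite cpowB cpow1//; ring.
apply: (@cdiff_comp _ (@cexp R) (fun w => p * clog w)); first exact: cdiff_cexp.
exact/cdiffZ/cdiff_clog.
Qed.

Fact cex_key : unit. Proof. by []. Qed.

(* [cexp] behind an opaque key, so that unification never unfolds it. *)
Definition cex z : R[i] := locked_with cex_key (cexp z).

Lemma cexE z : cex z = cexp z. Proof. by rewrite /cex unlock. Qed.
Lemma cexD z w : cex (z + w) = cex z * cex w. Proof. by rewrite !cexE cexpD. Qed.
Lemma cex0 : cex 0 = 1. Proof. by rewrite cexE cexp0. Qed.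
Lemma cexN z : cex (- z) = (cex z)^-1. Proof. by rewrite !cexE cexpN. Qed.
Lemma cex_real x : cex x%:C = (expR x)%:C. Proof. by rewrite cexE cexp_real. Qed.
Lemma cmod_cex z : cmod (cex z) = expR (Re z). Proof. by rewrite cexE cmod_cexp. Qed.
Lemma cex_neq0 z : cex z != 0. Proof. by rewrite cexE cexp_neq0. Qed.
Lemma cex_sub1_id w :
  cmod (cex w - 1 - w) <= 3 * cmod w ^+ 2 * expR (cmod w).
Proof. by rewrite cexE cexp_sub1_id. Qed.
Lemma cdiff_cex z : cdiff cex z (cex z).
Proof.
rewrite cexE; apply: cdiff_ext (cdiff_cexp z); first exact: ltr01.
by move=> h _; rewrite cexE.
Qed.
Lemma cex_clog z : 0 < Re z -> cex (clog z) = z.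
Proof. by move=> z0; rewrite cexE cexp_clog. Qed.
Lemma clog_cex w : `|Im w| < pi -> clog (cex w) = w.
Proof. by move=> h; rewrite cexE clog_cexp. Qed.
Lemma cpowE z p : cpow z p = cex (p * clog z). Proof. by rewrite cexE. Qed.
Lemma cpow_expR y p : cpow (expR y)%:C p = cex (p * y%:C).
Proof. by rewrite cpowE clog_real ?expR_gt0// expRK. Qed.

End ComplexLog.

(** * Uniqueness for Bessel's equation on the right half-plane *)

Section RealCalculus.
Variable R : realType.
Implicit Types (x y t : R).

Lemma scaleRE (a b : R) : a *: (b : R^o) = a * b. Proof. by []. Qed.

Lemma is_derive_eps (f : R -> R) x l :
  (forall e : R, 0 < e -> exists2 d : R, 0 < d &
    forall h, `|h| < d -> `|f (x + h) - f x - l * h| <= e * `|h|) ->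
  is_derive x (1 : R) f l.
Proof.
move=> H.
have Hl : h^-1 *: ((f \o shift x) (h *: (1 : R)) - f x) @[h --> 0^'] --> l.
  apply/cvgrPdist_le => e e0; have [d d0 Hd] := H e e0.
  near=> h.
  have h0 : h != 0 by near: h; exact: nbhs_dnbhs_neq.
  have hd : `|h| < d by near: h; apply: dnbhs0_lt.
  rewrite /= -[h *: 1]/(h * 1) mulr1 -[h^-1 *: _]/(h^-1 * _) [h + x]addrC.
  have -> : l - h^-1 * (f (x + h) - f x) = - (h^-1 * (f (x + h) - f x - l * h)).
    by field.
  rewrite normrN normrM normfV mulrC ler_pdivrMr ?normr_gt0//.
  exact: Hd.
split; last exact: cvg_lim Hl.
by apply/cvg_ex; exists l.
Unshelve. all: by end_near. Qed.

Lemma is_derive_continuous (f : R -> R) x l : is_derive x 1 f l ->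
  {for x, continuous f}.
Proof. by move=> H; apply/differentiable_continuous/derivable1_diffP; case: H. Qed.

Lemma derive_ge0_le (f f' : R -> R) a b : a <= b ->
  (forall x, a <= x <= b -> is_derive x 1 f (f' x)) ->
  (forall x, a <= x <= b -> 0 <= f' x) -> f a <= f b.
Proof.
move=> ab df f'0.
have [||c cab] := @MVT_segment R f f' a b ab.
- by move=> x xab; apply: df; move: xab; rewrite in_itv /= => /andP[/ltW -> /ltW ->].
- apply: continuous_in_subspaceT => x; rewrite inE /= in_itv /= => /df.
  exact: is_derive_continuous.
move: cab; rewrite in_itv /= -[f a <= f b]subr_ge0 => /f'0 c0 ->.
by rewrite mulr_ge0// subr_ge0.
Qed.

(** With m = n + 1, exp y >= (y / m)^m beats degree n by a whole factor y, and y is chosen so that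
    this factor outweighs the constants. *)
Lemma expR_gt_poly (c K P : R) n : 0 < c -> exists2 t : R, 0 <= t &
  K * (1 + t) ^+ n + P < c * expR t.
Proof.
move=> c0; pose m : R := n.+1%:R.
have m0 : 0 < m by rewrite ltr0n.
pose c' := c * expR (-1) / m ^+ n.+1.
have c'0 : 0 < c' by rewrite !mulr_gt0 ?expR_gt0 ?invr_gt0 ?exprn_gt0.
pose y := 1 + (`|K| + `|P| + 1) / c'.
have y1 : 1 <= y by rewrite lerDl divr_ge0 ?ltW// !addr_ge0.
have y0 : 0 < y by rewrite (lt_le_trans _ y1).
exists (y - 1); first by rewrite subr_ge0.
rewrite [1 + (y - 1)]addrC subrK expRD.
have h1 : (y / m) ^+ n.+1 <= expR y.
  have -> : expR y = expR (y / m) ^+ n.+1.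
    by rewrite -expRM_natl -/m; congr expR; field; rewrite gt_eqF.
  rewrite ler_pXn2r ?nnegrE ?expR_ge0 ?divr_ge0 ?ltW//.
  by rewrite (lt_le_trans _ (expR_ge1Dx _))// ltrDr.
have h2 : c' * y ^+ n.+1 <= c * (expR y * expR (-1)).
  have -> : c' * y ^+ n.+1 = c * ((y / m) ^+ n.+1 * expR (-1)).
    rewrite /c' expr_div_n; field.
    by rewrite -[m%R]/m expf_neq0 // gt_eqF.
  by rewrite ler_wpM2l ?(ltW c0)// ler_wpM2r ?expR_ge0.
apply: lt_le_trans h2.
have yn : 1 <= y ^+ n by rewrite exprn_ege1.
have cy : `|K| + `|P| + 1 < c' * y.
  by rewrite /y mulrDr mulr1 mulrC divfK ?gt_eqF// ltrDr.
have h3 : K * y ^+ n + P <= (`|K| + `|P|) * y ^+ n.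
  rewrite mulrDl lerD//; first by rewrite ler_wpM2r ?ler_norm// ltW// (lt_le_trans _ yn).
  by rewrite (le_trans (ler_norm _))// ler_peMr.
rewrite (le_lt_trans h3)// exprS mulrA ltr_pM2r ?(lt_le_trans _ yn)//.
by apply: lt_trans cy; rewrite ltrDl.
Qed.

(** Suppose p > 0 at t0; after a reflection p' >= 0 there. As p'' >= p, the function (p + p') exp (-
    t) is nondecreasing, so p + p' >= c exp t with c > 0. Then (p exp t)' >= c exp (2 t), and p
    grows at least like (c / 2) exp t, against the polynomial bound. *)
Lemma convex_poly_growth_eq0 (p p1 p2 : R -> R) (K : R) n :
  (forall t, is_derive t 1 p (p1 t)) -> (forall t, is_derive t 1 p1 (p2 t)) ->
  (forall t, 0 <= p t) -> (forall t, p t <= p2 t) ->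
  (forall t, p t <= K * (1 + `|t|) ^+ n) -> forall t, p t = 0.
Proof.
move=> dp dp1 p0 pp2 pK t0; apply/eqP; rewrite eq_le p0 andbT leNgt; apply/negP => pt0.
wlog p1t0 : p p1 p2 t0 dp dp1 p0 pp2 pK pt0 / 0 <= p1 t0 => [hw|].
  have [/hw|/ltW p1t0] := leP 0 (p1 t0); first exact.
  have dN t : is_derive t (1 : R) -%R (-1) by exact: is_deriveNid.
  apply: (hw (p \o -%R) (fun t => - p1 (- t)) (p2 \o -%R) (- t0)) => //=.
  - by move=> t; have := is_derive1_comp (dp (- t)) (dN t); rewrite mulrN1.
  - move=> t; have := is_derive1_comp (dp1 (- t)) (dN t).
    by move=> /is_deriveN; rewrite mulrN1 opprK.
  - by move=> t; rewrite -normrN.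
  - by rewrite opprK.
  - by rewrite opprK oppr_ge0.
have dexp t : is_derive t (1 : R) (fun t => expR t) (expR t) by exact: is_derive_expR.
have dexpN t : is_derive t (1 : R) (fun t => expR (- t)) (- expR (- t)).
  have := is_derive1_comp (is_derive_expR (- t)) (is_deriveNid t 1).
  by rewrite mulrN1.
pose E t := p t + p1 t.
have Et0 : 0 < E t0 by rewrite ltr_pwDl.
pose c := E t0 * expR (- t0).
have c0 : 0 < c by rewrite mulr_gt0 ?expR_gt0.
have hE t : t0 <= t -> c * expR t <= E t.
  move=> tt0.
  have := @derive_ge0_le (fun t => E t * expR (- t))
     (fun t => (p2 t - p t) * expR (- t)) t0 t tt0.
  rewrite -/c => H.
  have {}H : c <= E t * expR (- t).
    apply: H => x _; last by rewrite mulr_ge0 ?expR_ge0// subr_ge0.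
    have := is_deriveM (is_deriveD (dp x) (dp1 x)) (dexpN x).
    move=> /is_derive_eq; apply; rewrite /= ?fctE !scaleRE; ring.
  by rewrite -ler_pdivlMr ?expR_gt0// -expRN.
pose c2 := c / 2.
have c20 : 0 < c2 by rewrite divr_gt0.
pose psi t := p t * expR t - c2 * expR t ^+ 2.
have hp t : t0 <= t -> psi t0 <= psi t.
  move=> tt0.
  apply: (@derive_ge0_le psi (fun t => expR t * (E t - c * expR t)) t0 t tt0).
    move=> x _.
    have := is_deriveB (is_deriveM (dp x) (dexp x)) (is_deriveZ c2 (is_deriveX 2 (dexp x))).
    by move=> /is_derive_eq; apply; rewrite /= ?fctE !scaleRE /c2 /E; field.
  move=> x /andP[/hE h _]; by rewrite mulr_ge0 ?expR_ge0// subr_ge0.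
pose P := `|psi t0|.
have [t tge0 ht] := @expR_gt_poly (c2 * expR t0) (K * (1 + `|t0|) ^+ n) P n
   (mulr_gt0 c20 (expR_gt0 _)).
pose s := t + `|t0|.
have st0 : t0 <= s by rewrite /s (le_trans (ler_norm t0))// lerDr.
have s0 : 0 <= s by rewrite addr_ge0.
have hps : c2 * expR s - P <= p s.
  have es : 1 <= expR s by rewrite -expR0 ler_expR.
  have e0 := expR_gt0 s.
  have := hp s st0; rewrite {2}/psi => h.
  have hP : - psi t0 <= P * expR s.
    by rewrite (le_trans (ler_norm _))// normrN ler_peMr.
  have : (c2 * expR s - P) * expR s <= p s * expR s by lra.
  by rewrite ler_pM2r.
have := pK s; rewrite (ger0_norm s0) => hK.
have sqrt_2pi : 0 <= K.
  have := pK t0; have : 0 < (1 + `|t0|) ^+ n by rewrite exprn_gt0// ltr_pwDl.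
  move=> h1 h2; rewrite -(pmulr_lge0 _ h1); exact: le_trans h2.
have h1 : (1 + s) ^+ n <= (1 + `|t0|) ^+ n * (1 + t) ^+ n.
  rewrite -exprMn lerXn2r ?nnegrE ?addr_ge0 ?mulr_ge0 ?addr_ge0//.
  have : 0 <= t * `|t0| by rewrite mulr_ge0.
  by rewrite /s; lra.
have h2 : K * (1 + s) ^+ n <= K * (1 + `|t0|) ^+ n * (1 + t) ^+ n.
  by rewrite -mulrA ler_wpM2l.
have h3 : c2 * expR t0 * expR t <= c2 * expR s.
  rewrite -mulrA ler_wpM2l ?(ltW c20)// -expRD ler_expR /s addrC lerD2l.
  exact: ler_norm.
by lra.
Qed.

End RealCalculus.

(** * Complex derivatives restricted to real lines *)

Section LineDerivative.
Variable R : realType.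
Implicit Types (x y t : R) (z w h l v : R[i]) (f g : R[i] -> R[i]).

Lemma cdiff_line f z v t l : cdiff f (z + t%:C * v) l ->
  is_derive t (1 : R) (fun s : R => Re (f (z + s%:C * v))) (Re (l * v)) /\
  is_derive t (1 : R) (fun s : R => Im (f (z + s%:C * v))) (Im (l * v)).
Proof.
move=> H.
have H' (e : R) : 0 < e -> exists2 d : R, 0 < d & forall h : R, `|h| < d ->
    cmod (f (z + (t + h)%:C * v) - f (z + t%:C * v) - l * v * h%:C) <= e * `|h|.
  move=> e0; pose K := cmod v + 1; have sqrt_2pi : 0 < K by rewrite ltr_wpDl ?cmod_ge0.
  have [d d0 Hd] := H (e / K) (divr_gt0 e0 sqrt_2pi).
  exists (d / K); first by rewrite divr_gt0.
  move=> h hd; have -> : z + (t + h)%:C * v = z + t%:C * v + h%:C * v.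
    by rewrite rmorphD /= mulrDl addrA.
  have -> : l * v * h%:C = l * (h%:C * v) by ring.
  have hv : cmod (h%:C * v) <= `|h| * K.
    by rewrite cmodM cmod_real ler_wpM2l// lerDl.
  rewrite (le_trans (Hd _ _))//; first by rewrite (le_lt_trans hv)// -ltr_pdivlMr.
  have -> : e * `|h| = e / K * (`|h| * K) by field; rewrite gt_eqF.
  by rewrite ler_wpM2l// divr_ge0 ?ltW.
split; apply: is_derive_eps => e /H'[d d0 Hd]; exists d => // h /Hd.
  by apply: le_trans; rewrite (le_trans _ (Re_cmod _))// !ReImE mulr0 subr0.
by apply: le_trans; rewrite (le_trans _ (Im_cmod _))// !ReImE mulr0 add0r.
Qed.

Lemma cdiff_unique0 f z l (d : R) : 0 < d -> cdiff f z l ->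
  (forall h : R, `|h| < d -> f (z + h%:C) = 0) -> l = 0.
Proof.
move=> d0 Hf f0; apply/eqP; rewrite -cmod_eq0 eq_le cmod_ge0 andbT.
apply/ler_addgt0Pr => e e0; rewrite add0r.
have [d' d'0 H] := Hf e e0.
pose h : R := Num.min d d' / 2.
have m0 : 0 < Num.min d d' by rewrite lt_min d0.
have h0 : 0 < h by rewrite divr_gt0.
have hlt : h < Num.min d d' by rewrite /h; lra.
move: hlt; rewrite lt_min => /andP[hd hd'].
have ch : cmod h%:C = h by rewrite cmod_real gtr0_norm.
have := H h%:C; rewrite ch => /(_ hd').
rewrite f0 ?gtr0_norm// -[in f z](addr0 z) (f0 0) ?normr0// subrr sub0r cmodN cmodM ch.
by rewrite ler_pM2r.
Qed.

Lemma Re_dot z w : `|Re z * Re w + Im z * Im w| <= cmod z * cmod w.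
Proof.
have -> : Re z * Re w + Im z * Im w = Re (z^* * w).
  by case: z; case: w => a b c d /=; ring.
by rewrite (le_trans (Re_cmod _))// cmodM {1}/cmod; case: z => a b /=; rewrite sqrrN.
Qed.

(** The half-plane is star-shaped about 1, and on the segment from 1 to z both components have zero
    derivative. *)
Lemma constant_right_half f : (forall z : R[i], 0 < Re z -> cdiff f z 0) ->
  forall z : R[i], 0 < Re z -> f z = f 1.
Proof.
move=> H z z0.
have D t : 0 <= t <= 1 -> cdiff f (1 + t%:C * (z - 1)) 0.
  move=> /andP[t0 t1]; apply: H; rewrite !ReImE !mul0r subr0.
  have [->|tn0] := eqVneq t 0; first by rewrite mul0r addr0.
  have : 0 < t * Re z by rewrite mulr_gt0// lt_def tn0.
  by lra.
have key (u : R -> R) : (forall t, 0 <= t <= 1 -> is_derive t 1 u 0) -> u 0 = u 1.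
  move=> du; apply/le_anti/andP; split.
    exact: (@derive_ge0_le _ u (fun=> 0) 0 1 ler01 du).
  rewrite -lerN2; apply: (@derive_ge0_le _ (fun t => - u t) (fun=> 0) 0 1 ler01) => // t /du.
  by move=> /is_deriveN; rewrite oppr0.
have e1 : 1 + 1%:C * (z - 1) = z by rewrite mul1r addrC subrK.
have e0 : 1 + 0%:C * (z - 1) = 1 by rewrite mul0r addr0.
rewrite -[in LHS]e1 -[in RHS]e0; apply: complex_ext; apply/esym.
  apply: (key (fun t => Re (f (1 + t%:C * (z - 1))))) => t /D /cdiff_line[+ _].
  by rewrite mul0r.
apply: (key (fun t => Im (f (1 + t%:C * (z - 1))))) => t /D /cdiff_line[_].
by rewrite mul0r.
Qed.

End LineDerivative.

(** * Solutions of Bessel's equation with polynomial growth on vertical lines vanish *)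

Section BesselUniqueness.
Variable R : realType.
Implicit Types z : R[i].
Variables (d d1 d2 : R[i] -> R[i]) (nu : R).
Hypothesis dd : forall z : R[i], 0 < Re z -> cdiff d z (d1 z).
Hypothesis dd1 : forall z : R[i], 0 < Re z -> cdiff d1 z (d2 z).
Hypothesis ode : forall z : R[i], 0 < Re z ->
  d2 z + z^-1 * d1 z + (1 - nu%:C ^+ 2 / z ^+ 2) * d z = 0.
Hypothesis growth : forall x : R, 0 < x -> exists (K : R) n,
  forall t : R, cmod (d (x +i* t)) <= K * (1 + `|t|) ^+ n.

Let Re_le_cmod z : Re z <= cmod z.
Proof. by rewrite (le_trans (ler_norm _))// Re_cmod. Qed.

Let d2E z : 0 < Re z ->
  d2 z = - (d z + (z^-1 * d1 z - nu%:C ^+ 2 / z ^+ 2 * d z)).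
Proof.
move=> /ode/eqP; rewrite -addrA addr_eq0 => /eqP ->; congr (- _); ring.
Qed.

Let w_bound z (a : R) : 0 < a -> a <= Re z ->
  cmod (z^-1 * d1 z - nu%:C ^+ 2 / z ^+ 2 * d z) <=
  a^-1 * cmod (d1 z) + nu ^+ 2 / a ^+ 2 * cmod (d z).
Proof.
move=> a0 az; have az' : a <= cmod z by rewrite (le_trans az).
have z0 : 0 < cmod z by rewrite (lt_le_trans a0).
rewrite (le_trans (cmodB _ _))// (cmodM z^-1) (cmodM (nu%:C ^+ 2 / z ^+ 2)) (cmodM (nu%:C ^+ 2)).
rewrite !cmodV !cmodX cmod_real real_normK ?num_real//.
rewrite lerD//.
  by rewrite ler_wpM2r ?cmod_ge0// lef_pV2.
rewrite ler_wpM2r ?cmod_ge0// ler_wpM2l ?sqr_ge0//.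
by rewrite lef_pV2 ?posrE ?exprn_gt0// ler_pXn2r// nnegrE ltW.
Qed.

(** On the line Re z = x differentiation in t is multiplication of d/dz by i. For p = |d|^2 the
    equation in the form d2 = - (d + r) gives p'' = 2 (|d1|^2 + |d|^2 + Re (conj d r)). Since x >= 1
    and |nu| <= x / 2, one has |r| <= |d1| + |d| / 4, hence p'' - p >= 2 (|d1| - |d| / 2)^2 >= 0 and
    [convex_poly_growth_eq0] applies. *)
Let zero_right z : 1 + 2 * `|nu| <= Re z -> d z = 0.
Proof.
move=> zX; pose x := Re z.
have x1 : 1 <= x by rewrite (le_trans _ zX)// lerDl mulr_ge0.
have x0 : 0 < x by exact: lt_le_trans x1.
pose L (t : R) := x%:C + t%:C * 'i%C.
have LE t : L t = x +i* t by apply: complex_ext; rewrite /L !ReImE /=; ring.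
have ReL t : Re (L t) = x by rewrite LE.
have [K [n HK]] := growth x0.
pose u t := Re (d (L t)); pose v t := Im (d (L t)).
pose u1 t := Re (d1 (L t) * 'i%C); pose v1 t := Im (d1 (L t) * 'i%C).
pose u2 t := - Re (d2 (L t)); pose v2 t := - Im (d2 (L t)).
have L0 t : 0 < Re (L t) by rewrite ReL.
have du t : is_derive t (1 : R) u (u1 t) by have [] := cdiff_line (dd (L0 t)).
have dv t : is_derive t (1 : R) v (v1 t) by have [] := cdiff_line (dd (L0 t)).
have dd1i w : 0 < Re w -> cdiff (fun w => d1 w * 'i%C) w (d2 w * 'i%C).
  move=> w0; have := cdiffM (dd1 w0) (cdiff_cst 'i%C w).
  by rewrite mulr0 addr0.
have du1 t : is_derive t (1 : R) u1 (u2 t).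
  have [+ _] := cdiff_line (dd1i _ (L0 t)).
  by move/is_derive_eq; apply; rewrite /u2 -mulrA i_real_sqr mulrN1 ReN.
have dv1 t : is_derive t (1 : R) v1 (v2 t).
  have [_] := cdiff_line (dd1i _ (L0 t)).
  by move/is_derive_eq; apply; rewrite /v2 -mulrA i_real_sqr mulrN1 ImN.
pose p t := u t * u t + v t * v t.
pose p1 t := 2 * (u t * u1 t + v t * v1 t).
pose p2 t := 2 * (u1 t * u1 t + u t * u2 t + (v1 t * v1 t + v t * v2 t)).
have pE t : p t = cmod (d (L t)) ^+ 2 by rewrite sqr_cmod /p !expr2.
have H : forall t, p t = 0.
  apply: (@convex_poly_growth_eq0 R p p1 p2 (K ^+ 2) (n * 2)%N).
  - move=> t; have := is_deriveD (is_deriveM (du t) (du t)) (is_deriveM (dv t) (dv t)).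
    by move/is_derive_eq; apply; rewrite /p1 ?fctE !scaleRE; ring.
  - move=> t; have := is_deriveZ 2 (is_deriveD (is_deriveM (du t) (du1 t)) (is_deriveM (dv t) (dv1 t))).
    by move/is_derive_eq; apply; rewrite /p2 ?fctE !scaleRE; ring.
  - by move=> t; rewrite pE sqr_ge0.
  - move=> t; pose w := L t.
    have q1 : u1 t * u1 t + v1 t * v1 t = cmod (d1 w) ^+ 2.
      by rewrite sqr_cmod /u1 /v1 -/w !ReImE; ring.
    pose r := w^-1 * d1 w - nu%:C ^+ 2 / w ^+ 2 * d w.
    have q2 : u t * u2 t + v t * v2 t =
        cmod (d w) ^+ 2 + (Re (d w) * Re r + Im (d w) * Im r).
      by rewrite /u /u2 /v /v2 -/w d2E ?ReL// -/r !ReImE sqr_cmod; ring.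
    have q3 : p2 t = 2 * (cmod (d1 w) ^+ 2 + cmod (d w) ^+ 2
        + (Re (d w) * Re r + Im (d w) * Im r)).
      by rewrite -[RHS]mulr1 -q1 -addrA -q2 /p2; ring.
    rewrite q3 pE -/w.
    have := Re_dot (d w) r; rewrite ler_norml => /andP[hd _].
    have rb : cmod r <= cmod (d1 w) + 4^-1 * cmod (d w).
      have := @w_bound w x x0; rewrite ReL lexx => /(_ isT) h.
      rewrite (le_trans h)// lerD//.
        by rewrite ler_piMl ?cmod_ge0// invf_le1.
      rewrite ler_wpM2r ?cmod_ge0// ler_pdivrMr ?exprn_gt0//.
      have : `|nu| ^+ 2 <= (x / 2) ^+ 2.
        rewrite ler_pXn2r ?nnegrE ?normr_ge0 ?divr_ge0 ?ltW//.
        by have := zX; rewrite -/x; lra.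
      by rewrite real_normK ?num_real//; lra.
    have dw0 := cmod_ge0 (d w).
    have : cmod (d w) * cmod r <= cmod (d w) * (cmod (d1 w) + 4^-1 * cmod (d w)).
      by rewrite ler_wpM2l.
    have : 0 <= (cmod (d1 w) - cmod (d w) / 2) ^+ 2 by exact: sqr_ge0.
    by rewrite sqrrB !expr2; lra.
  - move=> t; rewrite pE LE exprM -exprMn ler_pXn2r ?nnegrE ?cmod_ge0//.
    exact: le_trans (cmod_ge0 _) (HK t).
have := H (Im z); rewrite pE LE => /eqP; rewrite sqrf_eq0 cmod_eq0 => /eqP <-.
by congr d; case: z zX @x x1 x0 L LE ReL HK u v u1 v1 u2 v2 L0 du dv du1 dv1 p p1 p2 pE H.
Qed.

(** The solution vanishes near a point b far to the right. A backward Gronwall argument along the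
    real axis carries d = d1 = 0 from b down to x, where [zero_right] gives nothing. *)
Lemma bessel_decaying_eq0 (x : R) : 0 < x -> d x%:C = 0 /\ d1 x%:C = 0.
Proof.
move=> x0; pose b := 2 + 2 * `|nu| + x.
have xb : x <= b by rewrite lerDr addr_ge0// mulr_ge0.
have db h : cmod h < 1 -> d (b%:C + h) = 0.
  move=> h1; apply: zero_right; rewrite ReD /=.
  have := le_lt_trans (Re_cmod h) h1; rewrite ltr_norml => /andP[h2 _].
  by rewrite /b; lra.
have d10 : d1 b%:C = 0.
  apply: (@cdiff_unique0 _ _ _ _ _ ltr01 (dd _)) => [/=|h h1].
    exact: lt_le_trans xb.
  by rewrite db// cmod_real.
have d0 : d b%:C = 0 by have := db 0; rewrite addr0 cmod0 ltr01; apply.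
pose L (t : R) := 0 + t%:C * 1 : R[i].
have LE t : L t = t%:C by rewrite /L mulr1 add0r.
pose k := x^-1 + 1 + nu ^+ 2 / x ^+ 2.
pose E t := Re (d (L t)) * Re (d (L t)) + Im (d (L t)) * Im (d (L t)) +
   (Re (d1 (L t)) * Re (d1 (L t)) + Im (d1 (L t)) * Im (d1 (L t))).
have EE t : E t = cmod (d (L t)) ^+ 2 + cmod (d1 (L t)) ^+ 2.
  by rewrite !sqr_cmod /E !expr2.
(* For t >= x, |d2| <= k (|d| + |d1|), so the derivative of E is at least - (1 + 3 k) E and E exp (K
   t) is nondecreasing. *)
pose K := 1 + 3 * k.
have k0 : 0 <= k by rewrite !addr_ge0 ?divr_ge0 ?sqr_ge0 ?invr_ge0 ?ltW ?exprn_gt0.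
pose E1 t := 2 * (Re (d (L t)) * Re (d1 (L t)) + Im (d (L t)) * Im (d1 (L t))) +
   2 * (Re (d1 (L t)) * Re (d2 (L t)) + Im (d1 (L t)) * Im (d2 (L t))).
have H : E x * expR (K * x) <= E b * expR (K * b).
  apply: (@derive_ge0_le R (fun t => E t * expR (K * t))
     (fun t => (E1 t + K * E t) * expR (K * t)) x b xb).
    move=> t /andP[xt _]; have L0 : 0 < Re (L t) by rewrite LE (lt_le_trans x0).
    have [a1 a2] : is_derive t (1 : R) (fun s => Re (d (L s))) (Re (d1 (L t))) /\
        is_derive t (1 : R) (fun s => Im (d (L s))) (Im (d1 (L t))).
      by have [b1 b2] := cdiff_line (dd L0); split;
        [apply: is_derive_eq b1 _|apply: is_derive_eq b2 _]; rewrite mulr1.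
    have [a3 a4] : is_derive t (1 : R) (fun s => Re (d1 (L s))) (Re (d2 (L t))) /\
        is_derive t (1 : R) (fun s => Im (d1 (L s))) (Im (d2 (L t))).
      by have [b1 b2] := cdiff_line (dd1 L0); split;
        [apply: is_derive_eq b1 _|apply: is_derive_eq b2 _]; rewrite mulr1.
    have a5 : is_derive t (1 : R) (fun t => expR (K * t)) (K * expR (K * t)).
      have := is_derive1_comp (is_derive_expR (K * t)) (is_deriveZ K (is_derive_id t (1 : R))).
      by move/is_derive_eq; apply; rewrite ?fctE !scaleRE; ring.
    have := is_deriveM (is_deriveD (is_deriveD (is_deriveM a1 a1) (is_deriveM a2 a2))
       (is_deriveD (is_deriveM a3 a3) (is_deriveM a4 a4))) a5.
    move/is_derive_eq; apply; rewrite ?fctE !scaleRE /E1 /E; ring.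
  move=> t /andP[xt _]; rewrite mulr_ge0 ?expR_ge0// EE.
  have L0 : 0 < Re (L t) by rewrite LE (lt_le_trans x0).
  set w := L t in L0 *.
  have := Re_dot (d w) (d1 w); rewrite ler_norml => /andP[h1 _].
  have := Re_dot (d1 w) (d2 w); rewrite ler_norml => /andP[h2 _].
  have h3 : cmod (d2 w) <= k * (cmod (d w) + cmod (d1 w)).
    rewrite d2E// cmodN (le_trans (cmodD _ _))//.
    have := @w_bound w x x0; rewrite {1}/w LE => /(_ xt) h3.
    have n0 : 0 <= nu ^+ 2 / x ^+ 2 by rewrite divr_ge0 ?sqr_ge0.
    have n1 : 0 <= x^-1 by rewrite invr_ge0 ltW.
    have c0 := cmod_ge0 (d w); have c1 := cmod_ge0 (d1 w).
    have := mulr_ge0 n0 c1; have := mulr_ge0 n1 c0.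
    by rewrite /k; lra.
  have c0 := cmod_ge0 (d w); have c1 := cmod_ge0 (d1 w).
  have h4 : cmod (d1 w) * cmod (d2 w) <= cmod (d1 w) * (k * (cmod (d w) + cmod (d1 w))).
    by rewrite ler_wpM2l.
  have h5 : 0 <= (cmod (d w) - cmod (d1 w)) ^+ 2 by exact: sqr_ge0.
  have h6 : 0 <= k * (cmod (d w) - cmod (d1 w)) ^+ 2 by rewrite mulr_ge0.
  have h7 : 0 <= k * (cmod (d w)) ^+ 2 by rewrite mulr_ge0 ?sqr_ge0.
  move: h5 h6 h7; rewrite /E1 -/w /K !sqrrB !expr2; lra.
have Eb : E b = 0 by rewrite EE LE d0 d10 cmod0 expr0n /= addr0.
have : E x <= 0 by move: H; rewrite Eb mul0r pmulr_lle0 ?expR_gt0.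
rewrite EE LE => h.
have s0 := sqr_ge0 (cmod (d x%:C)); have s1 := sqr_ge0 (cmod (d1 x%:C)).
have e0 : cmod (d x%:C) ^+ 2 = 0 by lra.
have e1 : cmod (d1 x%:C) ^+ 2 = 0 by lra.
by split; apply/eqP; rewrite -cmod_eq0 -sqrf_eq0; apply/eqP.
Qed.

End BesselUniqueness.

(** * Substitution on the real line *)

Section Substitution.
Variable R : realType.
Local Notation mu := (@lebesgue_measure R).
Implicit Types (x y t : R).

Lemma continuous_itv_meas (f : R -> R) (a b : R) :
  {in `[a, b]%R, continuous f} ->
  measurable_fun (`[a, b]%classic : set R) f.
Proof.
move=> cf; apply: subspace_continuous_measurable_fun => //.
by apply: continuous_in_subspaceT => x; rewrite inE /= => /cf.
Qed.

Lemma itvNn_nondecr (F : R -> R) : {homo F : x y / x <= y} ->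
  {homo (fun n : nat => `[F (- n%:R), F n%:R]%classic : set R) :
    n m / (n <= m)%N >-> (n <= m)%O}.
Proof.
move=> Fh n m nm; rewrite subsetEset => x /=; rewrite !in_itv /= => /andP[h1 h2].
apply/andP; split.
  by rewrite (le_trans _ h1)// Fh// lerN2 ler_nat.
by rewrite (le_trans h2)// Fh// ler_nat.
Qed.

Lemma bigcup_itvNn : \bigcup_n (`[(- n%:R), n%:R]%classic : set R) = setT.
Proof.
apply/seteqP; split=> // x _; exists (Num.truncn `|x|).+1 => //=.
have : `|x| <= (Num.truncn `|x|).+1%:R by rewrite ltW// truncnS_gt.
by rewrite in_itv /= ler_norml.
Qed.

Section Increasing.
Variables (F F' : R -> R) (D : set R).
Hypothesis dF : forall x, is_derive x (1 : R) F (F' x).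
Hypothesis cF' : continuous F'.
Hypothesis F'0 : forall x, 0 < F' x.
Hypothesis FD : forall y, D y <-> exists n : nat, F (- n%:R) <= y <= F n%:R.

Let cF : continuous F.
Proof. by move=> u; exact: is_derive_continuous (dF u). Qed.

Let F_incr : {homo F : x y / x < y}.
Proof.
move=> x y xy.
have [|c cab] := @MVT R F F' x y xy.
  exact: continuous_subspaceT.
by rewrite -[F x < F y]subr_gt0 => ->; rewrite mulr_gt0// subr_gt0.
Qed.

Let F_nd : {homo F : x y / x <= y}.
Proof. by move=> x y; rewrite le_eqVlt => /predU1P[->//|/F_incr/ltW]. Qed.

Let F'E : F^`()%classic = F'.
Proof. by apply/funext => x; rewrite derive1E; exact: derive_val. Qed.

(** [FD] presents D as the increasing union of the images of [-n, n]. The substitution rule holds on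
    each compact piece, and monotone convergence passes to the union on both sides, so limits of F
    at infinity never have to be named. *)
Lemma ge0_increasing_substitution (G : R -> R) : {in D, continuous G} ->
  (forall x, 0 <= G x) ->
  (\int[mu]_(x in D) (G x)%:E = \int[mu]_x (G (F x) * F' x)%:E)%E.
Proof.
move=> cG G0.
pose A (n : nat) := `[F (- n%:R), F n%:R]%classic : set R.
pose B (n : nat) := `[(- n%:R), n%:R]%classic : set R.
have DA : D = \bigcup_n A n.
  apply/seteqP; split => [y /FD[n h]|y [n _ h]]; first by exists n.
  by apply/FD; exists n; move: h; rewrite /A /= in_itv.
have cG' n : {in `[F (- n%:R), F n%:R]%R, continuous G}.
  move=> y yI; apply: cG; rewrite inE; apply/FD; exists n.
  by move: yI; rewrite in_itv.
have cGF : continuous (fun x => G (F x) * F' x).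
  move=> x; apply: cvgM; last exact: cF'.
  apply: continuous_comp; first exact: cF.
  apply: cG; rewrite inE; apply/FD.
  have : (\bigcup_n (`[(- n%:R), n%:R]%classic : set R)) x by rewrite bigcup_itvNn.
  by move=> [n _ /=]; rewrite in_itv /= => /andP[h1 h2]; exists n; rewrite !F_nd.
have l1 : (\int[mu]_(x in A i) (G x)%:E @[i --> \oo] --> \int[mu]_(x in \bigcup_i A i) (G x)%:E)%E.
  apply: ge0_nondecreasing_set_cvg_integral.
  - exact: itvNn_nondecr.
  - by move=> n; exact: measurable_itv.
  - by move=> n; apply/measurable_EFinP; exact: continuous_itv_meas.
  - by move=> n x _; rewrite lee_fin.
have l2 : (\int[mu]_(x in B i) (G (F x) * F' x)%:E @[i --> \oo] -->
     \int[mu]_(x in \bigcup_i B i) (G (F x) * F' x)%:E)%E.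
  apply: ge0_nondecreasing_set_cvg_integral.
  - exact: (@itvNn_nondecr id).
  - by move=> n; exact: measurable_itv.
  - by move=> n; apply/measurable_EFinP; apply: continuous_itv_meas => x _; exact: cGF.
  - by move=> n x _; rewrite lee_fin mulr_ge0// ltW.
have AB n : (\int[mu]_(x in A n) (G x)%:E = \int[mu]_(x in B n) (G (F x) * F' x)%:E)%E.
  rewrite /A integration_by_substitution_increasing ?F'E//.
  - by rewrite (@le_trans _ _ 0)// oppr_le0.
  - by move=> x y _ _; exact: F_incr.
  - by apply/cvg_ex; exists (F' (- n%:R)); apply: cvg_at_right_filter; exact: cF'.
  - by apply/cvg_ex; exists (F' n%:R); apply: cvg_at_left_filter; exact: cF'.
  - split=> [x _||]; first by case: (dF x).
      by apply: cvg_at_right_filter; exact: cF.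
    by apply: cvg_at_left_filter; exact: cF.
  - by apply: continuous_in_subspaceT => x; rewrite inE /= => /cG'.
rewrite -DA in l1; rewrite bigcup_itvNn in l2.
have l1' : (\int[mu]_(x in B i) (G (F x) * F' x)%:E @[i --> \oo] --> \int[mu]_(x in D) (G x)%:E)%E.
  by apply: cvg_trans l1; apply: near_eq_cvg; near=> n; rewrite AB.
exact: (cvg_unique _ l1' l2).
Unshelve. all: by end_near. Qed.

Lemma increasing_substitution (G : R -> R) : {in D, continuous G} ->
  (\int[mu]_(x in D) (G x)%:E = \int[mu]_x (G (F x) * F' x)%:E)%E.
Proof.
move=> cG; rewrite integralE [RHS]integralE; congr (_ - _)%E.
  have cmax : {in D, continuous (fun x => Num.max (G x) 0)}.
    by move=> x xD; apply: continuous_max; [exact: cG|exact: cvg_cst].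
  have -> : (fun x => (G x)%:E)^\+%E = (fun x => (Num.max (G x) 0)%:E).
    by apply/funext => x; rewrite funeposE -EFin_max.
  rewrite ge0_increasing_substitution//; last by move=> x; rewrite le_max lexx orbT.
  apply: eq_integral => x _; rewrite funeposE -EFin_max; congr (_%:E).
  by rewrite maxr_pMl ?mul0r// ltW.
have cmax : {in D, continuous (fun x => Num.max (- G x) 0)}.
  move=> x xD; apply: (@continuous_max _ _ (fun x => - G x)); last exact: cvg_cst.
  by apply: cvgN; exact: cG.
have -> : (fun x => (G x)%:E)^\-%E = (fun x => (Num.max (- G x) 0)%:E).
  by apply/funext => x; rewrite funenegE -EFin_max.
rewrite ge0_increasing_substitution//; last by move=> x; rewrite le_max lexx orbT.
apply: eq_integral => x _; rewrite funenegE -EFinN -EFin_max; congr (_%:E).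
by rewrite maxr_pMl ?(ltW (F'0 _))// mul0r mulNr.
Qed.

End Increasing.

Lemma substitution_expR (G : R -> R) : (forall x, 0 < x -> {for x, continuous G}) ->
  (\int[mu]_(x in `]0%R, +oo[) (G x)%:E = \int[mu]_x (G (expR x) * expR x)%:E)%E.
Proof.
move=> cG; apply: (@increasing_substitution (@expR R)).
- exact: continuous_expR.
- exact: expR_gt0.
- move=> y; rewrite /= in_itv /= andbT; split => [y0|[n /andP[+ _]]]; last first.
    by apply: lt_le_trans; exact: expR_gt0.
  exists (Num.truncn `|ln y|).+1.
  have : `|ln y| <= (Num.truncn `|ln y|).+1%:R by rewrite ltW// truncnS_gt.
  set n := (Num.truncn _).+1; rewrite ler_norml => /andP[h1 h2].
  by rewrite -[X in _ <= X <= _](lnK y0) !ler_expR h1 h2.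
- by move=> x; rewrite inE /= in_itv /= andbT => /cG.
Qed.

Lemma substitution_affine (G : R -> R) (a b : R) : 0 < a -> continuous G ->
  (\int[mu]_x (G x)%:E = \int[mu]_x (G (a * x + b) * a)%:E)%E.
Proof.
move=> a0 cG; apply: (@increasing_substitution (fun x => a * x + b) (fun=> a)) => //.
- move=> x; have := is_deriveD (is_deriveZ a (is_derive_id x (1 : R))) (is_derive_cst b x (1 : R)).
  by move/is_derive_eq; apply; rewrite scaleRE mulr1 addr0.
- by move=> x; exact: cvg_cst.
- move=> y; split => // _; exists (Num.truncn `|(y - b) / a|).+1.
  have : `|(y - b) / a| <= (Num.truncn `|(y - b) / a|).+1%:R by rewrite ltW// truncnS_gt.
  rewrite ler_norml ler_pdivlMr// ler_pdivrMr// => /andP[h1 h2].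
  by apply/andP; split; lra.
Qed.

(** Dominated convergence over [-n, n] with majorant |f'|; the boundary values are therefore only
    tested along integers. *)
Lemma ftc_R (f f' : R -> R) (l : R) : (forall x, is_derive x (1 : R) f (f' x)) ->
  continuous f' -> mu.-integrable setT (EFin \o f') ->
  (forall e, 0 < e -> exists n0 : nat, forall n, (n0 <= n)%N ->
     `|f n%:R - f (- n%:R) - l| <= e) ->
  \int[mu]_x f' x = l.
Proof.
move=> df cf' intf' lim0.
have cf : continuous f by move=> u; exact: is_derive_continuous (df u).
pose B (n : nat) := `[(- n%:R), n%:R]%classic : set R.
have fE : f^`()%classic = f' by apply/funext => x; rewrite derive1E; exact: derive_val.
have B1 n : (0 < n)%N -> (\int[mu]_(x in B n) (f' x)%:E = (f n%:R)%:E - (f (- n%:R))%:E)%E.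
  move=> n0; rewrite /B; apply: (continuous_FTC2 (F := f)).
  - by rewrite (@lt_trans _ _ 0) ?oppr_lt0 ?ltr0n.
  - exact: continuous_subspaceT.
  - split=> [x _||]; first by case: (df x).
      by apply: cvg_at_right_filter; exact: cf.
    by apply: cvg_at_left_filter; exact: cf.
  - by move=> x _; rewrite fE.
have mB n : measurable (B n) by exact: measurable_itv.
have mf' : measurable_fun setT (EFin \o f').
  by apply/measurable_EFinP; exact: continuous_measurable_fun.
have := @dominated_convergence _ _ _ mu setT measurableT
  (fun n => (fun x => (f' x)%:E) \_ (B n)) (fun x => (f' x)%:E) (fun x => `|(f' x)%:E|%E).
move=> lim1.
have {}lim1 : (\int[mu]_(x in B n) (f' x)%:E @[n --> \oo] --> \int[mu]_x (f' x)%:E)%E.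
  have : ((\int[mu]_x ((fun x => (f' x)%:E) \_ (B n)) x)%E @[n --> \oo] --> \int[mu]_x (f' x)%:E)%E.
    have [|||||_ _] // := lim1.
    - move=> n; apply/(measurable_restrictT _ (mB n)).
      exact: measurable_funTS.
    - apply: aeW => x _.
      apply: cvg_near_cst.
      have [n _ hn] : (\bigcup_n B n) x by rewrite bigcup_itvNn.
      exists n => // m /= nm; rewrite patchE mem_set//.
      by have := @itvNn_nondecr id (fun x y => id) n m nm; rewrite subsetEset; apply.
    - exact: integrable_abse.
    - apply: aeW => x n _; rewrite patchE; case: ifPn => // _.
      by rewrite abse0 abse_ge0.
  by apply: cvg_trans; apply: near_eq_cvg; near=> n; rewrite -integral_mkcond.
have lim2 : (\int[mu]_(x in B n) (f' x)%:E @[n --> \oo] --> l%:E)%E.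
  have : (f n%:R - f (- n%:R))%:E @[n --> \oo] --> l%:E.
    apply: cvg_EFin; first by near=> n.
    apply/cvgrPdist_le => e e0; have [n0 Hn] := lim0 e e0.
    near=> n; rewrite distrC; apply: Hn; near: n; exact: nbhs_infty_ge.
  apply: cvg_trans; apply: near_eq_cvg; near=> n; rewrite B1//.
  by near: n; exact: nbhs_infty_gt.
by rewrite /Rintegral (cvg_unique _ lim1 lim2).
Unshelve. all: by end_near. Qed.

Lemma ge0_reflection (G : R -> R) : continuous G -> (forall x, 0 <= G x) ->
  (\int[mu]_x (G x)%:E = \int[mu]_x (G (- x))%:E)%E.
Proof.
move=> cG G0; pose B (n : nat) := `[(- n%:R), n%:R]%classic : set R.
have H (K : R -> R) : continuous K -> (forall x, 0 <= K x) ->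
    (\int[mu]_(x in B i) (K x)%:E @[i --> \oo] --> \int[mu]_x (K x)%:E)%E.
  move=> cK sqrt_2pi; rewrite -[X in (\int[_]_(x in X) _)%E]bigcup_itvNn.
  apply: ge0_nondecreasing_set_cvg_integral.
  - exact: (@itvNn_nondecr id).
  - by move=> n; exact: measurable_itv.
  - by move=> n; apply/measurable_EFinP; apply: continuous_itv_meas => x _; exact: cK.
  - by move=> n x _; rewrite lee_fin.
have cGN : continuous (fun x => G (- x)).
  by move=> x; apply: continuous_comp; [exact: oppr_continuous|exact: cG].
have h1 := H _ cG G0; have h2 := H _ cGN (fun x => G0 (- x)).
have h3 : (\int[mu]_(x in B i) (G x)%:E @[i --> \oo] --> \int[mu]_x (G (- x))%:E)%E.
  apply: cvg_trans h2; apply: near_eq_cvg; near=> n; rewrite /B.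
  rewrite -[in LHS](opprK n%:R) integration_by_substitution_oppr ?opprK//.
  - by apply: eq_integral => x _ /=; rewrite opprK.
  - by rewrite (@le_trans _ _ 0)// oppr_le0.
  - exact: continuous_subspaceT.
exact: (cvg_unique _ h1 h3).
Unshelve. all: by end_near. Qed.

End Substitution.

(** * Complex-valued integrals and Laplace transforms *)

Section ComplexIntegral.
Context d (T : measurableType d) (R : realType) (m : {measure set T -> \bar R}).
Implicit Types (f g h : T -> R[i]) (u v : T -> R) (z w : R[i]).

Fact cint_key : unit. Proof. by []. Qed.
Definition cint f : R[i] :=
  locked_with cint_key ((\int[m]_x Re (f x)) +i* (\int[m]_x Im (f x))).
Lemma Re_cint f : Re (cint f) = \int[m]_x Re (f x). Proof. by rewrite /cint unlock. Qed.
Lemma Im_cint f : Im (cint f) = \int[m]_x Im (f x). Proof. by rewrite /cint unlock. Qed.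
Definition cintE := (Re_cint, Im_cint).

Definition cmeas f := measurable_fun setT (fun x => Re (f x)) /\
  measurable_fun setT (fun x => Im (f x)).
Definition rintg u := m.-integrable setT (EFin \o u).
Definition cintg f := rintg (fun x => Re (f x)) /\ rintg (fun x => Im (f x)).

Lemma rintg_meas u : rintg u -> measurable_fun setT u.
Proof. by move=> /measurable_int /measurable_EFinP. Qed.

Lemma rintg_dom u v : measurable_fun setT u -> rintg v ->
  (forall x, `|u x| <= v x) -> rintg u.
Proof.
move=> mu iv uv; apply: (le_integrable _ _ _ iv) => //; first exact/measurable_EFinP.
by move=> x _ /=; rewrite lee_fin (le_trans (uv x))// ler_norm.
Qed.

Lemma rintgZ c u : rintg u -> rintg (fun x => c * u x).
Proof. by move=> iu; have := integrableZl measurableT c iu; apply: eq_integrable. Qed.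

Lemma rintgD u v : rintg u -> rintg v -> rintg (fun x => u x + v x).
Proof. by move=> iu iv; have := integrableD measurableT iu iv; apply: eq_integrable. Qed.

Lemma rintgB u v : rintg u -> rintg v -> rintg (fun x => u x - v x).
Proof.
move=> iu /(rintgZ (-1)) iv; have := rintgD iu iv.
by under [X in rintg X -> _]eq_fun do rewrite mulN1r.
Qed.

(** A zero integral would force [u] to vanish almost everywhere. This is the source of both strict
    inequalities 0 < Theta < 1. *)
Lemma rintg_gt0 u : rintg u -> (forall x, 0 < u x) -> m setT != 0%E ->
  0 < \int[m]_x u x.
Proof.
move=> iu u0 mT; rewrite lt_def Rintegral_ge0 ?andbT; last by move=> x _; rewrite ltW.
apply: contra mT => /eqP I0; apply/eqP.
have mu : measurable_fun setT (EFin \o u) by exact: measurable_int iu.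
have e0 : (\int[m]_x `|(EFin \o u) x| = 0)%E.
  have -> : (\int[m]_x `|(EFin \o u) x| = \int[m]_x (EFin \o u) x)%E.
    by apply: eq_integral => x _ /=; rewrite ger0_norm// ltW.
  by rewrite -[LHS]fineK; [rewrite [fine _]I0|exact: integrable_fin_num].
have [N [mN N0 sN]] := (ae_eq_integral_abs _ measurableT mu).1 e0.
apply: (subset_measure0 _ _ _ N0) => // x _; apply: sN => /= /(_ I) /eqP.
by rewrite eqe gt_eqF.
Qed.

Lemma cmeas_real u : measurable_fun setT u -> cmeas (fun x => (u x)%:C).
Proof. by move=> mu; split => //; exact: measurable_cst. Qed.

Lemma cmeas_cst z : cmeas (fun=> z).
Proof. by split; exact: measurable_cst. Qed.

Lemma cmeasD f g : cmeas f -> cmeas g -> cmeas (fun x => f x + g x).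
Proof.
move=> [f1 f2] [g1 g2]; split.
  by under eq_fun do rewrite ReD; exact: measurable_funD.
by under eq_fun do rewrite ImD; exact: measurable_funD.
Qed.

Lemma cmeasM f g : cmeas f -> cmeas g -> cmeas (fun x => f x * g x).
Proof.
move=> [f1 f2] [g1 g2]; split.
  by under eq_fun do rewrite Re_mul; apply: measurable_funB; exact: measurable_funM.
by under eq_fun do rewrite Im_mul; apply: measurable_funD; exact: measurable_funM.
Qed.

Lemma cmeasN f : cmeas f -> cmeas (fun x => - f x).
Proof.
move=> [f1 f2]; split; [under eq_fun do rewrite ReN|under eq_fun do rewrite ImN].
  exact: measurableT_comp.
exact: measurableT_comp.
Qed.

Lemma cmeas_cex f : cmeas f -> cmeas (fun x => cex (f x)).
Proof.
move=> [f1 f2]; have me : measurable_fun setT (fun x => expR (Re (f x))).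
  exact: measurableT_comp.
split.
  under eq_fun do rewrite cexE /cexp Re_mul /= mul0r subr0.
  apply: measurable_funM => //; apply: (measurableT_comp _ f2).
  by apply: continuous_measurable_fun; exact: continuous_cos.
under eq_fun do rewrite cexE /cexp Im_mul /= mul0r addr0.
apply: measurable_funM => //; apply: (measurableT_comp _ f2).
by apply: continuous_measurable_fun; exact: continuous_sin.
Qed.

Lemma cmeas_cmod f : cmeas f -> measurable_fun setT (fun x => cmod (f x)).
Proof.
move=> [f1 f2]; rewrite /cmod.
apply: (measurableT_comp (f := @Num.sqrt R)).
  by apply: continuous_measurable_fun; exact: sqrt_continuous.
by apply: measurable_funD; apply: measurable_funX.
Qed.

Lemma cintg_dom f u : cmeas f -> rintg u -> (forall x, cmod (f x) <= u x) -> cintg f.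
Proof.
move=> [f1 f2] iu fu; split; apply: (rintg_dom _ iu) => // x.
  by rewrite (le_trans (Re_cmod _)).
by rewrite (le_trans (Im_cmod _)).
Qed.

Lemma eq_cint f g : (forall x, f x = g x) -> cint f = cint g.
Proof. by move=> fg; congr cint; exact/funext. Qed.

Lemma cint_real u : cint (fun x => (u x)%:C) = (\int[m]_x u x)%:C.
Proof. by apply: complex_ext; rewrite cintE// Rintegral_cst// mul0r. Qed.

Lemma cintD f g : cintg f -> cintg g -> cint (fun x => f x + g x) = cint f + cint g.
Proof.
move=> [f1 f2] [g1 g2]; apply: complex_ext; rewrite !ReImE !cintE.
  by rewrite -RintegralD//; apply: eq_Rintegral => x _; rewrite ReD.
by rewrite -RintegralD//; apply: eq_Rintegral => x _; rewrite ImD.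
Qed.

Lemma cintgD f g : cintg f -> cintg g -> cintg (fun x => f x + g x).
Proof.
move=> [f1 f2] [g1 g2]; split.
  by under eq_fun do rewrite ReD; exact: rintgD.
by under eq_fun do rewrite ImD; exact: rintgD.
Qed.

Lemma cintgZ z f : cintg f -> cintg (fun x => z * f x).
Proof.
move=> [f1 f2]; split.
  by under eq_fun do rewrite Re_mul; apply: rintgB; exact: rintgZ.
by under eq_fun do rewrite Im_mul; apply: rintgD; exact: rintgZ.
Qed.

Lemma cintZ z f : cintg f -> cint (fun x => z * f x) = z * cint f.
Proof.
move=> [f1 f2]; apply: complex_ext; rewrite !ReImE !cintE.
  rewrite -!RintegralZl// -RintegralB//; [|exact: rintgZ..].
  by apply: eq_Rintegral => x _; rewrite Re_mul.
rewrite -!RintegralZl// -RintegralD//; [|exact: rintgZ..].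
by apply: eq_Rintegral => x _; rewrite Im_mul.
Qed.

Lemma cintgB f g : cintg f -> cintg g -> cintg (fun x => f x - g x).
Proof.
move=> fi gi; have := cintgD fi (cintgZ (-1) gi).
by under [X in cintg X -> _]eq_fun do rewrite mulN1r.
Qed.

Lemma cintB f g : cintg f -> cintg g -> cint (fun x => f x - g x) = cint f - cint g.
Proof.
move=> fi gi; have := cintD fi (cintgZ (-1) gi); rewrite cintZ// mulN1r => <-.
by apply: eq_cint => x; rewrite mulN1r.
Qed.

Lemma cintg_sum (I : Type) (s : seq I) (F : I -> T -> R[i]) :
  (forall i, cintg (F i)) -> cintg (fun x => \sum_(i <- s) F i x).
Proof.
move=> H; elim: s => [|i s IH].
  under eq_fun do rewrite big_nil.
  have i0 : rintg (fun=> 0) by exact: integrable0.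
  by apply: (cintg_dom (cmeas_cst 0) i0) => x; rewrite cmod0.
under eq_fun do rewrite big_cons; exact: (cintgD (H i) IH).
Qed.

Lemma cint_sum (I : Type) (s : seq I) (F : I -> T -> R[i]) :
  (forall i, cintg (F i)) ->
  cint (fun x => \sum_(i <- s) F i x) = \sum_(i <- s) cint (F i).
Proof.
move=> H; elim: s => [|i s IH].
  rewrite big_nil; under eq_cint do rewrite big_nil.
  by rewrite (cint_real (fun=> 0)) Rintegral_cst// mul0r.
rewrite big_cons -IH -(cintD (H i) (cintg_sum s H)).
by apply: eq_cint => x; rewrite big_cons.
Qed.

(** The factor 2 comes from treating real and imaginary parts separately; it is harmless, as the
    bound only feeds derivative and growth estimates. *)
Lemma cmod_cint_le f u : cmeas f -> rintg u -> (forall x, cmod (f x) <= u x) ->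
  cmod (cint f) <= 2 * \int[m]_x u x.
Proof.
move=> mf iu fu; have [f1 f2] := cintg_dom mf iu fu.
have H (v : T -> R) : rintg v -> (forall x, `|v x| <= u x) -> `|\int[m]_x v x| <= \int[m]_x u x.
  move=> iv vu; rewrite (le_trans (le_normr_Rintegral _ _))// le_Rintegral//.
  exact: integrable_norm.
rewrite (le_trans (cmod_ReIm _))// !cintE mulr_natl mulr2n lerD// H// => x.
  by rewrite (le_trans (Re_cmod _)).
by rewrite (le_trans (Im_cmod _)).
Qed.

Section Laplace.
Variable phi : T -> R.

(* [h] is integrable against [exp (- z phi)] for [Re z] in the open set [I]. *)
Definition strip h (I : set R) := [/\ cmeas h, measurable_fun setT phi,
  forall x, I x -> exists2 e : R, 0 < e & I (x - e) /\ I (x + e) &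
  forall x, I x -> rintg (fun t => cmod (h t) * expR (- (x * phi t)))].

Definition lap h z := cint (fun t => h t * cex (- (z * (phi t)%:C))).

Let Re_expo z t : Re (- (z * (phi t)%:C)) = - (Re z * phi t).
Proof. by rewrite !ReImE mulr0 subr0. Qed.

Lemma lap_meas h z (I : set R) : strip h I -> cmeas (fun t => h t * cex (- (z * (phi t)%:C))).
Proof.
move=> [mh mphi _ _]; apply: cmeasM => //; apply/cmeas_cex/cmeasN.
by apply: cmeasM; [exact: cmeas_cst|exact: cmeas_real].
Qed.

Lemma lap_cintg h z (I : set R) : strip h I -> I (Re z) ->
  cintg (fun t => h t * cex (- (z * (phi t)%:C))).
Proof.
move=> hI Iz; have [mh mphi _ ih] := hI.
apply: (cintg_dom (lap_meas z hI) (ih _ Iz)) => t.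
by rewrite cmodM cmod_cex Re_expo.
Qed.

Lemma lap_bound h z (I : set R) : strip h I -> I (Re z) ->
  cmod (lap h z) <= 2 * \int[m]_t (cmod (h t) * expR (- (Re z * phi t))).
Proof.
move=> hI Iz; have [mh mphi _ ih] := hI.
apply: cmod_cint_le; [exact: lap_meas hI|exact: ih|].
by move=> t; rewrite cmodM cmod_cex Re_expo.
Qed.

Let expo_bound (x e t : R) : 0 < e ->
  expR (e * `|t|) * expR (- (x * t)) <= expR (- ((x - e) * t)) + expR (- ((x + e) * t)).
Proof.
move=> e0; rewrite -expRD.
have [t0|/ltW t0] := leP 0 t.
  rewrite ger0_norm//; have -> : e * t + - (x * t) = - ((x - e) * t) by ring.
  by rewrite lerDl expR_ge0.
rewrite ler0_norm//; have -> : e * - t + - (x * t) = - ((x + e) * t) by ring.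
by rewrite lerDr expR_ge0.
Qed.

Let strip_bound h (I : set R) x e : strip h I -> I (x - e) -> I (x + e) ->
  rintg (fun t => cmod (h t) * (expR (- ((x - e) * phi t)) + expR (- ((x + e) * phi t)))).
Proof.
move=> [_ _ _ ih] h1 h2; under eq_fun do rewrite mulrDr.
by apply: rintgD; exact: ih.
Qed.

Lemma strip_mul h (I : set R) : strip h I -> strip (fun t => - (phi t)%:C * h t) I.
Proof.
move=> hI; have [mh mphi openI ih] := hI; split => //.
  by apply: cmeasM => //; apply: cmeasN; exact: cmeas_real.
move=> x Ix; have [e e0 [I1 I2]] := openI x Ix.
have iB := rintgZ (e^-1) (strip_bound hI I1 I2).
apply: (rintg_dom _ iB).
  apply: measurable_funM.
    by apply: cmeas_cmod; apply: cmeasM => //; apply: cmeasN; exact: cmeas_real.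
  apply: measurableT_comp => //; apply: measurableT_comp => //.
  by apply: measurable_funM => //; exact: measurable_cst.
move=> t; rewrite ger0_norm ?mulr_ge0 ?cmod_ge0 ?expR_ge0//.
rewrite cmodM cmodN cmod_real.
have -> : `|phi t| * cmod (h t) * expR (- (x * phi t)) =
   cmod (h t) * (`|phi t| * expR (- (x * phi t))) by ring.
rewrite [leRHS]mulrCA ler_wpM2l ?cmod_ge0//.
rewrite [leRHS]mulrC ler_pdivlMr// (le_trans _ (expo_bound x (phi t) e0))//.
rewrite mulrAC ler_wpM2r ?expR_ge0// mulrC.
by rewrite (le_trans _ (expR_ge1Dx _))// lerDr.
Qed.

(** Differentiation under the integral with an explicit quadratic error. The second-order remainder
    of the exponential is absorbed by moving Re z to the endpoints Re z - e and Re z + e, where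
    [strip] still gives integrability. The phase is later [expR], [ch], [phi] or the identity; the
    last one yields regularity in the exponent, hence in mu. *)
Lemma lap_cdiff h (I : set R) z : strip h I -> I (Re z) ->
  cdiff (lap h) z (lap (fun t => - (phi t)%:C * h t) z).
Proof.
move=> hI Iz; have [mh mphi openI ih] := hI.
have [e e0 [I1 I2]] := openI _ Iz.
have iB := strip_bound hI I1 I2.
(* With p the phase, |p|^2 <= (4 / e)^2 exp (e |p| / 2), and exp (|k| |p|) <= exp (e |p| / 2) when
   |k| < e / 2; so the remainder costs C |k|^2 exp (e |p|). *)
pose C := 3 * (4 / e) ^+ 2.
apply: (@cdiff_quad _ _ _ _ (C * (2 * \int[m]_t (cmod (h t) *
   (expR (- ((Re z - e) * phi t)) + expR (- ((Re z + e) * phi t)))))) (e / 2)).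
  by rewrite divr_gt0.
move=> k ke.
have Hk : cintg (fun t => h t * cex (- ((z + k) * (phi t)%:C))).
  apply: (cintg_dom (lap_meas _ hI) iB) => t.
  rewrite cmodM ler_wpM2l ?cmod_ge0// cmod_cex.
  apply: le_trans (expo_bound (Re z) (phi t) e0).
  rewrite Re_expo -expRD ler_expR ReD.
  have : - (Re k * phi t) <= e * `|phi t|.
    rewrite (le_trans (ler_norm _))// normrN normrM ler_wpM2r//.
    by rewrite (le_trans (Re_cmod _))// (le_trans (ltW ke))// ler_pdivrMr// ler_peMr ?ler1n// ltW.
  by lra.
have H1 := lap_cintg hI Iz; have H2 := lap_cintg (strip_mul hI) Iz.
rewrite /lap -cintB// [X in _ - X]mulrC -cintZ// -cintB; [|exact: cintgB|exact: cintgZ].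
set u := (fun t => cmod (h t) * _) in iB *.
have -> : C * (2 * \int[m]_t u t) * cmod k ^+ 2 = 2 * \int[m]_t (C * cmod k ^+ 2 * u t).
  by rewrite RintegralZl//; ring.
apply: cmod_cint_le.
- have [//] : cintg (fun t => h t * cex (- ((z + k) * (phi t)%:C)) - h t * cex (- (z * (phi t)%:C)) -
    k * (- (phi t)%:C * h t * cex (- (z * (phi t)%:C)))) by apply: cintgB; [exact: cintgB|exact: cintgZ].
  by move=> a b; split; exact: rintg_meas.
- exact: rintgZ.
move=> t; set p := phi t.
have -> : h t * cex (- ((z + k) * p%:C)) - h t * cex (- (z * p%:C)) -
    k * (- p%:C * h t * cex (- (z * p%:C))) =
   h t * (cex (- (z * p%:C)) * (cex (- (k * p%:C)) - 1 - (- (k * p%:C)))).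
  by rewrite mulrDl opprD cexD; ring.
rewrite cmodM /u mulrCA ler_wpM2l ?cmod_ge0// cmodM cmod_cex Re_expo -/p.
have q := cex_sub1_id (- (k * p%:C)).
rewrite cmodN cmodM cmod_real in q.
have hp : `|p| <= 4 / e * expR (e / 4 * `|p|).
  rewrite mulrAC ler_pdivlMr//.
  have := expR_ge1Dx (e / 4 * `|p|) => h4.
  have : 4 * (1 + e / 4 * `|p|) <= 4 * expR (e / 4 * `|p|) by rewrite ler_wpM2l.
  by lra.
have hp2 : `|p| ^+ 2 <= (4 / e) ^+ 2 * expR (e / 2 * `|p|).
  have -> : expR (e / 2 * `|p|) = expR (e / 4 * `|p|) ^+ 2.
    by rewrite -expRM_natl; congr expR; field.
  by rewrite -exprMn lerXn2r// nnegrE// mulr_ge0 ?expR_ge0// divr_ge0// ltW.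
have hk : expR (cmod k * `|p|) <= expR (e / 2 * `|p|).
  by rewrite ler_expR ler_wpM2r// ltW.
have h3 : cmod (cex (- (k * p%:C)) - 1 - - (k * p%:C)) <=
    C * cmod k ^+ 2 * expR (e * `|p|).
  rewrite (le_trans q)// exprMn.
  have -> : C * cmod k ^+ 2 * expR (e * `|p|) = 3 * (cmod k ^+ 2 *
     ((4 / e) ^+ 2 * expR (e / 2 * `|p|))) * expR (e / 2 * `|p|).
    have -> : expR (e * `|p|) = expR (e / 2 * `|p|) * expR (e / 2 * `|p|).
      by rewrite -expRD; congr expR; field.
    by rewrite /C; ring.
  apply: ler_pM; rewrite ?expR_ge0//.
    by rewrite mulr_ge0// mulr_ge0 ?sqr_ge0.
  by rewrite ler_wpM2l// ler_wpM2l ?sqr_ge0.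
have C0 : 0 <= C * cmod k ^+ 2 by rewrite mulr_ge0 ?sqr_ge0// mulr_ge0 ?sqr_ge0.
have := expo_bound (Re z) p e0 => hb.
apply: (@le_trans _ _ (C * cmod k ^+ 2 * (expR (e * `|p|) * expR (- (Re z * p))))).
  by rewrite mulrC mulrA ler_wpM2r ?expR_ge0.
by rewrite ler_wpM2l.
Qed.

End Laplace.
End ComplexIntegral.

(** * Exponentially dominated integrands on the line and the plane, and Fubini *)

Section ExponentialIntegrands.
Variable R : realType.
Local Notation mu := (@lebesgue_measure R).
Local Notation cmeasR := (@cmeas _ (measurableTypeR R) R).
Local Notation cmeasRR := (@cmeas _ (measurableTypeR R * measurableTypeR R)%type R).
Implicit Types (x y t a b c : R) (z w p : R[i]).

(** The majorant is a multiple of the derivative of atan (exp (d v)), that is of 1 / cosh (d v). Its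
    integral is the measure of the range of that function, which lies in a bounded interval. *)
Lemma rintg_expR_norm (d : R) : 0 < d -> rintg mu (fun v => expR (- (d * `|v|))).
Proof.
move=> d0.
pose F v := atan (expR (d * v)).
pose F' v := (1 + expR (d * v) ^+ 2)^-1 * (expR (d * v) * d).
have dF v : is_derive v (1 : R) F (F' v).
  have h : is_derive v (1 : R) (fun v => d * v) d.
    have := is_deriveZ d (is_derive_id v (1 : R)).
    by move/is_derive_eq; apply; rewrite scaleRE mulr1.
  apply: (@is_derive1_comp _ (@atan R)).
have F'0 v : 0 < F' v by rewrite !mulr_gt0 ?invr_gt0 ?expR_gt0 ?ltr_pwDl ?sqr_ge0.
have ce : continuous (fun v => expR (d * v)).
  move=> v; apply: continuous_comp; last exact: continuous_expR.
  exact: scaler_continuous.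
have cF' : continuous F'.
  move=> v; apply: cvgM; last by apply: cvgM; [exact: ce|exact: cvg_cst].
  apply: cvgV; first by rewrite gt_eqF// ltr_pwDl ?sqr_ge0.
  apply: cvgD; first exact: cvg_cst.
  by rewrite expr2; apply: cvgM; exact: ce.
pose D : set R := [set y | exists n : nat, F (- n%:R) <= y <= F n%:R].
have DI : D `<=` `[- (pi / 2), pi / 2]%classic.
  move=> y [n /andP[h1 h2]] /=; rewrite in_itv /=; apply/andP; split.
    by rewrite (le_trans _ h1)// ltW// atan_gtNpi2.
  by rewrite (le_trans h2)// ltW// atan_ltpi2.
have mD : measurable D.
  have -> : D = \bigcup_n (`[F (- n%:R), F n%:R]%classic : set R).
    apply/seteqP; split => [y [n h]|y [n _ h]]; exists n => //.
  by apply: bigcupT_measurable => n; exact: measurable_itv.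
have := @ge0_increasing_substitution R F F' D dF cF' F'0 (fun y => iff_refl _) (fun=> 1).
move=> /(_ _ _) H.
have {}H : (\int[mu]_x (1 * F' x)%:E < +oo)%E.
  rewrite -H//; last by move=> x _; exact: cvg_cst.
  apply: (@le_lt_trans _ _ (\int[mu]_(x in `[(- (pi / 2))%R, (pi / 2)%R]) 1)%E).
    by apply: ge0_subset_integral => //; exact: measurable_itv.
  rewrite integral_cst//.
  rewrite mul1e /= lebesgue_measure_itv /=; case: ifP => _ //.
  by rewrite -EFinD ltry.
have iF' : rintg mu F'.
  apply/integrableP; split.
    by apply/measurable_EFinP; exact: continuous_measurable_fun.
  apply: le_lt_trans H; rewrite le_eqVlt; apply/orP; left; apply/eqP.
  by apply: eq_integral => x _ /=; rewrite mul1r ger0_norm// ltW.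
apply: (rintg_dom _ (rintgZ (2 / d) iF')).
  apply: continuous_measurable_fun => v; apply: continuous_comp; last exact: continuous_expR.
  apply: cvgN; apply: cvgM; first exact: cvg_cst.
  exact: norm_continuous.
move=> v; rewrite ger0_norm ?expR_ge0// /F'; set E := expR (d * v).
have E0 : 0 < E by exact: expR_gt0.
have q0 : 0 < 1 + E ^+ 2 by rewrite ltr_pwDl ?sqr_ge0.
have -> : 2 / d * ((1 + E ^+ 2)^-1 * (E * d)) = 2 * E / (1 + E ^+ 2).
  by field; rewrite !gt_eqF.
rewrite ler_pdivlMr//.
have [v0|/ltW v0] := leP 0 v.
  rewrite ger0_norm// expRN -/E mulrDr mulr1 expr2 mulrA mulVf ?gt_eqF// mul1r.
  have E1 : 1 <= E by rewrite -expR0 ler_expR mulr_ge0// ltW.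
  have : E^-1 <= 1 by rewrite invf_le1.
  by lra.
rewrite ler0_norm// mulrN opprK -/E.
have E1 : E <= 1 by rewrite -expR0 ler_expR mulr_ge0_le0// ltW.
have : E ^+ 2 <= 1 by rewrite exprn_ile1// ltW.
by move=> h; rewrite mulrC ler_pM2r//; lra.
Qed.

Lemma rintg_expR_norm2 (d : R) : 0 < d ->
  rintg (mu \x mu)%E (fun q : R * R => expR (- (d * `|q.1|)) * expR (- (d * `|q.2|))).
Proof.
move=> d0; have i1 := rintg_expR_norm d0.
pose e (v : R) := expR (- (d * `|v|)).
have me : measurable_fun setT e by exact: rintg_meas i1.
have mf : measurable_fun setT (fun q : R * R => (e q.1 * e q.2)%:E).
  apply/measurable_EFinP; apply: measurable_funM.
    by apply: (measurableT_comp me); exact: measurable_fst.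
  by apply: (measurableT_comp me); exact: measurable_snd.
apply/(integrable12ltyP mu mu mf).
pose K := \int[mu]_y e y.
have -> : (\int[mu]_x \int[mu]_y `|(e (x, y).1 * e (x, y).2)%:E| =
   \int[mu]_x (K%:E * (e x)%:E))%E.
  apply: eq_integral => x _ /=.
  have -> : (\int[mu]_y (`|e x * e y|)%:E = \int[mu]_y ((e x)%:E * (e y)%:E))%E.
    by apply: eq_integral => y _; rewrite ger0_norm// mulr_ge0 ?expR_ge0.
  rewrite integralZl// [RHS]muleC; congr (_ * _)%E.
  by rewrite /K /Rintegral fineK//; exact: integrable_fin_num.
by apply: integrable_lty => //; exact: integrableZl.
Qed.

(** The common decay class after t = exp v. Slices of a function dominated on the plane are
    dominated on the line, which supplies the slice hypotheses of Fubini. *)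
Definition exp_dominated f := exists (C d : R), 0 < d /\ forall v : R, cmod (f v) <= C * expR (- (d * `|v|)) :> R.
Definition exp_dominated2 (f : R * R -> R[i]) := exists (C d : R), 0 < d /\
  forall q : R * R, cmod (f q) <= C * (expR (- (d * `|q.1|)) * expR (- (d * `|q.2|))).

Lemma cintg_edom (f : R -> R[i]) : cmeasR f -> exp_dominated f -> cintg mu f.
Proof.
move=> mf [C [d [d0 H]]]; apply: (cintg_dom mf _ H).
exact/rintgZ/rintg_expR_norm.
Qed.

Lemma cintg_edom2 (f : R * R -> R[i]) : cmeasRR f -> exp_dominated2 f -> cintg (mu \x mu)%E f.
Proof.
move=> mf [C [d [d0 H]]]; apply: (cintg_dom mf _ H).
exact/rintgZ/rintg_expR_norm2.
Qed.

Lemma edom2_slice1 (f : R * R -> R[i]) x : exp_dominated2 f -> exp_dominated (fun y => f (x, y)).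
Proof.
move=> [C [d [d0 H]]]; exists (C * expR (- (d * `|x|))), d; split => // y.
by rewrite -mulrA; exact: H.
Qed.

Lemma edom2_slice2 (f : R * R -> R[i]) y : exp_dominated2 f -> exp_dominated (fun x => f (x, y)).
Proof.
move=> [C [d [d0 H]]]; exists (C * expR (- (d * `|y|))), d; split => // x.
by rewrite -mulrA [_ * expR (- (d * `|x|))]mulrC; exact: H.
Qed.

Lemma edom_weaken f C d d' : d' <= d ->
  (forall v : R, cmod (f v) <= C * expR (- (d * `|v|)) :> R) ->
  forall v : R, cmod (f v) <= `|C| * expR (- (d' * `|v|)) :> R.
Proof.
move=> dd H v; rewrite (le_trans (H v))// (@le_trans _ _ (`|C| * expR (- (d * `|v|))))//.
  by rewrite ler_wpM2r ?expR_ge0 ?ler_norm.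
by rewrite ler_wpM2l// ler_expR lerN2 ler_wpM2r.
Qed.

Lemma edom2_prod (f g : R -> R[i]) (h : R * R -> R[i]) : exp_dominated f -> exp_dominated g ->
  (forall q, cmod (h q) <= cmod (f q.1) * cmod (g q.2)) -> exp_dominated2 h.
Proof.
move=> [C [d [d0 Hf]]] [C' [d' [d'0 Hg]]] H.
pose m := Num.min d d'.
have md : m <= d by rewrite ge_min lexx.
have md' : m <= d' by rewrite ge_min lexx orbT.
exists (`|C| * `|C'|), m; split; first by rewrite lt_min d0.
move=> q; rewrite (le_trans (H q))// mulrACA.
by apply: ler_pM; rewrite ?cmod_ge0//; [exact: edom_weaken Hf _|exact: edom_weaken Hg _].
Qed.

Lemma cmeas_fst (f : R -> R[i]) : cmeasR f -> cmeasRR (fun q => f q.1).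
Proof.
by move=> [f1 f2]; split; [apply: (measurableT_comp f1)|apply: (measurableT_comp f2)].
Qed.

Lemma cmeas_snd (f : R -> R[i]) : cmeasR f -> cmeasRR (fun q => f q.2).
Proof.
by move=> [f1 f2]; split; [apply: (measurableT_comp f1)|apply: (measurableT_comp f2)].
Qed.

(* Tangent line of [x * exp] at the point where its slope is [c]. *)
Lemma expR_tangent c x : 0 < c -> 0 < x ->
  forall v, c * v <= x * expR v + c * (ln (c / x) - 1).
Proof.
move=> c0 x0 v; set L := ln (c / x).
have xL : x * expR L = c by rewrite /L lnK ?posrE ?divr_gt0//; field; rewrite gt_eqF.
have -> : x * expR v = c * expR (v - L).
  by rewrite -[in RHS]xL expRD expRN; field; rewrite gt_eqF ?expR_gt0.
have : c * (1 + (v - L)) <= c * expR (v - L) by rewrite ler_wpM2l ?expR_ge1Dx// ltW.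
by lra.
Qed.

(** For v >= 0 the tangent line of slope a + d leaves - d v to spare; for v < 0 the linear term
    decays by itself because d <= a. *)
Lemma gamma_exponent_bound a x d : 0 < d -> d <= a -> 0 < x ->
  exists C : R, forall v, a * v - x * expR v <= C - d * `|v|.
Proof.
move=> d0 da x0; have ad0 : 0 < a + d by rewrite addr_gt0// (lt_le_trans d0).
exists (`|(a + d) * (ln ((a + d) / x) - 1)|) => v.
set C := `|_|; have C0 : 0 <= C by exact: normr_ge0.
have e0 : 0 < x * expR v by rewrite mulr_gt0 ?expR_gt0.
have [v0|/ltW v0] := leP 0 v.
  have := expR_tangent ad0 x0 v; rewrite ger0_norm// => h.
  have := ler_norm ((a + d) * (ln ((a + d) / x) - 1)); rewrite -/C => h2.
  by lra.
rewrite ler0_norm//.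
have : (a - d) * v <= 0 by rewrite mulr_ge0_le0// subr_ge0.
lra.
Qed.

Section Fubini.
Variable f : R * R -> R[i].
Hypothesis fi : cintg (mu \x mu)%E f.
(** Every slice is integrable, not merely almost every one, so that each inner [cint] is a genuine
    value and integrals can be rewritten pointwise. *)
Hypothesis f1 : forall x, cintg mu (fun y => f (x, y)).
Hypothesis f2 : forall y, cintg mu (fun x => f (x, y)).

Let real12 (u : R * R -> R) : rintg (mu \x mu)%E u ->
  (forall x, rintg mu (fun y => u (x, y))) ->
  rintg mu (fun x => \int[mu]_y u (x, y)) /\
  \int[(mu \x mu)%E]_q u q = \int[mu]_x \int[mu]_y u (x, y).
Proof.
move=> iu iu1.
have E x : (\int[mu]_y (u (x, y))%:E = (\int[mu]_y u (x, y))%:E)%E.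
  rewrite /Rintegral fineK//.
  exact: (integrable_fin_num _ (iu1 x)).
split; first by apply: eq_integrable (integrable_fubini_F iu) => // x _; exact: E.
by rewrite /Rintegral -(integral12_prod_meas1 iu); congr fine; apply: eq_integral => x _; exact: E.
Qed.

Let real21 (u : R * R -> R) : rintg (mu \x mu)%E u ->
  (forall y, rintg mu (fun x => u (x, y))) ->
  \int[(mu \x mu)%E]_q u q = \int[mu]_y \int[mu]_x u (x, y).
Proof.
move=> iu iu1.
have E y : (\int[mu]_x (u (x, y))%:E = (\int[mu]_x u (x, y))%:E)%E.
  rewrite /Rintegral fineK//.
  exact: (integrable_fin_num _ (iu1 y)).
by rewrite /Rintegral -(integral21_prod_meas1 iu); congr fine; apply: eq_integral => x _; exact: E.
Qed.

Lemma cFubini12 : cint (mu \x mu)%E f = cint mu (fun x => cint mu (fun y => f (x, y))).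
Proof.
have [i1 i2] := fi; apply: complex_ext; rewrite !cintE.
  under [RHS]eq_Rintegral do rewrite cintE.
  by have [] := real12 i1 (fun x => (f1 x).1).
under [RHS]eq_Rintegral do rewrite cintE.
by have [] := real12 i2 (fun x => (f1 x).2).
Qed.

Lemma cFubini21 : cint (mu \x mu)%E f = cint mu (fun y => cint mu (fun x => f (x, y))).
Proof.
have [i1 i2] := fi; apply: complex_ext; rewrite !cintE.
  under [RHS]eq_Rintegral do rewrite cintE.
  by rewrite (real21 i1 (fun x => (f2 x).1)).
under [RHS]eq_Rintegral do rewrite cintE.
by rewrite (real21 i2 (fun x => (f2 x).2)).
Qed.

Lemma cintg_Fubini : cintg mu (fun x => cint mu (fun y => f (x, y))).
Proof.
have [i1 i2] := fi; split; [under eq_fun do rewrite cintE|under eq_fun do rewrite cintE].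
  by have [] := real12 i1 (fun x => (f1 x).1).
by have [] := real12 i2 (fun x => (f1 x).2).
Qed.

End Fubini.

Definition ccont (f : R -> R[i]) := continuous (fun v => Re (f v)) /\
  continuous (fun v => Im (f v)).

Lemma ccont_meas f : ccont f -> cmeasR f.
Proof. by move=> [f1 f2]; split; exact: continuous_measurable_fun. Qed.

Lemma ccont_cst z : ccont (fun=> z).
Proof. by split => x; exact: cvg_cst. Qed.

Lemma ccont_real (u : R -> R) : continuous u -> ccont (fun v => (u v)%:C).
Proof. by move=> cu; split => // x; exact: cvg_cst. Qed.

Lemma ccont_id : ccont (fun v => v%:C).
Proof. by apply: ccont_real => x; exact: cvg_id. Qed.

Lemma ccont_expR : ccont (fun v => (expR v)%:C).
Proof. by apply: ccont_real; exact: continuous_expR. Qed.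

Lemma ccontD f g : ccont f -> ccont g -> ccont (fun x => f x + g x).
Proof.
move=> [f1 f2] [g1 g2]; split => x.
  by under eq_fun do rewrite ReD; apply: cvgD; [exact: f1|exact: g1].
by under eq_fun do rewrite ImD; apply: cvgD; [exact: f2|exact: g2].
Qed.

Lemma ccontM f g : ccont f -> ccont g -> ccont (fun x => f x * g x).
Proof.
move=> [f1 f2] [g1 g2]; split => x.
  by under eq_fun do rewrite Re_mul; apply: cvgB; apply: cvgM; solve [exact: f1|exact: g1|exact: f2|exact: g2].
by under eq_fun do rewrite Im_mul; apply: cvgD; apply: cvgM; solve [exact: f1|exact: g1|exact: f2|exact: g2].
Qed.

Lemma ccontN f : ccont f -> ccont (fun x => - f x).
Proof.
move=> [f1 f2]; split => x.
  by under eq_fun do rewrite ReN; apply: cvgN; exact: f1.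
by under eq_fun do rewrite ImN; apply: cvgN; exact: f2.
Qed.

Lemma ccont_cdiff (f : R[i] -> R[i]) (g : R -> R[i]) :
  (forall v, exists l, cdiff f (g v) l) -> ccont g -> ccont (fun v => f (g v)).
Proof.
move=> df [g1 g2].
have H v : forall e, 0 < e -> \forall w \near v, cmod (f (g w) - f (g v)) <= e.
  move=> e e0; have [l /cdiff_lip[d [d0 L]]] := df v.
  pose K := cmod l + 1; have sqrt_2pi : 0 < K by rewrite ltr_wpDl ?cmod_ge0.
  have m0 : 0 < Num.min d (e / K) / 2 by rewrite divr_gt0// lt_min d0 divr_gt0.
  near=> w.
  have h1 : `|Re (g v) - Re (g w)| < Num.min d (e / K) / 2.
    near: w; have := g1 v; move/cvgrPdist_lt; exact.
  have h2 : `|Im (g v) - Im (g w)| < Num.min d (e / K) / 2.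
    near: w; have := g2 v; move/cvgrPdist_lt; exact.
  have : cmod (g w - g v) < Num.min d (e / K).
    rewrite (le_lt_trans (cmod_ReIm _))// ReB ImB (splitr (Num.min _ _)).
    by rewrite ltrD// distrC.
  rewrite lt_min => /andP[/L]; rewrite [g v + _]addrC subrK => h3 h4.
  rewrite (le_trans h3)// -/K.
  by have := ltW h4; rewrite ler_pdivlMr// mulrC.
split => v; apply/cvgrPdist_le => e e0; have := H v e e0; apply: filterS => w.
  by apply: le_trans; rewrite distrC -ReB Re_cmod.
by apply: le_trans; rewrite distrC -ImB Im_cmod.
Unshelve. all: by end_near. Qed.

Lemma ccont_cex f : ccont f -> ccont (fun x => cex (f x)).
Proof. by apply: ccont_cdiff => v; exists (cex (f v)); exact: cdiff_cex. Qed.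

Lemma cint_affine (f : R -> R[i]) a b : 0 < a -> ccont f ->
  cint mu f = cint mu (fun v => f (a * v + b) * a%:C).
Proof.
move=> a0 [f1 f2]; apply: complex_ext; rewrite !cintE /Rintegral.
  rewrite (substitution_affine b a0 f1); congr fine; apply: eq_integral => v _.
  by rewrite !ReImE mulr0 subr0.
rewrite (substitution_affine b a0 f2); congr fine; apply: eq_integral => v _.
by rewrite !ReImE mulr0 add0r.
Qed.

Lemma cint_shift (f : R -> R[i]) b : ccont f ->
  cint mu f = cint mu (fun v => f (v + b)).
Proof.
move=> cf; rewrite (cint_affine b ltr01 cf).
by apply: eq_cint => v; rewrite mulr1 mul1r.
Qed.

(** The substitution t = exp v. Only positive t enter, through the continuous [H], so the behaviour
    of [cpow] on the rest of the line does not interfere. *)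
Lemma cintegral_expR (f H : R -> R[i]) : ccont H ->
  (forall v, f (expR v) = H v) ->
  cintegral `]0%R, +oo[%classic f = cint mu (fun v => H v * (expR v)%:C).
Proof.
move=> [H1 H2] fH.
have fE x : 0 < x -> f x = H (ln x) by move=> x0; rewrite -fH lnK.
have key (G K : R -> R) : continuous K -> (forall x, 0 < x -> G x = K (ln x)) ->
    (\int[mu]_(x in `]0%R, +oo[) (G x)%:E = \int[mu]_x (K x * expR x)%:E)%E.
  move=> cK GK.
  have -> : (\int[mu]_(x in `]0%R, +oo[) (G x)%:E = \int[mu]_(x in `]0%R, +oo[) (K (ln x))%:E)%E.
    by apply: eq_integral => x; rewrite inE /= in_itv /= andbT => x0; rewrite GK.
  rewrite substitution_expR; first by apply: eq_integral => x _; rewrite expRK.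
  by move=> x x0; apply: continuous_comp; [exact: continuous_ln|exact: cK].
apply: complex_ext; rewrite /cintegral !cintE !ReImE /Rintegral.
  rewrite (key _ _ H1); first by congr fine; apply: eq_integral => v _; rewrite !ReImE mulr0 subr0.
  by move=> x /fE ->.
rewrite (key _ _ H2); first by congr fine; apply: eq_integral => v _; rewrite !ReImE mulr0 add0r.
by move=> x /fE ->.
Qed.

End ExponentialIntegrands.

(** * Gamma function and terminant *)

Section GammaFunction.
Variable R : realType.
Local Notation mu := (@lebesgue_measure R).
Implicit Types (x y t a b c : R) (z w p s : R[i]).

Lemma cpow1x q : cpow 1 q = 1 :> R[i].
Proof. by rewrite cpowE (_ : 1 = 1%:C)// clog_real// ln1 mulr0 cex0. Qed.

(** Euler's identity, from differentiating the scaling law in the scale at 1. The law is known for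
    real scales only, and real increments suffice to identify a complex derivative. *)
Lemma homogeneous_euler (H H' : R[i] -> R[i]) p :
  (forall z, 0 < Re z -> cdiff H z (H' z)) ->
  (forall x z, 0 < x -> 0 < Re z -> H (x%:C * z) = cpow x%:C (- p) * H z) ->
  forall z, 0 < Re z -> H' z * z + p * H z = 0.
Proof.
move=> dH hom z z0.
have d1 : cdiff (fun w => H (w * z) - cpow w (- p) * H z) 1
    (H' (1 * z) * (1 * z + 1 * 0) - (- p * cpow 1 (- p - 1) * H z + cpow 1 (- p) * 0)).
  apply: cdiffB.
    apply: (@cdiff_comp _ H (fun w => w * z)); first by apply: dH; rewrite mul1r.
    exact: (cdiffM (@cdiff_id _ 1) (cdiff_cst z 1)).
  exact: (cdiffM (cdiff_cpow (- p) (ltr01 : 0 < Re (1 : R[i]))) (cdiff_cst (H z) 1)).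
have /= := cdiff_unique0 ltr01 d1.
rewrite !cpow1x mul1r => H0; rewrite -[RHS]H0; first by ring.
move=> h h1; have h0 : 0 < 1 + h.
  by move: h1; rewrite ltr_norml => /andP[? _]; lra.
by rewrite -[1]/(1%:C) -rmorphD hom// subrr.
Qed.

(** By Euler's identity H z z^p has zero derivative, so a law for real scaling becomes a power law
    on the whole half-plane. This takes the place of rotating a contour. *)
Lemma homogeneous_right_half (H H' : R[i] -> R[i]) p :
  (forall z, 0 < Re z -> cdiff H z (H' z)) ->
  (forall x z, 0 < x -> 0 < Re z -> H (x%:C * z) = cpow x%:C (- p) * H z) ->
  forall z, 0 < Re z -> H z = H 1 * cpow z (- p).
Proof.
move=> dH hom.
have euler := homogeneous_euler dH hom.
move=> z z0.
have const : H z * cpow z p = H 1 * cpow 1 p.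
  apply: (@constant_right_half _ (fun z => H z * cpow z p)) => // w w0.
  have wn0 : w != 0 by apply: contraTneq w0 => ->; rewrite ltxx.
  have := cdiffM (dH w w0) (cdiff_cpow p w0).
  have -> // : H' w * cpow w p + H w * (p * cpow w (p - 1)) = 0.
  rewrite -[LHS](mulfK wn0) cpowB cpow1//.
  have -> : (H' w * cpow w p + H w * (p * (cpow w p / w))) * w =
     (H' w * w + p * H w) * cpow w p by field.
  by rewrite euler// !mul0r.
rewrite cpowN; apply: (mulIf (cpow_neq0 z p)); rewrite divfK ?cpow_neq0// const.
by rewrite cpow1x mulr1.
Qed.

Lemma edom_gamma a c x (f : R -> R[i]) : 0 < a -> 0 < x ->
  (forall v : R, cmod (f v) <= c * expR (a * v - x * expR v)) -> exp_dominated f.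
Proof.
move=> a0 x0 H; have [C HC] := gamma_exponent_bound a0 (lexx a) x0.
exists (`|c| * expR C), a; split => // v.
rewrite (le_trans (H v))// (@le_trans _ _ (`|c| * expR (a * v - x * expR v)))//.
  by rewrite ler_wpM2r ?expR_ge0 ?ler_norm.
by rewrite -mulrA -expRD ler_wpM2l// ler_expR.
Qed.

Lemma strip_gamma p : 0 < Re p ->
  strip mu (@expR R) (fun v => cex (p * v%:C)) [set x | 0 < x].
Proof.
move=> p0; split.
- apply: ccont_meas; apply: ccont_cex; apply: ccontM; first exact: ccont_cst.
  exact: ccont_id.
- by apply: continuous_measurable_fun; exact: continuous_expR.
- move=> x x0; exists (x / 2); first by rewrite divr_gt0.
  by split; rewrite /mkset; move: x0; rewrite /mkset; lra.
- move=> x x0; have [C HC] := gamma_exponent_bound p0 (lexx (Re p)) x0.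
  have i1 := rintgZ (expR C) (rintg_expR_norm p0).
  apply: (rintg_dom _ i1).
    apply: measurable_funM.
      apply: cmeas_cmod; apply: ccont_meas; apply: ccont_cex.
      by apply: ccontM; [exact: ccont_cst|exact: ccont_id].
    apply: continuous_measurable_fun => v; apply: continuous_comp; last exact: continuous_expR.
    by apply: cvgN; apply: cvgM; [exact: cvg_cst|exact: continuous_expR].
  move=> v; rewrite cmod_cex !ReImE mulr0 subr0 -expRD ger0_norm ?expR_ge0//.
  by rewrite -expRD ler_expR.
Qed.

(** For Re p > 0 and Re w > 0 this is Gamma(p) w^(- p), namely Euler's integral after t = exp v. *)
Definition gexp p w := lap mu (@expR R) (fun v => cex (p * v%:C)) w.

Lemma ccont_gexp p w : ccont (fun v => cex (p * v%:C) * cex (- (w * (expR v)%:C))).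
Proof.
apply: ccontM; apply: ccont_cex.
  by apply: ccontM; [exact: ccont_cst|exact: ccont_id].
by apply: ccontN; apply: ccontM; [exact: ccont_cst|exact: ccont_expR].
Qed.

Lemma gexp_cdiff p w : 0 < Re p -> 0 < Re w -> cdiff (gexp p) w (- gexp (p + 1) w).
Proof.
move=> p0 w0; have := lap_cdiff (strip_gamma p0) w0.
have -> // : lap mu (@expR R) (fun t => - (expR t)%:C * cex (p * t%:C)) w = - gexp (p + 1) w.
have p1 : 0 < Re (p + 1) by rewrite ReD addr_gt0.
rewrite /gexp /lap -[RHS]mulN1r -cintZ; last exact: (lap_cintg (strip_gamma p1)).
by apply: eq_cint => v; rewrite mulrDl cexD mul1r cex_real; ring.
Qed.

Lemma gexp_hom p x w : 0 < Re p -> 0 < x -> 0 < Re w ->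
  gexp p (x%:C * w) = cpow x%:C (- p) * gexp p w.
Proof.
move=> p0 x0 w0.
rewrite {1}/gexp /lap (cint_shift (- ln x)); last exact: ccont_gexp.
rewrite -cintZ; last exact: (lap_cintg (strip_gamma p0)).
apply: eq_cint => v; rewrite cpowE clog_real// -!cexD; congr cex.
have -> : (expR (v - ln x))%:C = (expR v)%:C / x%:C.
  by rewrite expRD expRN lnK ?posrE// rmorphM fmorphV.
have xn0 : x%:C != 0 by rewrite (inj_eq (@complexI R)) gt_eqF.
by rewrite rmorphB /=; field.
Qed.

Lemma gexpE p w : 0 < Re p -> 0 < Re w -> gexp p w = gexp p 1 * cpow w (- p).
Proof.
move=> p0; apply: homogeneous_right_half => [z|x z x0]; first exact: gexp_cdiff.
exact: gexp_hom.
Qed.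

Lemma gexpS p : 0 < Re p -> gexp (p + 1) 1 = p * gexp p 1.
Proof.
move=> p0.
have := homogeneous_euler (fun z => gexp_cdiff p0) (fun x z => gexp_hom p0) (ltr01 : 0 < Re (1 : R[i])).
by move=> /eqP; rewrite mulr1 addr_eq0 eqr_opp => /eqP.
Qed.

Lemma gexp_rising p k : 0 < Re p ->
  gexp (p + k%:R) 1 = \prod_(0 <= j < k) (p + j%:R) * gexp p 1.
Proof.
move=> p0; elim: k => [|k IH]; first by rewrite addr0 big_geq// mul1r.
rewrite -addn1 natrD addrA gexpS; last by rewrite !ReImE ltr_wpDr.
by rewrite addn1 big_nat_recr //= IH; ring.
Qed.

Lemma gexp_int s : gamma_int s = gexp s 1.
Proof.
rewrite /gamma_int (@cintegral_expR _ _ (fun v => cex ((s - 1) * v%:C) * (expR (- expR v))%:C)).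
- apply: eq_cint => v.
  by rewrite mulrBl mul1r cexD cexN !cex_real mul1r -rmorphN cex_real mulrAC divfK// -cex_real cex_neq0.
- apply: ccontM.
    by apply: ccont_cex; apply: ccontM; [exact: ccont_cst|exact: ccont_id].
  apply: ccont_real => x; apply: continuous_comp; last exact: continuous_expR.
  by apply: cvgN; exact: continuous_expR.
- by move=> v; rewrite cpow_expR.
Qed.

(** Any number of shifts reaching Re > 0 gives the same value. [gamma] picks its own number, while
    the prefactor must be read with N shifts and the terminants with none. *)
Lemma gammaE s n : 0 < Re s + n%:R ->
  gamma s = gexp (s + n%:R) 1 / \prod_(0 <= j < n) (s + j%:R).
Proof.
have key m k : (m <= k)%N -> 0 < Re s + m%:R ->
    gexp (s + k%:R) 1 / \prod_(0 <= j < k) (s + j%:R) =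
    gexp (s + m%:R) 1 / \prod_(0 <= j < m) (s + j%:R).
  move=> mk m0; rewrite -(subnKC mk) natrD addrA (@gexp_rising (s + m%:R)); last by rewrite ReD Re_nat.
  rewrite (big_cat_nat (leq0n m) (leq_addr (k - m) m)) /=.
  rewrite -{2}[m in X in _ * X]add0n big_addn addKn.
  have -> : \prod_(0 <= i < k - m) (s + (i + m)%:R) =
      \prod_(0 <= j < k - m) (s + m%:R + j%:R).
    by apply: eq_bigr => i _; rewrite natrD; ring.
  set A := \prod_(0 <= j < m) _; set B := \prod_(0 <= j < k - m) _.
  (* Only the extra factors, which have positive real part, are cancelled. The product A may vanish
     at a pole; both sides are then 0. *)
  have B0 : B != 0.
    rewrite prodf_seq_neq0; apply/allP => j _; apply/implyP => _.
    have : 0 < Re (s + m%:R + j%:R) by rewrite !ReImE ltr_wpDr.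
    by apply: contraTneq => ->; rewrite ltxx.
  by rewrite invfM [A^-1 * _]mulrC mulrACA mulfV// mul1r.
move=> n0; rewrite /gamma gexp_int; set k := (if _ then _ else _).
have k0 : 0 < Re s + k%:R.
  rewrite /k; case: ifPn; first by rewrite addr0.
  by rewrite -leNgt => s0; rewrite -ltrBlDl sub0r truncnS_gt.
by have [nk|/ltnW kn] := leqP n k; [exact: key|exact/esym/key].
Qed.

Lemma gexp_integrand_real a v :
  cex (a%:C * v%:C) * cex (- (1 * (expR v)%:C)) = (expR (a * v - expR v))%:C :> R[i].
Proof. by rewrite -!rmorphM mul1r -rmorphN !cex_real -rmorphM expRD. Qed.

Lemma gexp_real a : 0 < a -> gexp a%:C 1 = (\int[mu]_v expR (a * v - expR v))%:C.
Proof.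
move=> a0; rewrite -cint_real; apply: eq_cint => v.
exact: gexp_integrand_real.
Qed.

Lemma lebesgue_setT_neq0 : mu setT != 0%E.
Proof.
apply/eqP => h.
have : (mu `[0%R, 1%R]%classic <= mu setT)%E.
  by apply: le_measure; rewrite ?inE//; exact: measurable_itv.
by rewrite h lebesgue_measure_itv /= lte_fin ltr01 oppr0 adde0 lee_fin ler10.
Qed.

Lemma gexp_real_gt0 a : 0 < a -> 0 < \int[mu]_v expR (a * v - expR v).
Proof.
move=> a0; apply: rintg_gt0.
- have [+ _] := lap_cintg (strip_gamma (a0 : 0 < Re a%:C)) (ltr01 : 0 < Re (1 : R[i])).
  by apply: eq_integrable => // v _; rewrite /comp gexp_integrand_real.
- by move=> v; exact: expR_gt0.
- exact: lebesgue_setT_neq0.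
Qed.

Lemma expRNn_small (d e : R) : 0 < d -> 0 < e ->
  exists n0 : nat, forall n, (n0 <= n)%N -> expR (- (d * n%:R)) <= e.
Proof.
move=> d0 e0; exists (Num.truncn (d * e)^-1).+1 => n hn.
have de : 0 < d * e by rewrite mulr_gt0.
have h : (d * e)^-1 <= n%:R.
  by rewrite (@le_trans _ _ (Num.truncn (d * e)^-1).+1%:R) ?ler_nat// ltW// truncnS_gt.
rewrite expRN invf_ple ?posrE ?expR_gt0// (le_trans _ (expR_ge1Dx _))//.
rewrite (@le_trans _ _ (d * n%:R)) ?lerDr//.
by rewrite -ler_pdivrMl// -invfM.
Qed.

Lemma gexp11 : gexp 1 1 = 1.
Proof.
rewrite (gexp_real ltr01); congr (_%:C).
pose f v := - expR (- expR v) : R; pose f' v := expR (1 * v - expR v) : R.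
apply: (@ftc_R _ f).
- move=> v; rewrite mul1r expRD.
  have := is_deriveN (@is_derive1_comp _ expR (- expR) v _ _ (is_derive_expR _) (is_deriveN (is_derive_expR v))).
  by move/is_derive_eq; apply; ring.
- move=> v; apply: continuous_comp; last exact: continuous_expR.
  by apply: cvgB; [apply: cvgM; [exact: cvg_cst|exact: cvg_id]|exact: continuous_expR].
- have [+ _] := lap_cintg (strip_gamma (ltr01 : 0 < Re (1 : R[i]))) (ltr01 : 0 < Re (1 : R[i])).
  by apply: eq_integrable => // v _; rewrite /comp gexp_integrand_real.
move=> e e0; have [n0 H] := expRNn_small ltr01 (divr_gt0 e0 (ltr0Sn _ 1)).
exists n0 => n /H; rewrite mul1r => h.
have a1 : expR (- expR n%:R) <= expR (- n%:R) :> R.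
  by rewrite ler_expR lerN2 (le_trans _ (expR_ge1Dx _))// lerDr.
have a2 := expR_ge1Dx (- expR (- n%:R) : R).
have a3 := expR_gt0 (- expR n%:R : R).
have a4 : expR (- expR (- n%:R)) < 1 :> R by rewrite -expR0 ltr_expR oppr_lt0 expR_gt0.
by rewrite ler_norml /f; apply/andP; split; lra.
Qed.

End GammaFunction.

(** * Integral representation of Gamma(p) times the terminant on the positive axis *)

Section Terminant.
Variable R : realType.
Local Notation mu := (@lebesgue_measure R).
Local Notation cmeasR := (@cmeas _ (measurableTypeR R) R).
Local Notation cmeasRR := (@cmeas _ (measurableTypeR R * measurableTypeR R)%type R).
Implicit Types (x y t a b c e : R) (z w p s : R[i]).

Lemma cex_pi2 : cex ((pi / 2%:R)%:C * 'i%C) = 'i%C :> R[i].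
Proof.
have -> : (pi / 2%:R)%:C * 'i%C = 0 +i* (pi / 2) :> R[i].
  by apply: complex_ext; rewrite !ReImE; ring.
by rewrite cexE /cexp /= expR0 cos_pihalf sin_pihalf mul1r.
Qed.

Definition unit_sign e := e = 1 \/ e = -1.

Lemma cex_sign e : unit_sign e -> cex (e%:C * ((pi / 2%:R)%:C * 'i%C)) = e%:C * 'i%C :> R[i].
Proof.
case=> ->; first by rewrite !mul1r cex_pi2.
rewrite rmorphN1 !mulN1r cexN cex_pi2.
by apply: (mulfI (x := 'i%C : R[i])); rewrite ?mulrN ?i_real_sqr ?opprK ?divff// eq_complex /= oner_eq0 andbF.
Qed.

(** For e = 1 or -1 the path x e i + t of the incomplete Gamma function equals e i times x - i e t.
    The second factor stays in Re > 0, where powers are under control. *)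
Definition ray x e t : R[i] := x%:C - 'i%C * (e * t)%:C.

Lemma Re_ray x e t : Re (ray x e t) = x.
Proof. by rewrite /ray !ReImE; ring. Qed.

(** The argument of the ray lies strictly within pi / 2 of 0, so a further quarter turn stays inside
    the principal branch. *)
Lemma cpow_rotate x y e p : unit_sign e -> 0 < x ->
  cpow (x%:C * (e%:C * 'i%C) + y%:C) p =
  cex (e%:C * ((pi / 2%:R)%:C * 'i%C * p)) * cpow (ray x e y) p.
Proof.
move=> e1 x0; rewrite !cpowE -cexD; congr cex.
have ee : e * e = 1 by case: e1 => ->; rewrite ?mulr1 ?mulrNN ?mulr1.
have -> : x%:C * (e%:C * 'i%C) + y%:C =
    cex (e%:C * ((pi / 2%:R)%:C * 'i%C) + clog (ray x e y)).
  rewrite cexD cex_sign// cex_clog ?Re_ray//.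
  have -> : e%:C * 'i%C * ray x e y = x%:C * (e%:C * 'i%C) - ('i%C * 'i%C) * (e * e * y)%:C.
    by rewrite /ray !rmorphM /=; ring.
  by rewrite i_real_sqr ee mul1r mulN1r opprK.
rewrite clog_cex; first by ring.
have := Im_clog (z := ray x e y); rewrite Re_ray => /(_ x0).
rewrite !ltr_norml ImD; set th := Im (clog _) => /andP[h1 h2].
have -> : Im (e%:C * ((pi / 2%:R)%:C * 'i%C)) = e * (pi / 2) by rewrite !ReImE; ring.
have := pi_gt0 R.
by case: e1 => ->; rewrite ?mul1r ?mulN1r => ?; apply/andP; split; lra.
Qed.

Lemma ccont_ray x e : ccont (fun y => ray x e (expR y)).
Proof.
apply: ccontD; first exact: ccont_cst.
apply: ccontN; apply: ccontM; first exact: ccont_cst.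
by apply: ccont_real => y; apply: cvgM; [exact: cvg_cst|exact: continuous_expR].
Qed.

Lemma ccont_cpow_ray x e p : 0 < x -> ccont (fun y => cpow (ray x e (expR y)) p).
Proof.
move=> x0; apply: (@ccont_cdiff _ (fun w => cpow w p)); last exact: ccont_ray.
by move=> y; eexists; apply: cdiff_cpow; rewrite Re_ray.
Qed.

Lemma cmod_cpow_ray x e t p : 0 < x -> 0 < Re p ->
  cmod (cpow (ray x e t) (- p)) <= expR (- (Re p * ln x) + `|Im p| * (pi / 2)).
Proof.
move=> x0 p0; rewrite cpowE cmod_cex ler_expR !ReImE.
have xw : x <= cmod (ray x e t).
  by rewrite -{1}(Re_ray x e t) (le_trans (ler_norm _))// Re_cmod.
have w0 : 0 < cmod (ray x e t) by exact: lt_le_trans xw.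
have := Im_clog (z := ray x e t); rewrite Re_ray => /(_ x0) h.
have lx : ln x <= ln (cmod (ray x e t)) by rewrite ler_ln.
have h1 : Re p * ln x <= Re p * ln (cmod (ray x e t)) by rewrite ler_wpM2l// ltW.
have h2 : `|Im p * Im (clog (ray x e t))| <= `|Im p| * (pi / 2).
  by rewrite normrM ler_wpM2l// ltW.
have h3 := ler_norm (Im p * Im (clog (ray x e t))).
have -> : carg (ray x e t) = Im (clog (ray x e t)) by [].
by lra.
Qed.

Definition wexp y : R := expR (y - expR y).

Lemma ccont_wexp : ccont (fun y => (wexp y)%:C).
Proof.
apply: ccont_real => y; apply: continuous_comp; last exact: continuous_expR.
by apply: cvgB; [exact: cvg_id|exact: continuous_expR].
Qed.

Lemma edom_wexp : exp_dominated (fun y => (wexp y)%:C).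
Proof.
apply: (@edom_gamma _ 1 1 1) => // v.
by rewrite cmod_real !mul1r ger0_norm ?expR_ge0.
Qed.

Lemma edom_mul_bounded (f g : R -> R[i]) c :
  (forall v, cmod (f v) <= c) -> exp_dominated g -> exp_dominated (fun v => f v * g v).
Proof.
move=> H [C [d [d0 Hg]]]; exists (c * C), d; split => // v.
by rewrite cmodM -mulrA ler_pM ?cmod_ge0.
Qed.

(** The exponential factors in the terminant exactly undo the quarter turn, leaving the integral of
    (x - i e t)^(- p) exp (- t) over t > 0, with t = exp y. *)
Lemma inc_gamma_ray x e p : unit_sign e -> 0 < x -> 0 < Re p ->
  cex (e%:C * ((pi / 2%:R)%:C * 'i%C * p)) * cex (e%:C * ('i%C * x%:C)) *
    inc_gamma (1 - p) (x%:C * (e%:C * 'i%C)) =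
  cint mu (fun y => cpow (ray x e (expR y)) (- p) * (wexp y)%:C).
Proof.
move=> e1 x0 p0.
have ci : cintg mu (fun y => cpow (ray x e (expR y)) (- p) * (wexp y)%:C).
  apply: cintg_edom.
    by apply: ccont_meas; apply: ccontM; [exact: ccont_cpow_ray|exact: ccont_wexp].
  by apply: edom_mul_bounded edom_wexp => v; exact: cmod_cpow_ray.
rewrite /inc_gamma (@cintegral_expR _ _ (fun y => cex (e%:C * ((pi / 2%:R)%:C * 'i%C * (- p))) *
   cpow (ray x e (expR y)) (- p) * cex (- (x%:C * (e%:C * 'i%C) + (expR y)%:C)))).
- set E := cex _ * cex _; have E0 : E != 0 by rewrite mulf_neq0 ?cex_neq0.
  transitivity (E * cint mu (fun y => E^-1 * (cpow (ray x e (expR y)) (- p) * (wexp y)%:C))).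
    congr (_ * _); apply: eq_cint => y.
    rewrite /E invfM -!cexN /wexp expRD [(expR y * _)%:C]rmorphM /= opprD cexD -[- (expR y)%:C]rmorphN cex_real.
    have -> : e%:C * ((pi / 2)%:C * 'i%C * - p) = - (e%:C * ((pi / 2)%:C * 'i%C * p)) by ring.
    have -> : x%:C * (e%:C * 'i%C) = e%:C * ('i%C * x%:C) by ring.
    by ring.
  by rewrite cintZ// mulVKf.
- apply: ccontM.
    by apply: ccontM; [exact: ccont_cst|exact: ccont_cpow_ray].
  by apply: ccont_cex; apply: ccontN; apply: ccontD; [exact: ccont_cst|exact: ccont_expR].
- move=> y; rewrite cpow_rotate//.
  have -> : 1 - p - 1 = - p by ring.
  by rewrite -cexE.
Qed.

(** Gamma(p) times the power of the ray is again an integral, in v. After exchanging the order, the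
    integral over y is Euler's integral for exponent 1 and equals 1 / (1 - i e exp v). *)
Lemma gamma_inc_gamma_ray x e p : 0 < x -> 0 < Re p ->
  gexp p 1 * cint mu (fun y => cpow (ray x e (expR y)) (- p) * (wexp y)%:C) =
  cint mu (fun v => cex (p * v%:C) * cex (- (x%:C * (expR v)%:C)) *
     (ray 1 e (expR v))^-1).
Proof.
move=> x0 p0.
have ci : cintg mu (fun y => cpow (ray x e (expR y)) (- p) * (wexp y)%:C).
  apply: cintg_edom.
    by apply: ccont_meas; apply: ccontM; [exact: ccont_cpow_ray|exact: ccont_wexp].
  by apply: edom_mul_bounded edom_wexp => v; exact: cmod_cpow_ray.
pose f (q : R * R) := cex (p * q.2%:C) * cex (- (ray x e (expR q.1) * (expR q.2)%:C)) * (wexp q.1)%:C.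
have cf : cmeasRR f.
  apply: cmeasM; last first.
    by apply: (cmeas_fst (f := fun y => (wexp y)%:C)); apply: ccont_meas; exact: ccont_wexp.
  apply: cmeasM.
    apply: (cmeas_snd (f := fun v => cex (p * v%:C))); apply: ccont_meas; apply: ccont_cex.
    by apply: ccontM; [exact: ccont_cst|exact: ccont_id].
  apply: cmeas_cex; apply: cmeasN; apply: cmeasM.
    by apply: (cmeas_fst (f := fun y => ray x e (expR y))); apply: ccont_meas; exact: ccont_ray.
  by apply: (cmeas_snd (f := fun y => (expR y)%:C)); apply: ccont_meas; exact: ccont_expR.
pose g v := cex (p * v%:C) * cex (- (x%:C * (expR v)%:C)).
have eg : exp_dominated g.
  apply: (@edom_gamma _ (Re p) 1 x) => // v.
  by rewrite cmodM !cmod_cex mul1r -expRD ler_expR !ReImE; lra.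
have ef : exp_dominated2 f.
  apply: (edom2_prod edom_wexp eg) => q.
  rewrite /f /g (cmodM (_ * _)) (cmodM (cex _) (cex _)) (cmodM (cex _) (cex _)).
  rewrite !cmod_cex mulrC ler_wpM2l ?cmod_ge0//.
  rewrite ler_wpM2l ?expR_ge0// ler_expR.
  by rewrite ReN Re_mul Re_ray Im_real mulr0 subr0 !ReImE; lra.
have s1 y : cintg mu (fun v => f (y, v)).
  apply: cintg_edom; last exact: edom2_slice1.
  rewrite /f /=; apply: ccont_meas; apply: ccontM; last exact: ccont_cst.
  exact: ccont_gexp.
have s2 v : cintg mu (fun y => f (y, v)).
  apply: cintg_edom; last exact: edom2_slice2.
  rewrite /f /=; apply: ccont_meas; apply: ccontM; last exact: ccont_wexp.
  apply: ccontM; first exact: ccont_cst.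
  apply: ccont_cex; apply: ccontN; apply: ccontM; last exact: ccont_cst.
  exact: ccont_ray.
have cif := cintg_edom2 cf ef.
rewrite -(cintZ _ ci).
transitivity (cint mu (fun y => cint mu (fun v => f (y, v)))).
  apply: eq_cint => y; rewrite mulrA -gexpE ?Re_ray// /gexp /lap mulrC -cintZ; last first.
    by apply: (lap_cintg (strip_gamma p0)); rewrite Re_ray.
  by apply: eq_cint => v; rewrite /f /= mulrC.
rewrite -(cFubini12 cif s1) (cFubini21 cif s2); apply: eq_cint => v.
have r0 : 0 < Re (ray 1 e (expR v)) by rewrite Re_ray.
have -> : (ray 1 e (expR v))^-1 = gexp 1 (ray 1 e (expR v)).
  by rewrite gexpE// gexp11 mul1r cpowN cpow1.
rewrite /gexp /lap -cintZ; last first.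
  by apply: (lap_cintg (strip_gamma (ltr01 : 0 < Re (1 : R[i])))).
apply: eq_cint => y; rewrite /f /= -!mulrA; congr (_ * _).
rewrite /wexp -(cex_real (y - expR y)) -!cexD; congr (cex _).
by rewrite /ray !rmorphM !rmorphB /=; ring.
Qed.

(** The form of Gamma(p) Pi_p(x) used throughout: the integral of t^(p-1) exp (- t) / (1 + (t /
    x)^2) with t = exp v. *)
Definition termint p x := cint mu (fun v => cex (p * v%:C) *
  (expR (- expR v) / (1 + expR v ^+ 2 / x ^+ 2))%:C).

Lemma ray_sum v : (ray 1 1 v)^-1 + (ray 1 (-1) v)^-1 = (2 / (1 + v ^+ 2))%:C.
Proof.
have h e : ray 1 e v != 0.
  by apply: contraTneq (ltr01 : 0 < 1 :> R) => h; rewrite -(Re_ray 1 e v) h ltxx.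
have v0 : 1 + v ^+ 2 != 0 by rewrite gt_eqF// ltr_pwDl ?sqr_ge0.
have e1 : ray 1 1 v * ray 1 (-1) v = (1 + v ^+ 2)%:C.
  by apply: complex_ext; rewrite /ray !ReImE; ring.
have e2 : ray 1 1 v + ray 1 (-1) v = 2%:C.
  by apply: complex_ext; rewrite /ray !ReImE; ring.
have -> : (ray 1 1 v)^-1 + (ray 1 (-1) v)^-1 =
    (ray 1 1 v + ray 1 (-1) v) / (ray 1 1 v * ray 1 (-1) v).
  by field; rewrite !h.
by rewrite e1 e2 rmorphM fmorphV.
Qed.

(** The two incomplete Gamma terms contribute conjugate reciprocals, whose sum is 2 / (1 + exp (2
    v)) by [ray_sum]. Translating v by ln x moves the scale x from the exponential into the
    kernel. *)
Lemma gamma_terminant p x : 0 < x -> 0 < Re p ->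
  gamma p * terminant p x%:C = termint p x.
Proof.
move=> x0 p0; rewrite (@gammaE _ p 0) ?addr0// big_geq// divr1.
have g1 e : cintg mu (fun v => cex (p * v%:C) * cex (- (x%:C * (expR v)%:C)) *
     (ray 1 e (expR v))^-1).
  apply: cintg_edom.
    apply: ccont_meas; apply: ccontM; first exact: ccont_gexp.
    apply: (@ccont_cdiff _ (fun w => w^-1)); last exact: ccont_ray.
    move=> u; eexists; apply: cdiff_inv.
    by apply: contraTneq (ltr01 : 0 < 1 :> R) => h; rewrite -(Re_ray 1 e (expR u)) h ltxx.
  apply: (@edom_gamma _ (Re p) 1 x) => // u.
  rewrite cmodM (cmodM (cex _)) !cmod_cex mul1r -expRD cmodV.
  have -> : Re (p * u%:C) + Re (- (x%:C * (expR u)%:C)) = Re p * u - x * expR u.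
    by rewrite !ReImE; ring.
  rewrite ler_piMr ?expR_ge0// invf_le1.
    by rewrite (le_trans _ (Re_cmod _))// Re_ray normr1.
  by rewrite cmod_gt0; apply: contraTneq (ltr01 : 0 < 1 :> R) => h; rewrite -(Re_ray 1 e (expR u)) h ltxx.
rewrite /terminant -!cexE.
have := @inc_gamma_ray x 1 p (or_introl erefl) x0 p0.
rewrite !mul1r cex_pi2 => ->.
have := @inc_gamma_ray x (-1) p (or_intror erefl) x0 p0.
have -> : (-1)%:C = -1 :> R[i] by rewrite rmorphN1.
have -> : cex (- ((pi / 2%:R)%:C * 'i%C)) = - 'i%C :> R[i].
  rewrite cexN cex_pi2; apply: (mulfI (x := 'i%C : R[i])).
    by rewrite eq_complex /= oner_eq0 andbF.
  by rewrite divff ?mulrN ?i_real_sqr ?opprK// eq_complex /= oner_eq0 andbF.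
rewrite !mulN1r => ->.
rewrite mulrCA mulrDr.
transitivity (cpow x%:C p / 2%:R * (cint mu (fun v => cex (p * v%:C) * cex (- (x%:C * (expR v)%:C)) *
     (ray 1 1 (expR v))^-1) + cint mu (fun v => cex (p * v%:C) * cex (- (x%:C * (expR v)%:C)) *
     (ray 1 (-1) (expR v))^-1))).
  congr (_ * (_ + _)); exact: gamma_inc_gamma_ray.
rewrite -(cintD (g1 1) (g1 (-1))).
pose g v := cex (p * v%:C) * cex (- (x%:C * (expR v)%:C)) * ((1 + expR v ^+ 2)^-1)%:C.
have gE v : cex (p * v%:C) * cex (- (x%:C * (expR v)%:C)) / ray 1 1 (expR v) +
    cex (p * v%:C) * cex (- (x%:C * (expR v)%:C)) / ray 1 (-1) (expR v) = 2%:C * g v.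
  by rewrite -mulrDr ray_sum rmorphM /g; ring.
have gi : cintg mu g.
  have := cintgZ (2%:C^-1) (cintgD (g1 1) (g1 (-1))).
  congr (cintg _ _); apply/funext => v; rewrite gE mulKf//.
  by rewrite (inj_eq (@complexI R)).
rewrite [cint mu _](_ : _ = cint mu (fun v => 2%:C * g v)); last first.
  by apply: eq_cint => v; exact: gE.
rewrite (cintZ _ gi).
rewrite /termint [in RHS](cint_shift (ln x)); last first.
  apply: ccontM.
    by apply: ccont_cex; apply: ccontM; [exact: ccont_cst|exact: ccont_id].
  apply: ccont_real => v; apply: cvgM.
    apply: continuous_comp; last exact: continuous_expR.
    by apply: cvgN; exact: continuous_expR.
  apply: cvgV.
    by rewrite gt_eqF// ltr_pwDl// divr_ge0 ?sqr_ge0.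
  apply: cvgD; first exact: cvg_cst.
  apply: cvgM; last exact: cvg_cst.
  by rewrite expr2; apply: cvgM; exact: continuous_expR.
have -> : cpow x%:C p / 2%:R * (2%:C * cint mu g) = cpow x%:C p * cint mu g.
  have -> : 2%:C = 2%:R :> R[i] by rewrite rmorph_nat.
  by rewrite mulrA divfK// pnatr_eq0.
rewrite -cintZ//; apply: eq_cint => v.
rewrite /g expRD lnK ?posrE// rmorphD mulrDr cexD cpowE clog_real//.
rewrite -rmorphM -rmorphN cex_real.
have -> : 1 + (expR v * x) ^+ 2 / x ^+ 2 = 1 + expR v ^+ 2 by field; rewrite gt_eqF.
by rewrite [expR v * x]mulrC [((expR _) / _)%:C]rmorphM; ring.
Qed.

End Terminant.

(** * The Lommel function as a double Laplace integral *)

Section Hyperbolic.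
Variable R : realType.
Local Notation mu := (@lebesgue_measure R).
Local Notation cmeasR := (@cmeas _ (measurableTypeR R) R).
Local Notation cmeasRR := (@cmeas _ (measurableTypeR R * measurableTypeR R)%type R).
Implicit Types (x y t a b c e u v nu : R) (z w p s : R[i]).

Definition ch u : R := (expR u + expR (- u)) / 2.
Definition sh u : R := (expR u - expR (- u)) / 2.

Lemma ch_gt0 u : 0 < ch u.
Proof. by rewrite divr_gt0// addr_gt0 ?expR_gt0. Qed.

Lemma sh_le_ch u : `|sh u| <= ch u.
Proof.
rewrite ler_norml /sh /ch; have := expR_gt0 u; have := expR_gt0 (- u).
by move=> ? ?; apply/andP; split; lra.
Qed.

Lemma expR_norm_ch u : expR `|u| <= 2 * ch u.
Proof.
have -> : 2 * ch u = expR u + expR (- u) by rewrite /ch; field.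
have [u0|u0] := leP 0 u.
  by rewrite ger0_norm// lerDl expR_ge0.
by rewrite ltr0_norm// lerDr expR_ge0.
Qed.

Lemma continuous_ch : continuous ch.
Proof.
move=> u; apply: cvgM; last exact: cvg_cst.
apply: cvgD; first exact: continuous_expR.
by apply: continuous_comp; [exact: oppr_continuous|exact: continuous_expR].
Qed.

Definition phi (q : R * R) : R := expR q.1 * ch q.2.

Lemma measurable_phi : @measurable_fun _ _ (measurableTypeR R * measurableTypeR R)%type (measurableTypeR R) setT phi.
Proof.
apply: measurable_funM.
  by apply: (measurableT_comp (f := @expR R)).
apply: (measurableT_comp (f := ch)) => //.
by apply: continuous_measurable_fun; exact: continuous_ch.
Qed.

(** Since exp v cosh u >= exp (v + |u|) / 2, the one-variable bound applies at v + |u|. It yields -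
    b |u| as well, which beats nu u; splitting the gap b - |nu| into two halves d leaves decay d in
    each variable. *)
Lemma phi_exponent_bound b nu x : `|nu| < b -> 0 < x -> exists (C d : R), 0 < d /\
  forall v u, b * v + nu * u - x * (expR v * ch u) <= C - d * `|v| - d * `|u|.
Proof.
move=> nub x0; pose d := (b - `|nu|) / 2.
have d0 : 0 < d by rewrite divr_gt0// subr_gt0.
have n0 := normr_ge0 nu.
have db : d <= b by rewrite /d; lra.
have x20 : 0 < x / 2 by rewrite divr_gt0.
have [C HC] := gamma_exponent_bound d0 db x20.
exists C, d; split => // v u.
have := HC (v + `|u|); rewrite expRD => h.
have h1 : x * (expR v * ch u) >= x / 2 * (expR v * expR `|u|).
  have -> : x / 2 * (expR v * expR `|u|) = x * (expR v * (expR `|u| / 2)) by field.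
  rewrite ler_wpM2l ?(ltW x0)// ler_wpM2l ?expR_ge0// ler_pdivrMr// mulrC.
  exact: expR_norm_ch.
have h2 : nu * u <= `|nu| * `|u| by rewrite -normrM ler_norm.
have h3 : `|v| - `|u| <= `|v + `|u| |.
  have := ler_normD (v + `|u|) (- `|u|); rewrite addrK normrN normr_id; lra.
have h4 : d * (`|v| - `|u|) <= d * `|v + `|u| | by rewrite ler_wpM2l// ltW.
have h5 : `|nu| = b - 2 * d by rewrite /d; field.
rewrite h5 in h2.
have u0 := normr_ge0 u.
by rewrite !mulrDr mulrDl in h2 h h4 *; lra.
Qed.

Lemma strip_phi (h : R * R -> R[i]) b nu : cmeasRR h -> `|nu| < b ->
  (forall q, cmod (h q) <= expR (b * q.1 + nu * q.2)) ->
  strip (mu \x mu)%E phi h [set x | 0 < x].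
Proof.
move=> mh nub hb; split => //.
- exact: measurable_phi.
- move=> x x0; exists (x / 2); first by rewrite divr_gt0.
  by split; rewrite /mkset; move: x0; rewrite /mkset; lra.
move=> x x0; have [C [d [d0 H]]] := phi_exponent_bound nub x0.
apply: (rintg_dom _ (rintgZ (expR C) (rintg_expR_norm2 d0))).
  apply: measurable_funM; first exact: cmeas_cmod.
  apply: (measurableT_comp (f := fun y => expR (- (x * y)))); last exact: measurable_phi.
  apply: continuous_measurable_fun => y; apply: continuous_comp; last exact: continuous_expR.
  by apply: cvgN; apply: cvgM; [exact: cvg_cst|exact: cvg_id].
move=> q; rewrite ger0_norm ?mulr_ge0 ?cmod_ge0 ?expR_ge0//.
rewrite (@le_trans _ _ (expR (b * q.1 + nu * q.2) * expR (- (x * phi q))))//.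
  by rewrite ler_wpM2r ?expR_ge0.
by rewrite -!expRD ler_expR; have := H q.1 q.2; rewrite /phi; lra.
Qed.

Lemma strip_ch nu : strip mu ch (fun u => (expR (nu * u))%:C) [set x | 0 < x].
Proof.
have ce : continuous (fun u => expR (nu * u)).
  move=> u; apply: continuous_comp; last exact: continuous_expR.
  exact: scaler_continuous.
split.
- by apply: ccont_meas; exact: ccont_real.
- by apply: continuous_measurable_fun; exact: continuous_ch.
- move=> x x0; exists (x / 2); first by rewrite divr_gt0.
  by split; rewrite /mkset; move: x0; rewrite /mkset; lra.
move=> x x0.
have nub : `|nu| < `|nu| + 1 by rewrite ltrDl.
have [C [d [d0 H]]] := phi_exponent_bound nub x0.
apply: (rintg_dom _ (rintgZ (expR C) (rintg_expR_norm d0))).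
  apply: measurable_funM.
    by apply: cmeas_cmod; apply: ccont_meas; exact: ccont_real.
  apply: continuous_measurable_fun => u; apply: continuous_comp; last exact: continuous_expR.
  by apply: cvgN; apply: cvgM; [exact: cvg_cst|exact: continuous_ch].
move=> u; rewrite ger0_norm ?mulr_ge0 ?cmod_ge0 ?expR_ge0//.
rewrite cmod_real ger0_norm ?expR_ge0// -!expRD ler_expR.
by have := H 0 u; rewrite mulr0 normr0 expR0 mul1r mulr0; lra.
Qed.

Lemma ccont_ch : ccont (fun u => (ch u)%:C).
Proof. by apply: ccont_real; exact: continuous_ch. Qed.

Lemma cftc (f f' : R[i] -> R[i]) : (forall x : R, cdiff f x%:C (f' x%:C)) ->
  ccont (fun x : R => f' x%:C) -> cintg mu (fun x : R => f' x%:C) ->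
  (forall e, 0 < e -> exists n0 : nat, forall n, (n0 <= n)%N ->
    cmod (f (n%:R)%:C) <= e /\ cmod (f (- n%:R)%:C) <= e) ->
  cint mu (fun x : R => f' x%:C) = 0.
Proof.
move=> df [c1 c2] [i1 i2] lim.
have dl x : is_derive x (1 : R) (fun x => Re (f x%:C)) (Re (f' x%:C)) /\
    is_derive x (1 : R) (fun x => Im (f x%:C)) (Im (f' x%:C)).
  have H := @cdiff_line R f 0 1 x (f' x%:C); rewrite mulr1 add0r in H.
  have [h1 h2] := H (df x); rewrite mulr1 in h1 h2.
  have E (s : R) : f (0 + s%:C * 1) = f s%:C by rewrite add0r mulr1.
  have E1 : (fun s : R => Re (f (0 + s%:C * 1))) = (fun s : R => Re (f s%:C)).
    by apply/funext => s; rewrite E.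
  have E2 : (fun s : R => Im (f (0 + s%:C * 1))) = (fun s : R => Im (f s%:C)).
    by apply/funext => s; rewrite E.
  by rewrite E1 in h1; rewrite E2 in h2.
apply: complex_ext; rewrite cintE.
  apply: (ftc_R (fun x => (dl x).1)) => // e e0.
  have [n0 H] := lim (e / 2) (divr_gt0 e0 (ltr0Sn _ 1)).
  exists n0 => n /H[h1 h2]; rewrite subr0 (le_trans (ler_normB _ _))// (splitr e).
  by rewrite lerD// (le_trans (Re_cmod _)).
apply: (ftc_R (fun x => (dl x).2)) => // e e0.
have [n0 H] := lim (e / 2) (divr_gt0 e0 (ltr0Sn _ 1)).
exists n0 => n /H[h1 h2]; rewrite subr0 (le_trans (ler_normB _ _))// (splitr e).
by rewrite lerD// (le_trans (Im_cmod _)).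
Qed.

(** The integrand of w^2 K'' + w K' - (w^2 + nu^2) K for K(w), the integral of exp (nu u - w cosh
    u), which is 2 K_nu(w). *)
Definition bessel_weight nu w u : R[i] :=
  (w ^+ 2 * ((ch u)%:C ^+ 2 - 1) - w * (ch u)%:C - nu%:C ^+ 2) *
  ((expR (nu * u))%:C * cex (- (w * (ch u)%:C))).

Lemma cintg_bessel_weight nu w : 0 < Re w -> cintg mu (bessel_weight nu w).
Proof.
move=> w0; have s0 := strip_ch nu; have s1 := strip_mul s0; have s2 := strip_mul s1.
have i0 := lap_cintg s0 w0; have i1 := lap_cintg s1 w0; have i2 := lap_cintg s2 w0.
have := cintgD (cintgD (cintgZ (w ^+ 2) i2) (cintgZ w i1)) (cintgZ (- (w ^+ 2 + nu%:C ^+ 2)) i0).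
by congr (cintg _ _); apply/funext => u; rewrite /bessel_weight; ring.
Qed.

Definition cch z := (cex z + cex (- z)) / 2%:R.
Definition csh z := (cex z - cex (- z)) / 2%:R.

Lemma cdiff_cexM p z : cdiff (fun z => cex (p * z)) z (cex (p * z) * p).
Proof.
have := @cdiff_comp _ (@cex R) (fun z => p * z) z _ _ (cdiff_cex (p * z)) (cdiffZ p (cdiff_id z)).
by rewrite mulr1.
Qed.

Lemma cdiff_cexN z : cdiff (fun z => cex (- z)) z (- cex (- z)).
Proof.
have := @cdiff_ext _ _ (fun z => cex (- z)) z _ 1 ltr01 _ (cdiff_cexM (-1) z).
by rewrite mulN1r mulrN1; apply => h _; rewrite mulN1r.
Qed.

Lemma cdiff_cch z : cdiff cch z (csh z).
Proof.
have := cdiffM (cdiffD (cdiff_cex z) (cdiff_cexN z)) (cdiff_cst (2%:R^-1) z).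
by rewrite mulr0 addr0.
Qed.

Lemma cdiff_csh z : cdiff csh z (cch z).
Proof.
have := cdiffM (cdiffB (cdiff_cex z) (cdiff_cexN z)) (cdiff_cst (2%:R^-1) z).
by rewrite mulr0 addr0 opprK.
Qed.

Lemma cch_real u : cch u%:C = (ch u)%:C.
Proof. by rewrite /cch /ch -rmorphN !cex_real rmorphM rmorphD fmorphV rmorph_nat. Qed.

Lemma csh_real u : csh u%:C = (sh u)%:C.
Proof. by rewrite /csh /sh -rmorphN !cex_real rmorphM rmorphB fmorphV rmorph_nat. Qed.

(* [bessel_weight] is the derivative of [- (nu + w sinh u) exp (nu u - w cosh u)]. *)
Lemma cint_bessel_weight nu w : 0 < Re w -> cint mu (bessel_weight nu w) = 0.
Proof.
move=> w0.
pose G z := (- nu%:C - w * csh z) * (cex (nu%:C * z) * cex (- w * cch z)).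
pose G' z := (w ^+ 2 * (cch z ^+ 2 - 1) - w * cch z - nu%:C ^+ 2) *
  (cex (nu%:C * z) * cex (- w * cch z)).
have csq z : csh z ^+ 2 = cch z ^+ 2 - 1.
  have h : cex z * cex (- z) = 1 by rewrite cexN mulfV ?cex_neq0.
  by rewrite /csh /cch; field: h.
have dG z : cdiff G z (G' z).
  have d1 := cdiffB (cdiff_cst (- nu%:C) z) (cdiffZ w (cdiff_csh z)).
  have d2 := @cdiff_comp _ (@cex R) (fun z => - w * cch z) z _ _ (cdiff_cex (- w * cch z)) (cdiffZ (- w) (cdiff_cch z)).
  have := cdiffM d1 (cdiffM (cdiff_cexM nu%:C z) d2).
  by congr cdiff; rewrite /G' -csq; ring.
have E u : bessel_weight nu w u = G' u%:C.
  by rewrite /bessel_weight /G' cch_real -rmorphM cex_real mulNr.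
rewrite (eq_cint mu E).
(* Half of the decay Re w cosh u pays for the factor w sinh u; the other half, at v = 0, gives the
   exponential decay in u. *)
have [C [d [d0 H]]] := phi_exponent_bound (b := `|nu| + 1) (ltac:(by rewrite ltrDl) : `|nu| < `|nu| + 1) (ltac:(by rewrite divr_gt0) : 0 < Re w / 2).
have bnd u : cmod (G u%:C) <= (`|nu| + 2 * cmod w / Re w) * expR C * expR (- (d * `|u|)).
  rewrite /G cch_real csh_real -rmorphM cex_real cmodM cmodM cmod_real ger0_norm ?expR_ge0// cmod_cex.
  have -> : Re (- w * (ch u)%:C) = - (Re w * ch u) by rewrite !ReImE; ring.
  have h1 : cmod (- nu%:C - w * (sh u)%:C) <= `|nu| + cmod w * ch u.
    rewrite (le_trans (cmodB _ _))// cmodN cmod_real lerD2l cmodM cmod_real ler_wpM2l ?cmod_ge0//.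
    exact: sh_le_ch.
  rewrite (le_trans (ler_wpM2r (mulr_ge0 (expR_ge0 _) (expR_ge0 _)) h1))//.
  have h2 : `|nu| + cmod w * ch u <= (`|nu| + 2 * cmod w / Re w) * expR (Re w / 2 * ch u).
    rewrite mulrDl lerD//.
      rewrite ler_peMr// -[leLHS]expR0 ler_expR mulr_ge0 ?(ltW (ch_gt0 _))//.
      by rewrite divr_ge0// ltW.
    have := expR_ge1Dx (Re w / 2 * ch u) => h.
    have -> : cmod w * ch u = 2 * cmod w / Re w * (Re w / 2 * ch u).
      by field; rewrite gt_eqF.
    rewrite ler_wpM2l ?divr_ge0 ?mulr_ge0 ?cmod_ge0 ?(ltW w0)//; lra.
  rewrite (le_trans (ler_wpM2r (mulr_ge0 (expR_ge0 _) (expR_ge0 _)) h2))//.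
  rewrite -[leLHS]mulrA -[leRHS]mulrA ler_wpM2l//.
    by rewrite addr_ge0 ?divr_ge0 ?mulr_ge0 ?cmod_ge0 ?(ltW w0).
  rewrite -!expRD ler_expR.
  by have := H 0 u; rewrite mulr0 normr0 expR0 mul1r mulr0; lra.
apply: (@cftc G G').
- by move=> x; exact: dG.
- have -> : (fun x : R => G' x%:C) = (fun u => (w ^+ 2 * ((ch u)%:C ^+ 2 - 1) - w * (ch u)%:C - nu%:C ^+ 2) *
  (cex (nu%:C * u%:C) * cex (- w * (ch u)%:C))) by apply/funext => u; rewrite /G' cch_real.
  have cc := ccont_ch.
  apply: ccontM.
    apply: ccontD; last exact: ccont_cst.
    apply: ccontD; last by apply/ccontN/ccontM; [exact: ccont_cst|].
    apply: ccontM; first exact: ccont_cst.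
    apply: ccontD; last exact: ccont_cst.
    exact: (ccontM cc cc).
  apply: ccontM; apply/ccont_cex/ccontM; rewrite ?mulNr//; try exact: ccont_cst.
  exact: ccont_id.
- have -> : (fun x : R => G' x%:C) = bessel_weight nu w by apply/funext => u; rewrite E.
  exact: cintg_bessel_weight.
move=> e e0; set K := (_ + _) * expR C in bnd.
have sqrt_2pi : 0 < `|K| + 1 by rewrite ltr_wpDl.
have [n0 Hn] := expRNn_small d0 (divr_gt0 e0 sqrt_2pi).
exists n0 => n /Hn; rewrite ler_pdivlMr// mulrC => h.
have h' : K * expR (- (d * n%:R)) <= e.
  apply: le_trans h; rewrite ler_wpM2r ?expR_ge0// (le_trans (ler_norm _))// lerDl//.
by split; rewrite (le_trans (bnd _))// ?normrN ger0_norm ?ler0n.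
Qed.

End Hyperbolic.

(** * The plane integrals F and H: differential equation, homogeneity, value at 1 *)

Section LommelIntegral.
Variable R : realType.
Local Notation mu := (@lebesgue_measure R).
Local Notation cmeasR := (@cmeas _ (measurableTypeR R) R).
Local Notation cmeasRR := (@cmeas _ (measurableTypeR R * measurableTypeR R)%type R).
Implicit Types (x y t a b c e u v nu : R) (z w p s : R[i]).

Definition damp v : R := (1 + expR v ^+ 2)^-1.

Lemma damp_ge0 v : 0 <= damp v.
Proof. by rewrite invr_ge0 addr_ge0// sqr_ge0. Qed.

Lemma damp_le1 v : damp v <= 1.
Proof. by rewrite invf_le1 ?lerDl ?sqr_ge0// ltr_pwDl// sqr_ge0. Qed.

Lemma continuous_damp : continuous damp.
Proof.
move=> v; apply: cvgV; first by rewrite gt_eqF// ltr_pwDl// sqr_ge0.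
apply: cvgD; first exact: cvg_cst.
by rewrite expr2; apply: cvgM; exact: continuous_expR.
Qed.

(* Always used with [p = 1 - mu + 2 N]; integrating [weightH] and [weightF] against
   [exp (- z phi)] gives both sides of the Lommel equation. *)
Definition weightH p nu (q : R * R) : R[i] := cex (p * q.1%:C) * (expR (nu * q.2))%:C.
Definition weightF p nu (q : R * R) : R[i] :=
  cex (p * q.1%:C) * (damp q.1)%:C * (expR (nu * q.2))%:C.

Lemma ccont_cexM p : ccont (fun v : R => cex (p * v%:C)).
Proof. by apply: ccont_cex; apply: ccontM; [exact: ccont_cst|exact: ccont_id]. Qed.

Lemma ccont_expRM nu : ccont (fun u => (expR (nu * u))%:C).
Proof.
apply: ccont_real => u; apply: continuous_comp; last exact: continuous_expR.
exact: scaler_continuous.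
Qed.

Lemma strip_weightH p nu : `|nu| < Re p -> strip (mu \x mu)%E (@phi R) (weightH p nu) [set x | 0 < x].
Proof.
move=> nup; apply: (strip_phi _ nup).
  apply: cmeasM.
    by apply: (cmeas_fst (f := fun v => cex (p * v%:C))); apply/ccont_meas/ccont_cexM.
  by apply: (cmeas_snd (f := fun u => (expR (nu * u))%:C)); apply/ccont_meas/ccont_expRM.
by move=> q; rewrite cmodM cmod_cex cmod_real ger0_norm ?expR_ge0// -expRD ler_expR !ReImE; lra.
Qed.

Lemma strip_weightF p nu : `|nu| < Re p -> strip (mu \x mu)%E (@phi R) (weightF p nu) [set x | 0 < x].
Proof.
move=> nup; apply: (strip_phi _ nup).
  apply: cmeasM; last first.
    by apply: (cmeas_snd (f := fun u => (expR (nu * u))%:C)); apply/ccont_meas/ccont_expRM.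
  apply: cmeasM.
    by apply: (cmeas_fst (f := fun v => cex (p * v%:C))); apply/ccont_meas/ccont_cexM.
  apply: (cmeas_fst (f := fun v => (damp v)%:C)); apply/ccont_meas/ccont_real.
  exact: continuous_damp.
move=> q; rewrite (cmodM (_ * _)) (cmodM (cex _)) cmod_cex !cmod_real.
rewrite !ger0_norm ?expR_ge0 ?damp_ge0//.
have h : expR (Re (p * q.1%:C)) * damp q.1 <= expR (Re (p * q.1%:C)).
  by rewrite ler_piMr ?expR_ge0 ?damp_le1.
rewrite (le_trans (ler_wpM2r (expR_ge0 _) h))// -expRD ler_expR !ReImE; lra.
Qed.

Definition lomH p nu := lap (mu \x mu)%E (@phi R) (weightH p nu).
Definition lomF p nu := lap (mu \x mu)%E (@phi R) (weightF p nu).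
Definition lomF1 p nu :=
  lap (mu \x mu)%E (@phi R) (fun q => - (phi q)%:C * weightF p nu q).
Definition lomF2 p nu :=
  lap (mu \x mu)%E (@phi R) (fun q => - (phi q)%:C * (- (phi q)%:C * weightF p nu q)).

Lemma lomF_cdiff p nu z : `|nu| < Re p -> 0 < Re z -> cdiff (lomF p nu) z (lomF1 p nu z).
Proof. by move=> nup z0; exact: (lap_cdiff (strip_weightF nup) z0). Qed.

Lemma lomF1_cdiff p nu z : `|nu| < Re p -> 0 < Re z -> cdiff (lomF1 p nu) z (lomF2 p nu z).
Proof. by move=> nup z0; exact: (lap_cdiff (strip_mul (strip_weightF nup)) z0). Qed.

(** Put w = z exp v. On the integrand of F the operator gives w^2 cosh^2 u - w cosh u + z^2 - nu^2.
    Over the same denominator the right side contributes z^2 (1 + exp (2 v)) = z^2 + w^2. The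
    difference is [bessel_weight] at w, whose integral over u vanishes for every v. *)
Lemma lomF_ode p nu z : `|nu| < Re p -> 0 < Re z ->
  z ^+ 2 * lomF2 p nu z + z * lomF1 p nu z + (z ^+ 2 - nu%:C ^+ 2) * lomF p nu z =
  z ^+ 2 * lomH p nu z.
Proof.
move=> nup z0.
have sF := strip_weightF nup; have sF1 := strip_mul sF; have sF2 := strip_mul sF1.
have iF := lap_cintg sF z0; have iF1 := lap_cintg sF1 z0; have iF2 := lap_cintg sF2 z0.
have iH := lap_cintg (strip_weightH nup) z0.
apply/eqP; rewrite -subr_eq0; apply/eqP.
rewrite /lomF2 /lomF1 /lomF /lomH /lap.
rewrite -(cintZ _ iF) -(cintZ _ iF1) -(cintZ _ iF2) -(cintZ _ iH).
have j1 := cintgD (cintgZ (z ^+ 2) iF2) (cintgZ z iF1).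
have j2 := cintgD j1 (cintgZ (z ^+ 2 - nu%:C ^+ 2) iF).
have j3 := cintgB j2 (cintgZ (z ^+ 2) iH).
rewrite -(cintD (cintgZ (z ^+ 2) iF2) (cintgZ z iF1)).
rewrite -(cintD j1 (cintgZ (z ^+ 2 - nu%:C ^+ 2) iF)).
rewrite -(cintB j2 (cintgZ (z ^+ 2) iH)).
pose k q := cex (p * q.1%:C) * (damp q.1)%:C * bessel_weight nu (z * (expR q.1)%:C) q.2.
have kE : k = (fun q => z ^+ 2 * (- (phi q)%:C * (- (phi q)%:C * weightF p nu q) * cex (- (z * (phi q)%:C))) +
    z * (- (phi q)%:C * weightF p nu q * cex (- (z * (phi q)%:C))) +
    (z ^+ 2 - nu%:C ^+ 2) * (weightF p nu q * cex (- (z * (phi q)%:C))) -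
    z ^+ 2 * (weightH p nu q * cex (- (z * (phi q)%:C)))).
  apply/funext => -[v u]; rewrite /k /bessel_weight /weightF /weightH /phi [fst _]/= [snd _]/=.
  have h0 : z * (expR v)%:C * (ch u)%:C = z * (expR v * ch u)%:C.
    by rewrite [(expR v * ch u)%:C]rmorphM mulrA.
  rewrite [X in cex (- X)]h0; clear h0.
  have d1 : (1 + (expR v)%:C ^+ 2) * (damp v)%:C = 1.
    by rewrite -rmorphXn -(rmorph1 (real_complex R)) -rmorphD -rmorphM divff// gt_eqF// ltr_pwDl// sqr_ge0.
  move: (cex (- _)) => E; rewrite [(expR v * ch u)%:C]rmorphM.
  have d2 : cex (p * v%:C) * (expR (nu * u))%:C * E =
     cex (p * v%:C) * (expR (nu * u))%:C * E * ((1 + (expR v)%:C ^+ 2) * (damp v)%:C).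
    by rewrite d1 mulr1.
  rewrite [X in _ = _ - _ * X]d2; ring.
rewrite -kE in j3 *.
have w0 v : 0 < Re (z * (expR v)%:C) by rewrite Re_mul Re_real Im_real mulr0 subr0 mulr_gt0 ?expR_gt0.
have s1 v : cintg mu (fun u => k (v, u)).
  by rewrite /k /=; apply: cintgZ; apply: cintg_bessel_weight.
rewrite (cFubini12 j3 s1).
have Z v : cint mu (fun u => k (v, u)) = 0.
  have := cintZ (cex (p * v%:C) * (damp v)%:C) (cintg_bessel_weight nu (w0 v)).
  by rewrite (cint_bessel_weight nu (w0 v)) mulr0.
transitivity (cint mu (fun=> 0 : R[i])); first by apply: eq_cint => v; exact: Z.
by apply: complex_ext; rewrite cintE /Rintegral integral0.
Qed.

Lemma lomH_slice p nu z u : 0 < Re p -> 0 < Re z ->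
  cintg mu (fun v => weightH p nu (v, u) * cex (- (z * (phi (v, u))%:C))) /\
  cint mu (fun v => weightH p nu (v, u) * cex (- (z * (phi (v, u))%:C))) =
    (expR (nu * u))%:C * gexp p ((ch u)%:C * z).
Proof.
move=> p0 z0.
have w0 : 0 < Re ((ch u)%:C * z) by rewrite Re_mul Re_real Im_real mul0r subr0 mulr_gt0 ?ch_gt0.
have E : (fun v => weightH p nu (v, u) * cex (- (z * (phi (v, u))%:C))) =
    (fun v => (expR (nu * u))%:C * (cex (p * v%:C) * cex (- ((ch u)%:C * z * (expR v)%:C)))).
  apply/funext => v; rewrite /weightH /phi [fst _]/= [snd _]/=.
  have -> : z * (expR v * ch u)%:C = (ch u)%:C * z * (expR v)%:C by rewrite rmorphM; ring.
  ring.
rewrite E; split; first exact: (cintgZ _ (lap_cintg (strip_gamma p0) w0)).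
by rewrite (cintZ _ (lap_cintg (strip_gamma p0) w0)).
Qed.

Lemma lomH_slice2 p nu z v : 0 < Re z ->
  cintg mu (fun u => weightH p nu (v, u) * cex (- (z * (phi (v, u))%:C))).
Proof.
move=> z0.
have w0 : 0 < Re (z * (expR v)%:C) by rewrite Re_mul Re_real Im_real mulr0 subr0 mulr_gt0 ?expR_gt0.
have E (u : R) : weightH p nu (v, u) * cex (- (z * (phi (v, u))%:C)) =
    cex (p * v%:C) * ((expR (nu * u))%:C * cex (- (z * (expR v)%:C * (ch u)%:C))).
  by rewrite /weightH /phi [fst _]/= [snd _]/= -mulrA [(expR v * ch u)%:C]rmorphM (mulrA z).
have := cintgZ (cex (p * v%:C)) (lap_cintg (strip_ch nu) w0).
by congr (cintg _ _); apply/funext => u; rewrite E.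
Qed.

(** The power cosh^(- p) decays like exp (- Re p |u|), which outweighs exp (nu u). *)
Lemma cintg_ch_gexp p nu : `|nu| < Re p ->
  cintg mu (fun u => (expR (nu * u))%:C * gexp p (ch u)%:C).
Proof.
move=> nup; have p0 : 0 < Re p by rewrite (le_lt_trans _ nup).
have c0 u : 0 < Re ((ch u)%:C) by rewrite Re_real ch_gt0.
apply: cintg_edom.
  apply: ccont_meas; apply: ccontM; first exact: ccont_expRM.
  apply: (@ccont_cdiff _ (gexp p) (fun u => (ch u)%:C)); last exact: ccont_ch.
  by move=> u; eexists; apply: gexp_cdiff.
exists (cmod (gexp p 1) * expR (Re p * ln 2)), (Re p - `|nu|); split; first by rewrite subr_gt0.
move=> u; rewrite (gexpE p0 (c0 u)) cmodM cmod_real ger0_norm ?expR_ge0// cmodM mulrCA.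
rewrite -[leRHS]mulrA ler_wpM2l ?cmod_ge0// cpowE cmod_cex clog_real ?ch_gt0//.
rewrite -!expRD ler_expR Re_mul Re_real Im_real mulr0 subr0 ReN.
have h1 : nu * u <= `|nu| * `|u| by rewrite -normrM ler_norm.
have h2 : `|u| - ln 2 <= ln (ch u).
  have cp := ch_gt0 u; have cp2 : 0 < 2 * ch u by apply: mulr_gt0.
  rewrite lerBlDr addrC -lnM ?posrE// -ler_expR lnK ?posrE//.
  exact: expR_norm_ch.
have h3 : Re p * (`|u| - ln 2) <= Re p * ln (ch u) by rewrite ler_wpM2l ?(ltW p0).
lra.
Qed.

(** Integrating over v first leaves [gexp] at cosh u times z, where z enters only through the factor
    z^(- p). *)
Lemma lomHE p nu z : `|nu| < Re p -> 0 < Re z -> lomH p nu z = lomH p nu 1 * cpow z (- p).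
Proof.
move=> nup z0; have p0 : 0 < Re p by rewrite (le_lt_trans _ nup).
have key w : 0 < Re w ->
   lomH p nu w = cint mu (fun u => (expR (nu * u))%:C * gexp p ((ch u)%:C * w)).
  move=> w0; have iH := lap_cintg (strip_weightH nup) w0.
  have sl u := (lomH_slice nu u p0 w0).1.
  rewrite /lomH /lap (cFubini21 iH sl); apply: eq_cint => u.
  exact: (lomH_slice nu u p0 w0).2.
have r1 : 0 < Re (1 : R[i]) by rewrite Re1.
rewrite (key z z0) (key 1 r1) mulrC.
have -> : (fun u => (expR (nu * u))%:C * gexp p ((ch u)%:C * 1)) =
    (fun u => (expR (nu * u))%:C * gexp p (ch u)%:C) by apply/funext => u; rewrite mulr1.
rewrite -(cintZ _ (cintg_ch_gexp nup)); apply: eq_cint => u.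
have c0 : 0 < Re ((ch u)%:C) by rewrite Re_real ch_gt0.
have w0 : 0 < Re ((ch u)%:C * z) by rewrite Re_mul Re_real Im_real mul0r subr0 mulr_gt0 ?ch_gt0.
rewrite (gexpE p0 w0) (gexpE p0 c0) cpow_realM ?ch_gt0//; ring.
Qed.

(* Substitute [v1 = 2 y - v2], then [v2 = y + u]. *)
Lemma gexp_product p nu : `|nu| < Re p ->
  gexp ((p - nu%:C) / 2%:R) 1 * gexp ((p + nu%:C) / 2%:R) 1 = 2%:R * lomH p nu 2%:R.
Proof.
move=> nup; set a := (_ - _) / _; set b := (_ + _) / _.
have half : (2^-1 : R)%:C = 2%:R^-1 by rewrite fmorphV rmorph_nat.
have [a0 b0] : 0 < Re a /\ 0 < Re b.
  have := ler_norm nu; have := ler_norm (- nu); rewrite normrN => h1 h2.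
  by rewrite /a /b -half !ReImE !mulr0 !subr0 !mulr_gt0 ?invr_gt0//; lra.
have r1 : 0 < Re (1 : R[i]) by rewrite Re1.
pose fa v := cex (a * v%:C) * cex (- (1 * (expR v)%:C)).
pose fb v := cex (b * v%:C) * cex (- (1 * (expR v)%:C)).
have ia : cintg mu fa := lap_cintg (strip_gamma a0) r1.
have ib : cintg mu fb := lap_cintg (strip_gamma b0) r1.
have ca : ccont fa := @ccont_gexp R a 1.
have cb : ccont fb := @ccont_gexp R b 1.
pose k (q : R * R) := fa (2 * q.1 - q.2) * fb q.2 * 2%:C.
have edg s w : 0 < Re s -> 0 < Re w -> exp_dominated (fun v => cex (s * v%:C) * cex (- (w * (expR v)%:C))).
  move=> s0 w0; apply: (@edom_gamma _ (Re s) 1 (Re w)) => // v.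
  by rewrite cmodM !cmod_cex mul1r -expRD ler_expR !ReImE; lra.
have [Ca [da [da0 Ha]]] : exp_dominated fa := edg a 1 a0 r1.
have [Cb [db [db0 Hb]]] : exp_dominated fb := edg b 1 b0 r1.
have ek : exp_dominated2 k.
  pose d := Num.min da db; have d0 : 0 < d by rewrite lt_min da0.
  have dda : d <= da by rewrite ge_min lexx.
  have ddb : d <= db by rewrite ge_min lexx orbT.
  have Ha' := edom_weaken dda Ha; have Hb' := edom_weaken ddb Hb.
  exists (`|Ca| * `|Cb| * 2), (d / 2); split; first by rewrite divr_gt0.
  move=> [y v]; rewrite /k [fst _]/= [snd _]/= (cmodM (_ * _)) (cmodM (fa _)) cmod_real (ger0_norm (ler0n _ 2)).
  have := ler_pM (cmod_ge0 _) (cmod_ge0 _) (Ha' (2 * y - v)) (Hb' v).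
  rewrite mulrACA => h.
  have h1 : expR (- (d * `|2 * y - v|)) * expR (- (d * `|v|)) <= expR (- (d / 2 * `|y|)) * expR (- (d / 2 * `|v|)).
    rewrite -!expRD ler_expR.
    have h2 := ler_normD (2 * y - v) v; rewrite subrK normrM (ger0_norm (ler0n _ 2)) in h2.
    have := normr_ge0 v; have := normr_ge0 (2 * y - v); have := normr_ge0 y => n1 n2 n3.
    have : d * ((`|y| + `|v|) / 2) <= d * (`|2 * y - v| + `|v|).
      rewrite ler_wpM2l ?(ltW d0)//; lra.
    lra.
  have C0 : 0 <= `|Ca| * `|Cb| by rewrite mulr_ge0.
  have := le_trans h (ler_wpM2l C0 h1) => h3.
  by rewrite [leRHS]mulrAC ler_wpM2r.
have caff (f : R -> R[i]) (c e : R) : ccont f -> ccont (fun v => f (c * v + e)).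
  move=> [c1 c2]; have cc : continuous (fun v : R => c * v + e).
    move=> v; apply: cvgD; last exact: cvg_cst.
    by apply: cvgM; [exact: cvg_cst|exact: cvg_id].
  by split=> v; [exact: (continuous_comp (cc v) (c1 _))|exact: (continuous_comp (cc v) (c2 _))].
have s1 y : ccont (fun v => k (y, v)).
  apply: (@ccontM _ (fun v => fa (2 * y - v) * fb v) (fun=> 2%:C)); last exact: ccont_cst.
  apply: ccontM => //.
  have := caff fa (-1) (2 * y) ca; congr (ccont _).
  by apply/funext => v; rewrite mulN1r addrC.
have s2 v : ccont (fun y => k (y, v)).
  apply: (@ccontM _ (fun y => fa (2 * y - v) * fb v) (fun=> 2%:C)); last exact: ccont_cst.
  apply: ccontM; last exact: ccont_cst.
  exact: (caff fa 2 (- v) ca).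
have mk : cmeasRR k.
  apply: cmeasM; last exact: cmeas_cst.
  apply: cmeasM; last by apply: (cmeas_snd (f := fb)); exact: ccont_meas.
  have ml : cmeasRR (fun q => (2 * q.1 - q.2)%:C).
    have -> : (fun q : R * R => (2 * q.1 - q.2)%:C) = (fun q => 2%:C * q.1%:C + - q.2%:C).
      by apply/funext => q; rewrite rmorphB rmorphM.
    apply: cmeasD.
      apply: cmeasM; first exact: cmeas_cst.
      by apply: (cmeas_fst (f := fun v => v%:C)); apply: ccont_meas; exact: ccont_id.
    apply: cmeasN.
    by apply: (cmeas_snd (f := fun v => v%:C)); apply: ccont_meas; exact: ccont_id.
  apply: cmeasM; apply: cmeas_cex.
    by apply: cmeasM => //; exact: cmeas_cst.
  apply: cmeasN; apply: cmeasM; first exact: cmeas_cst.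
  have -> : (fun q : R * R => (expR (2 * q.1 - q.2))%:C) = (fun q => cex (2 * q.1 - q.2)%:C).
    by apply/funext => q; rewrite cex_real.
  exact: cmeas_cex.
have ik := cintg_edom2 mk ek.
have i1 y : cintg mu (fun v => k (y, v)).
  by apply: cintg_edom; [exact: ccont_meas|exact: edom2_slice1].
have i2 v : cintg mu (fun y => k (y, v)).
  by apply: cintg_edom; [exact: ccont_meas|exact: edom2_slice2].
transitivity (cint (mu \x mu)%E k).
  rewrite (cFubini21 ik i2) /gexp /lap -/fa -/fb -(cintZ _ ib); apply: eq_cint => v.
  rewrite -/(fb v) mulrC (@cint_affine _ fa 2 (- v))// -cintZ; last first.
    apply: cintg_edom; first by apply: ccont_meas; apply: ccontM; [exact: caff|exact: ccont_cst].
    exists (Ca * 2 * expR (da * `|v|)), da; split => // y.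
    rewrite (cmodM (fa _)) cmod_real (ger0_norm (ler0n _ 2)).
    rewrite (le_trans (ler_wpM2r (ler0n _ 2) (Ha _)))//.
    have Ca0 : 0 <= Ca.
      by have := le_trans (cmod_ge0 _) (Ha 0); rewrite pmulr_lge0 ?expR_gt0.
    rewrite mulrAC -[leRHS]mulrA ler_wpM2l ?mulr_ge0// -expRD ler_expR.
    have h2 := ler_normD (2 * y - v) v; rewrite subrK normrM (ger0_norm (ler0n _ 2)) in h2.
    have n1 := normr_ge0 y.
    have : da * `|y| <= da * (`|2 * y - v| + `|v|) by rewrite ler_wpM2l ?(ltW da0)//; lra.
    by lra.
  by apply: eq_cint => y; rewrite /k /=; ring.
have r2 : 0 < Re (2%:R : R[i]) by rewrite Re_nat ltr0n.
have iH := lap_cintg (strip_weightH nup) r2.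
have sl v := lomH_slice2 p nu v r2.
rewrite (cFubini12 ik i1) /lomH /lap -(cintZ _ iH) (cFubini12 (cintgZ _ iH) (fun v => cintgZ _ (sl v))).
(* Here a (y - u) + b (y + u) = p y + nu u and exp (y - u) + exp (y + u) = 2 exp y cosh u, while the
   factor 2 in [k] is the Jacobian of v1 = 2 y - v2. *)
have P (y u : R) : k (y, u + y) = 2%:R * (weightH p nu (y, u) * cex (- (2%:R * (phi (y, u))%:C))).
  have -> : 2%:R * (weightH p nu (y, u) * cex (- (2%:R * (phi (y, u))%:C))) =
     weightH p nu (y, u) * cex (- (2%:R * (phi (y, u))%:C)) * 2%:C.
    by rewrite (rmorph_nat (real_complex R)); ring.
  rewrite /k /fa /fb /weightH /phi; rewrite ![fst _]/= ![snd _]/=; congr (_ * _).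
  rewrite -(cex_real (nu * u)) -!cexD; congr cex.
  have -> : (expR y * ch u)%:C = ((expR (2 * y - (u + y)))%:C + (expR (u + y))%:C) / 2%:R.
    have -> : 2 * y - (u + y) = y + - u by ring.
    rewrite [u + y]addrC !expRD /ch !rmorphM !rmorphD fmorphV rmorph_nat; ring.
  have -> : 2 * y - (u + y) = y - u by ring.
  rewrite /a /b rmorphB rmorphM rmorphD.
  by field.
apply: eq_cint => y; rewrite (@cint_shift _ (fun v => k (y, v)) y)//.
by apply: eq_cint => u; exact: P.
Qed.

Lemma gexp_product1 p nu : `|nu| < Re p ->
  gexp ((p - nu%:C) / 2%:R) 1 * gexp ((p + nu%:C) / 2%:R) 1 = cpow 2%:R (1 - p) * lomH p nu 1.
Proof.
move=> nup; have r2 : 0 < Re (2%:R : R[i]) by rewrite Re_nat ltr0n.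
by rewrite gexp_product// lomHE// cpowD cpow1//; ring.
Qed.

(* On the positive real axis the substitution [v -> v - ln x] brings the integral
   into the form of the terminant representation. *)
Lemma lap_phi_real p h x : 0 < x -> strip mu (@ch R) h [set x | 0 < x] ->
  cintg (mu \x mu)%E (fun q => cex (p * q.1%:C) * (damp q.1)%:C * h q.2 * cex (- (x%:C * (phi q)%:C))) ->
  cint (mu \x mu)%E (fun q => cex (p * q.1%:C) * (damp q.1)%:C * h q.2 * cex (- (x%:C * (phi q)%:C))) =
  cpow x%:C (- p) * cint mu (fun v => cex (p * v%:C) * ((1 + expR v ^+ 2 / x ^+ 2)^-1)%:C *
     lap mu (@ch R) h (expR v)%:C).
Proof.
move=> x0 sh ci.
have w0 v : 0 < Re (x * expR v)%:C by rewrite Re_real mulr_gt0 ?expR_gt0.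
pose G v := cex (p * v%:C) * (damp v)%:C * lap mu (@ch R) h (x * expR v)%:C.
have E v (u : R) : cex (p * v%:C) * (damp v)%:C * h u * cex (- (x%:C * (phi (v, u))%:C)) =
    cex (p * v%:C) * (damp v)%:C * (h u * cex (- ((x * expR v)%:C * (ch u)%:C))).
  by rewrite /phi [fst _]/= [snd _]/= -(mulrA _ (h u)) -!rmorphM (mulrA x).
have s1 v : cintg mu (fun u => cex (p * v%:C) * (damp v)%:C * h u * cex (- (x%:C * (phi (v, u))%:C))).
  have := cintgZ (cex (p * v%:C) * (damp v)%:C) (lap_cintg sh (w0 v)).
  by congr (cintg _ _); apply/funext => u; rewrite E.
have GE v : cint mu (fun u => cex (p * v%:C) * (damp v)%:C * h u * cex (- (x%:C * (phi (v, u))%:C))) = G v.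
  by rewrite (eq_cint mu (E v)) (cintZ _ (lap_cintg sh (w0 v))).
have ciG : cintg mu G.
  by have := cintg_Fubini ci s1; congr (cintg _ _); apply/funext => v; exact: GE.
have cG : ccont G.
  apply: ccontM.
    by apply: ccontM; [exact: ccont_cexM|apply: ccont_real; exact: continuous_damp].
  apply: (@ccont_cdiff _ (lap mu (@ch R) h) (fun v => (x * expR v)%:C)).
    by move=> v; eexists; apply: (lap_cdiff sh (w0 v)).
  apply: ccont_real => v; apply: cvgM; first exact: cvg_cst.
  exact: continuous_expR.
have cp0 := cpow_neq0 x%:C p.
rewrite (cFubini12 ci s1).
transitivity (cint mu G); first by apply: eq_cint => v; exact: GE.
have -> : cint mu G = cpow x%:C (- p) * cint mu (fun v => cpow x%:C p * G v).
  by rewrite (cintZ _ ciG) mulrA -cpowD addNr cpow0 mul1r.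
rewrite (cint_shift (- ln x)); last by apply: ccontM; first exact: ccont_cst.
congr (_ * _); apply: eq_cint => v.
have e1 : expR (v + - ln x) = expR v / x by rewrite expRD expRN lnK ?posrE.
rewrite /G /damp e1.
have -> : x * (expR v / x) = expR v by field; rewrite gt_eqF.
have -> : cex (p * (v + - ln x)%:C) = cex (p * v%:C) / cex (p * (ln x)%:C).
  by rewrite rmorphB mulrBr cexD cexN.
have := cex_neq0 (p * (ln x)%:C); rewrite expr_div_n cpowE clog_real//.
have gen (A B C D : R[i]) : A != 0 -> A * (B / A * C * D) = B * C * D by move=> A0; field.
exact: gen.
Qed.

End LommelIntegral.

(** * From the topological derivative on R[i] to [cdiff] *)

Section Bridge.
Variable R : realType.
Implicit Types (x y t a b c e u v nu : R) (z w p s : R[i]).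

Lemma normrC z : `|z : R[i]^o| = (cmod z)%:C.
Proof. by case: z => a b; rewrite normc_def. Qed.

Lemma near_cmod (P : R[i] -> Prop) (z : R[i]) :
  (\forall w \near nbhs (z : R[i]^o), P w) <->
  exists2 d : R, 0 < d & forall w, cmod (w - z) < d -> P w.
Proof.
split.
  move=> /nbhs_ballP[r /= r0 H].
  (* Positivity in R[i] forces a zero imaginary part, so the radius is a real number. *)
  have rr : r = (Re r)%:C by case: r r0 {H} => a b; rewrite ltcE /= => /andP[/eqP -> _].
  exists (Re r); first by move: r0; rewrite rr ltcR.
  move=> w wd; apply: H; rewrite -ball_normE /ball_ /= distrC normrC rr ltcR.
  by [].
move=> [d d0 H]; apply/nbhs_ballP; exists d%:C; first by rewrite /= ltcR.
by move=> w; rewrite -ball_normE /ball_ /= distrC normrC ltcR => /H.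
Qed.

Lemma cdiff_cderiv (f : R[i] -> R[i]) z : cderivable f z -> cdiff f z (cderiv f z).
Proof.
move=> df; have : (fun h : R[i]^o => h^-1 *: ((f : R[i]^o -> R[i]^o) (h *: (1 : R[i]^o) + z) - f z)) @ (0 : R[i]^o)^' --> (cderiv f z : R[i]^o) by exact: df.
move=> /cvgrPdist_le H e e0.
have /H : (0 : R[i]) < e%:C by rewrite ltcR.
move=> /(near_cmod (fun t : R[i] => t != 0 -> _) 0).1 [d d0 Hd].
exists d => // h hd; have [->|h0] := eqVneq h 0.
  by rewrite addr0 subrr mulr0 subr0 cmod0 mulr0.
have := Hd h; rewrite subr0 => /(_ hd h0).
rewrite normrC lecR => Hh.
have -> : f (z + h) - f z - cderiv f z * h = - (h * (cderiv f z - h^-1 * (f (h * 1 + z) - f z))).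
  by rewrite mulr1 [h + z]addrC; field.
by rewrite cmodN cmodM mulrC ler_wpM2r ?cmod_ge0.
Qed.

End Bridge.
(** One step of the sum in [lomW_ode], with x for z^e: the operator multiplies z^e by z^2 - nu^2 +
    e^2. Stated over a field so that powers are opaque variables. *)
Lemma telescoping_algebra (K : fieldType) (z y s1 s2 s3 c e x : K) : z != 0 ->
  z ^+ 2 * s1 + z ^+ 2 * (c * (e * ((e - 1) * (x / z / z)))) +
  (z * s2 + z * (c * (e * (x / z)))) + ((z ^+ 2 - y) * s3 + (z ^+ 2 - y) * (c * x)) =
  z ^+ 2 * s1 + z * s2 + (z ^+ 2 - y) * s3 + c * ((z ^+ 2 - y + e ^+ 2) * x).
Proof. by move=> z0; field. Qed.

(** * The Lommel function as partial sum plus a multiple of F *)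

Section LommelRepresentation.
Variable R : realType.
Local Notation leb := (@lebesgue_measure R).
Implicit Types (x y t a b c e u v nu : R) (z w p q s mu : R[i]).

Definition polyb x (f : R[i] -> R[i]) := exists (K : R) n,
  forall t : R, cmod (f (x +i* t)) <= K * (1 + `|t|) ^+ n.

Lemma polybD x f g : polyb x f -> polyb x g -> polyb x (fun z => f z + g z).
Proof.
move=> [K [n Hf]] [L [m Hg]]; exists (`|K| + `|L|), (n + m)%N => t.
have t1 : 1 <= 1 + `|t| by rewrite lerDl.
have t0 : 0 <= 1 + `|t| by rewrite (le_trans ler01).
rewrite (le_trans (cmodD _ _))// mulrDl lerD//.
  rewrite (le_trans (Hf t))// (le_trans (ler_wpM2r (exprn_ge0 _ t0) (ler_norm K)))//.
  by rewrite ler_wpM2l// ler_weXn2l// leq_addr.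
rewrite (le_trans (Hg t))// (le_trans (ler_wpM2r (exprn_ge0 _ t0) (ler_norm L)))//.
by rewrite ler_wpM2l// ler_weXn2l// leq_addl.
Qed.

Lemma polybZ x q f : polyb x f -> polyb x (fun z => q * f z).
Proof.
move=> [K [n Hf]]; exists (cmod q * K), n => t.
by rewrite cmodM -mulrA ler_wpM2l ?cmod_ge0.
Qed.

Lemma polyb_sum x (I : Type) (r : seq I) (F : I -> R[i] -> R[i]) :
  (forall i, polyb x (F i)) -> polyb x (fun z => \sum_(i <- r) F i z).
Proof.
move=> HF; elim: r => [|i r IH].
  by exists 0, 0%N => t; rewrite big_nil cmod0 mul0r.
have [K [n H]] := polybD (HF i) IH.
by exists K, n => t; rewrite big_cons.
Qed.

(** The modulus contributes a power of |z| and the argument only a bounded factor. On the line |z|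
    >= x, so ln |z| is bounded below and |Re q| can be rounded up to an integer exponent. *)
Lemma polyb_cpow x q : 0 < x -> polyb x (fun z => cpow z q).
Proof.
move=> x0; pose n := (Num.truncn `|Re q|).+1.
have qn : `|Re q| <= n%:R by rewrite ltW// truncnS_gt.
exists (expR (`|Re q| * `|ln x| + `|Im q| * pi) * (1 + x) ^+ n), n => t.
set z := x +i* t.
have xz : x <= cmod z by rewrite (le_trans _ (Re_cmod z))// ler_norm.
have z0 : 0 < cmod z by rewrite (lt_le_trans x0).
have zt : 1 + cmod z <= (1 + x) * (1 + `|t|).
  have := cmod_ReIm z; rewrite (ger0_norm (ltW x0)) => h.
  have : 0 <= x * `|t| by rewrite mulr_ge0// ltW.
  by move: h; rewrite /z /=; lra.
rewrite cpowE cmod_cex Re_mul.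
have -> : Re (clog z) = ln (cmod z) by [].
have z1 : 0 <= 1 + cmod z by rewrite addr_ge0// ltW.
have h1 : `|ln (cmod z)| <= `|ln x| + ln (1 + cmod z).
  have [c1|c1] := leP 1 (cmod z).
    rewrite ger0_norm ?ln_ge0//.
    have : ln (cmod z) <= ln (1 + cmod z) by rewrite ler_ln ?posrE ?lerDr// ltr_wpDr// ltW.
    by have := normr_ge0 (ln x); lra.
  have l0 : ln (cmod z) <= 0 by rewrite ln_le0// ltW.
  have lx : ln x <= ln (cmod z) by rewrite ler_ln ?posrE.
  rewrite ler0_norm//.
  have : 0 <= ln (1 + cmod z) by rewrite ln_ge0// lerDl ltW.
  by have := ler_norm (- ln x); rewrite normrN; lra.
have h2 : Re q * ln (cmod z) <= `|Re q| * `|ln x| + n%:R * ln (1 + cmod z).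
  rewrite (le_trans (ler_norm _))// normrM (le_trans (ler_wpM2l (normr_ge0 _) h1))//.
  rewrite mulrDr lerD2l ler_wpM2r// ln_ge0// lerDl ltW//.
have h3 : - (Im q * Im (clog z)) <= `|Im q| * pi.
  rewrite (le_trans (ler_norm _))// normrN normrM ler_wpM2l//.
  rewrite ltW// (lt_trans (Im_clog _)) ?x0//; exact: pi2_lt_pi.
rewrite (@le_trans _ _ (expR (`|Re q| * `|ln x| + `|Im q| * pi) * (1 + cmod z) ^+ n))//.
  have -> : (1 + cmod z) ^+ n = expR (n%:R * ln (1 + cmod z)).
    by rewrite mulrC expRM_natr lnK// posrE ltr_wpDr// ltW.
  by rewrite -expRD ler_expR; lra.
rewrite -[leRHS]mulrA -exprMn ler_wpM2l ?expR_ge0// lerXn2r// nnegrE//.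
by rewrite mulr_ge0// addr_ge0// ltW.
Qed.

Variables (mu : R[i]) (nu : R) (N : nat).
Let p := 1 - (mu - (2 * N)%:R).
Hypothesis nup : `|nu| < Re p.
Hypothesis H1 : lomH p nu 1 != 0.

Let cf n := (-1) ^+ n * lommel_a n (- mu) nu%:C.
Let ex n := mu - 1 - (2 * n)%:R.

(** The coefficient of F is fixed by the truncation defect: the operator leaves an excess [cf N]
    z^(2 - p) after N terms, and F produces z^2 H 1 z^(- p). *)
Definition lomW z := \sum_(0 <= n < N) cf n * cpow z (ex n) + cf N / lomH p nu 1 * lomF p nu z.
Definition lomW1 z := \sum_(0 <= n < N) cf n * (ex n * cpow z (ex n - 1)) +
  cf N / lomH p nu 1 * lomF1 p nu z.
Definition lomW2 z := \sum_(0 <= n < N) cf n * (ex n * ((ex n - 1) * cpow z (ex n - 1 - 1))) +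
  cf N / lomH p nu 1 * lomF2 p nu z.

Lemma lomW_cdiff z : 0 < Re z -> cdiff lomW z (lomW1 z).
Proof.
move=> z0; apply: cdiffD; last by apply: cdiffZ; exact: lomF_cdiff.
by apply: cdiff_sum => n; apply: cdiffZ; exact: cdiff_cpow.
Qed.

Lemma lomW1_cdiff z : 0 < Re z -> cdiff lomW1 z (lomW2 z).
Proof.
move=> z0; apply: cdiffD; last by apply: cdiffZ; exact: lomF1_cdiff.
by apply: cdiff_sum => n; apply/cdiffZ/cdiffZ; exact: cdiff_cpow.
Qed.

(** On z^e the operator z^2 D^2 + z D + z^2 - nu^2 gives z^(e+2) + (e^2 - nu^2) z^e, and a_(n+1) =
    a_n (e^2 - nu^2) at e = mu - 1 - 2 n. With the alternating signs the sum telescopes to T 0 - T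
    N, and the F part supplies T N. *)
Lemma lomW_ode z : 0 < Re z ->
  lomW2 z + z^-1 * lomW1 z + (1 - nu%:C ^+ 2 / z ^+ 2) * lomW z = cpow z (mu - 1).
Proof.
move=> z0; have zn0 : z != 0 by apply: contraTneq z0 => ->; rewrite Re0 ltxx.
apply: (mulfI (expf_neq0 2 zn0)).
have cS s : cpow z (s - 1) = cpow z s / z by rewrite cpowB cpow1.
transitivity (z ^+ 2 * lomW2 z + z * lomW1 z + (z ^+ 2 - nu%:C ^+ 2) * lomW z).
  by field.
pose T n := cf n * cpow z (mu + 1 - (2 * n)%:R).
have cT n : cpow z (mu + 1 - (2 * n)%:R) = z ^+ 2 * cpow z (ex n).
  by rewrite -(cpow_nat 2 z0) -cpowD; congr cpow; rewrite /ex; ring.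
have sumT : forall k, z ^+ 2 * (\sum_(0 <= n < k) cf n * (ex n * ((ex n - 1) * cpow z (ex n - 1 - 1)))) +
    z * (\sum_(0 <= n < k) cf n * (ex n * cpow z (ex n - 1))) +
    (z ^+ 2 - nu%:C ^+ 2) * (\sum_(0 <= n < k) cf n * cpow z (ex n)) = T 0%N - T k.
  elim=> [|k IH]; first by rewrite !big_geq// subrr !mulr0 !addr0.
  rewrite !(big_nat_recr k) //= !mulrDr.
  have -> : T k.+1 = T k - cf k * ((z ^+ 2 - nu%:C ^+ 2 + ex k ^+ 2) * cpow z (ex k)).
    have e1 : mu + 1 - (2 * k.+1)%:R = ex k by rewrite /ex mulnS natrD; ring.
    have e2 : lommel_a k.+1 (- mu) nu%:C = lommel_a k (- mu) nu%:C * (ex k ^+ 2 - nu%:C ^+ 2).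
      rewrite /lommel_a big_nat_recr //=; congr (_ * (_ - _)).
      by rewrite /ex natrM -natr1; ring.
    by rewrite /T e1 cT /cf e2 exprS; ring.
  have -> (a b c : R[i]) : a - (b - c) = a - b + c by rewrite opprB addrA addrAC.
  rewrite -IH (cS (ex k - 1)) (cS (ex k)).
  exact: telescoping_algebra.
have T0 : T 0%N = z ^+ 2 * cpow z (mu - 1).
  by rewrite /T cT /cf /lommel_a big_geq// expr0 !mul1r /ex muln0 subr0.
rewrite -T0 -[RHS](subrK (T N)) -sumT /lomW /lomW1 /lomW2.
have h := lomF_ode nup z0.
have TN : T N = cf N / lomH p nu 1 * (z ^+ 2 * lomH p nu z).
  rewrite (lomHE nup z0) /T cT.
  have -> : ex N = - p by rewrite /ex /p; ring.
  by field.
rewrite TN -h; ring.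
Qed.

Lemma lomW_polyb x : 0 < x -> polyb x lomW.
Proof.
move=> x0; apply: polybD.
  by apply: polyb_sum => n; apply: polybZ; exact: polyb_cpow.
apply: polybZ.
exists (2 * \int[(leb \x leb)%E]_t (cmod (weightF p nu t) * expR (- (x * phi t)))), 0%N => t.
by rewrite expr0 mulr1; exact: (lap_bound (z := x +i* t) (strip_weightF nup) x0).
Qed.

Variable S : R[i] -> R[i].
Hypothesis SL : is_lommel mu nu%:C S.

Let slit z : 0 < Re z -> slit_plane z.
Proof.
move=> z0; split; first by apply: contraTneq z0 => ->; rewrite Re0 ltxx.
by rewrite (lt_trans (carg_right z0)) ?pi2_lt_pi.
Qed.

(** Far out on the line the asymptotic condition bounds S by 2 |z^(mu-1)|; on the remaining compact
    segment continuity gives a maximum. *)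
Lemma lommel_polyb x : 0 < x -> polyb x S.
Proof.
move=> x0; have pi20 : 0 < pi / 2 :> R by rewrite divr_gt0// pi_gt0.
(* The choice delta = pi / 2 gives the closed right half-plane, which contains every vertical line
   used. *)
have [A HA] := lommel_asymptotic SL pi20 ltr01.
have [K [n HK]] := polyb_cpow (mu - 1) x0.
pose g t : R[i] := x +i* t.
have cg : ccont g.
  by split; [exact: cst_continuous|move=> t; exact: cvg_id].
have [c1 c2] : ccont (fun t => S (g t)).
  apply: ccont_cdiff cg => t; eexists; apply: cdiff_cderiv.
  by apply: (lommel_derivable SL); exact: slit.
pose B := `|A|.
have B0 : - B <= B by rewrite ge0_cp// normr_ge0.
pose u t := `|Re (S (g t))| + `|Im (S (g t))|.
have cu : continuous u.
  by move=> t; apply: cvgD; apply: (continuous_comp (c1 t) (@norm_continuous _ R^o _)) || apply: (continuous_comp (c2 t) (@norm_continuous _ R^o _)).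
have [c _ Hc] := EVT_max B0 (continuous_subspaceT cu).
exists (u c + 2 * `|K|), n => t.
have t1 : 1 <= (1 + `|t|) ^+ n by rewrite exprn_ege1// lerDl.
have t0 := le_trans ler01 t1.
have uc : 0 <= u c by rewrite addr_ge0.
have [tB|Bt] := leP `|t| B.
  have := Hc t; rewrite in_itv /= -ler_norml => /(_ tB) h.
  rewrite (le_trans (cmod_ReIm _))// -/(u t) (le_trans h)//.
  rewrite -[leLHS]mulr1 (le_trans (ler_wpM2l uc t1))// ler_wpM2r// lerDl mulr_ge0//.
have z0 : 0 < Re (g t) by [].
have sec : sector (pi / 2) (g t).
  split; first by apply: contraTneq z0 => ->; rewrite Re0 ltxx.
  by rewrite (le_trans (ltW (carg_right z0)))//; lra.
have AB : A <= cmod (g t).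
  by rewrite (le_trans (ler_norm A))// (le_trans (ltW Bt))// (le_trans _ (Im_cmod _)).
have h := HA _ sec AB.
have E : S (g t) = cpow (g t) (mu - 1) * (1 + (S (g t) / cpow (g t) (mu - 1) - 1)).
  by field; exact: cpow_neq0.
rewrite -/(g t) E cmodM.
have h2 : cmod (1 + (S (g t) / cpow (g t) (mu - 1) - 1)) <= 2.
  by rewrite (le_trans (cmodD _ _))// cmod1 [leRHS](_ : 2 = 1 + 1)// lerD2l.
rewrite (le_trans (ler_wpM2l (cmod_ge0 _) h2))//.
have := HK t; rewrite -/(g t) => h3.
rewrite (le_trans (ler_wpM2r (ler0n _ 2) h3))// mulrDl.
rewrite (@le_trans _ _ (2 * `|K| * (1 + `|t|) ^+ n)) ?lerDr ?mulr_ge0//.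
by rewrite mulrC mulrA ler_wpM2r// ler_wpM2l// ler_norm.
Qed.

Lemma lommel_representation x : 0 < x ->
  S x%:C = lomW x%:C /\ cderiv S x%:C = lomW1 x%:C.
Proof.
have dS z : 0 < Re z -> cdiff S z (cderiv S z).
  by move=> z0; apply: cdiff_cderiv; apply: (lommel_derivable SL); exact: slit.
have dS1 z : 0 < Re z -> cdiff (cderiv S) z (cderiv (cderiv S) z).
  by move=> z0; apply: cdiff_cderiv; apply: (lommel_derivable2 SL); exact: slit.
have := @bessel_decaying_eq0 R (fun z => S z - lomW z) (fun z => cderiv S z - lomW1 z)
  (fun z => cderiv (cderiv S) z - lomW2 z) nu.
move=> H x0; have [||||] := H _ _ _ _ x x0.
- by move=> z z0; apply: cdiffB; [exact: dS|exact: lomW_cdiff].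
- by move=> z z0; apply: cdiffB; [exact: dS1|exact: lomW1_cdiff].
- move=> z z0; have e1 := lommel_ode SL (slit z0); have e2 := lomW_ode z0.
  have lin (a a' b b' c c' u v : R[i]) : a - a' + u * (b - b') + v * (c - c') =
    a + u * b + v * c - (a' + u * b' + v * c') by ring.
  by rewrite lin e1 e2 subrr.
- move=> y y0; have := polybD (lommel_polyb y0) (polybZ (-1) (lomW_polyb y0)).
  by move=> [K [n h]]; exists K, n => t; rewrite -mulN1r; exact: h.
by move=> /eqP + /eqP; rewrite !subr_eq0 => /eqP -> /eqP ->.
Qed.

End LommelRepresentation.

(** * Enveloping expansion of the modified Bessel function *)

Section BinomialTaylor.
Variable R : realType.
Implicit Types (a b x y : R).

Definition gbin a m : R := (\prod_(0 <= j < m) (a - j%:R)) / m`!%:R.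

Lemma gbin0 a : gbin a 0 = 1.
Proof. by rewrite /gbin big_geq// fact0 divr1. Qed.

Lemma gbinS a m : gbin a m.+1 * m.+1%:R = a * gbin (a - 1) m.
Proof.
rewrite /gbin big_nat_recl// subr0 factS natrM.
have -> : \prod_(0 <= i < m) (a - i.+1%:R) = \prod_(0 <= j < m) (a - 1 - j%:R).
  by apply: eq_bigr => i _; rewrite -natr1; ring.
have f0 : m`!%:R != 0 :> R by rewrite pnatr_eq0 -lt0n fact_gt0.
have s0 : m.+1%:R != 0 :> R by rewrite pnatr_eq0.
have gen (P u w : R) : u != 0 -> w != 0 -> a * P / (u * w) * u = a * (P / w).
  by move=> u0 w0; field; rewrite u0 w0.
exact: gen.
Qed.

Definition pow1 a y : R := expR (a * ln (1 + y)).
Definition bintail a M y : R := pow1 a y - \sum_(0 <= m < M) gbin a m * y ^+ m.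

Lemma pow1D a b y : pow1 (a + b) y = pow1 a y * pow1 b y.
Proof. by rewrite /pow1 mulrDl expRD. Qed.

Lemma pow1_1 y : 0 <= y -> pow1 1 y = 1 + y.
Proof. by move=> y0; rewrite /pow1 mul1r lnK// posrE ltr_pwDl. Qed.

Lemma is_derive_pow1 a y : 0 <= y -> is_derive y (1 : R) (pow1 a) (a * pow1 (a - 1) y).
Proof.
move=> y0; have y1 : 0 < 1 + y by rewrite ltr_pwDl.
have d1 : is_derive y (1 : R) (fun y => a * ln (1 + y)) (a * (1 + y)^-1).
  have dl := is_derive1_ln y1.
  have dd : is_derive y (1 : R) (fun y => 1 + y) 1.
    have d0 : is_derive y (1 : R) (cst (1 : R) \+ id) (0 + 1) by exact: is_deriveD.
    by rewrite add0r in d0.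
  have := is_derive1_comp dl dd => dc.
  have := is_deriveZ a dc.
  by move/is_derive_eq; apply; rewrite !scaleRE mulr1.
have := @is_derive1_comp _ expR (fun y => a * ln (1 + y)) y _ _ (is_derive_expR (a * ln (1 + y))) d1.
move/is_derive_eq; apply.
have -> : pow1 (a - 1) y = pow1 a y / (1 + y).
  by have := pow1D (a - 1) 1 y; rewrite subrK (pow1_1 y0) => ->; rewrite mulfK// gt_eqF.
by rewrite /pow1; ring.
Qed.

Lemma is_derive_monomial c M y :
  is_derive y (1 : R) (fun t => c * t ^+ M.+1) (c * (M.+1%:R * y ^+ M)).
Proof.
have d0 : is_derive y (1 : R) (fun t => t ^+ M.+1) (M.+1%:R * y ^+ M).
  have d1 := is_deriveX M.+1 (is_derive_id y (1 : R)).
  rewrite exprfctE scaleRE mulr1 in d1; exact: d1.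
exact: (is_deriveZ c d0).
Qed.

Lemma is_derive_bintail a M y : 0 <= y ->
  is_derive y (1 : R) (bintail a M.+1) (a * bintail (a - 1) M y).
Proof.
move=> y0; rewrite /bintail.
have dp := is_derive_pow1 a y0.
have ds : is_derive y (1 : R) (fun y => \sum_(0 <= m < M.+1) gbin a m * y ^+ m)
    (\sum_(0 <= m < M) a * (gbin (a - 1) m * y ^+ m)).
  elim: M => [|M IH].
    rewrite [X in is_derive _ _ X](_ : _ = fun=> 1).
      by rewrite big_geq//; exact: is_derive_cst.
    by apply/funext => t; rewrite big_nat1 gbin0 expr0 mulr1.
  rewrite [X in is_derive _ _ X](_ : _ = (fun y => \sum_(0 <= m < M.+1) gbin a m * y ^+ m) \+
     (fun y => gbin a M.+1 * y ^+ M.+1)); last by apply/funext => t; rewrite big_nat_recr.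
  rewrite big_nat_recr//=; apply: is_deriveD.
  have := is_derive_monomial (gbin a M.+1) M y.
  by move/is_derive_eq; apply; rewrite [RHS]mulrA -gbinS; ring.
have := is_deriveB dp ds; move/is_derive_eq; apply.
by rewrite mulrBr mulr_sumr.
Qed.

Lemma bintail_at0 a M : bintail a M.+1 0 = 0.
Proof.
rewrite /bintail /pow1 addr0 ln1 mulr0 expR0 big_nat_recl// gbin0 expr0 mulr1 big1 ?addr0 ?subrr//.
by move=> i _; rewrite expr0n mulr0.
Qed.

Lemma MVT0 (f df : R -> R) y : 0 < y -> (forall x, 0 <= x -> is_derive x (1 : R) f (df x)) ->
  exists2 c : R, 0 < c < y & f y - f 0 = df c * y.
Proof.
move=> y0 H; have [|||c] := @MVT R f df 0 y.
- exact: y0.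
- by move=> x; rewrite in_itv /= => /andP[/ltW x0 _]; exact: H.
- apply: derivable_within_continuous => x; rewrite in_itv /= => /andP[x0 _].
  by have [] := H x x0.
- by rewrite in_itv /= subr0 => h1 h2; exists c.
Qed.

(* The binomial series is enveloping: both claims follow by induction on [M],
   since differentiation turns the tail for [(a, M.+1)] into [a] times the
   tail for [(a - 1, M)]. *)
Lemma bintail_bounds M : forall a y, a < M%:R -> 0 < y ->
  if gbin a M == 0 then bintail a M y = 0
  else 0 < bintail a M y / gbin a M < y ^+ M.
Proof.
elim: M => [|M IH] a y aM y0.
  (* For M = 0 the hypothesis is a < 0, which puts (1 + y)^a strictly between 0 and 1. *)
  rewrite gbin0 oner_eq0 divr1 expr0 /bintail big_geq// subr0 expR_gt0 /=.
  by rewrite -expR0 ltr_expR nmulr_rlt0// ln_gt0// ltrDl.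
have aM' : a - 1 < M%:R by rewrite ltrBlDr natr1.
have M0 : M.+1%:R != 0 :> R by rewrite pnatr_eq0.
have [c /andP[c0 cy]] := MVT0 y0 (fun x => @is_derive_bintail a M x).
rewrite bintail_at0 subr0 => tE.
have := IH (a - 1) c aM' c0.
case: ifPn => [/eqP g0|g0]; case: ifPn => [/eqP h0|h0].
- by move=> h; rewrite tE h mulr0 mul0r.
- have := gbinS a M; rewrite g0 mulr0 => /eqP.
  by rewrite mulf_eq0 (negPf h0) (negPf M0).
- have := gbinS a M; rewrite h0 mul0r => /esym/eqP.
  by rewrite mulf_eq0 (negPf g0) orbF tE => /eqP ->; rewrite !mul0r.
have a0 : a != 0.
  by apply: contraNneq h0 => a0; have := gbinS a M; rewrite a0 mul0r => /eqP; rewrite mulf_eq0 (negPf M0) orbF.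
have gE : gbin a M.+1 = a * gbin (a - 1) M / M.+1%:R by rewrite -gbinS mulfK.
have tg t : a * bintail (a - 1) M t / gbin a M.+1 = M.+1%:R * (bintail (a - 1) M t / gbin (a - 1) M).
  have gen (T G u : R) : G != 0 -> u != 0 -> a * T / (a * G / u) = u * (T / G).
    by move=> G0 u0; field; rewrite G0 a0 u0.
  by rewrite gE gen.
move=> /andP[l1 l2]; apply/andP; split.
  by rewrite tE mulrAC tg mulr_gt0// mulr_gt0// ltr0n.
(* For the upper bound the mean value theorem is applied to y^(M+1) minus the normalised tail: its
   derivative is (M + 1) times the same difference one level down. *)
have dm (x : R) : 0 <= x -> is_derive x (1 : R) (fun t => 1 * t ^+ M.+1 - (gbin a M.+1)^-1 * bintail a M.+1 t)
    (1 * (M.+1%:R * x ^+ M) - (gbin a M.+1)^-1 * (a * bintail (a - 1) M x)).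
  move=> x0; have := is_deriveB (is_derive_monomial 1 M x)
    (is_deriveZ (gbin a M.+1)^-1 (@is_derive_bintail a M x x0)).
  by move/is_derive_eq; apply.
have [d /andP[d0 dy]] := MVT0 y0 dm.
have z0 : 0 ^+ M.+1 = 0 :> R by rewrite expr0n.
rewrite bintail_at0 z0 !mulr0 !subr0 !mul1r => mE.
have := IH (a - 1) d aM' d0; rewrite (negPf g0) => /andP[k1 k2].
rewrite -subr_gt0 [_ / _]mulrC mE mulr_gt0// [_^-1 * _]mulrC tg -mulrBr.
by rewrite mulr_gt0 ?ltr0Sn// subr_gt0.
Qed.

End BinomialTaylor.

(** * Integral representations of K_nu *)

Section BesselIntegral.
Variable R : realType.
Local Notation mu := (@lebesgue_measure R).
Implicit Types (x y t a b c e u v w r nu : R).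

(* [kappa nu x] is [2 K_nu x]; [kappa1 nu x] below is [- 2 K_nu' x]. *)
Definition kappa nu x : R := \int[mu]_u expR (nu * u - x * ch u).

Lemma kappa_integrand nu x u :
  (expR (nu * u))%:C * cex (- (x%:C * (ch u)%:C)) = (expR (nu * u - x * ch u))%:C :> R[i].
Proof. by rewrite -rmorphM -rmorphN cex_real -rmorphM expRD. Qed.

Lemma rintg_kappa nu x : 0 < x -> rintg mu (fun u => expR (nu * u - x * ch u)).
Proof.
move=> x0; have x0' : 0 < Re (x%:C : R[i]) by [].
have [+ _] := lap_cintg (strip_ch nu) x0'.
by apply: eq_integrable => // u _; rewrite /comp kappa_integrand.
Qed.

Lemma kappa_lap nu x : 0 < x -> lap mu (@ch R) (fun u => (expR (nu * u))%:C) x%:C = (kappa nu x)%:C.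
Proof. by move=> x0; rewrite /kappa -cint_real; apply: eq_cint => u; exact: kappa_integrand. Qed.

Lemma Rintegral_EFin (f : R -> R) : rintg mu f ->
  (\int[mu]_u (f u)%:E = (\int[mu]_u f u)%:E)%E.
Proof. by move=> fi; rewrite /Rintegral fineK//; exact: (integrable_fin_num _ fi). Qed.

Lemma kappaE nu x : 0 < x -> (\int[mu]_u (expR (nu * u - x * ch u))%:E = (kappa nu x)%:E)%E.
Proof. by move=> x0; rewrite Rintegral_EFin//; exact: rintg_kappa. Qed.

Lemma chN u : ch (- u) = ch u.
Proof. by rewrite /ch opprK addrC. Qed.

Lemma continuous_expR_comp (f : R -> R) : continuous f -> continuous (fun u => expR (f u)).
Proof. by move=> cf u; apply: continuous_comp; [exact: cf|exact: continuous_expR]. Qed.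

Lemma continuous_mull c : continuous (fun u : R => c * u).
Proof. by move=> u; apply: cvgM; [exact: cvg_cst|exact: cvg_id]. Qed.

Lemma continuous_kappa_integrand nu x : continuous (fun u => expR (nu * u - x * ch u)).
Proof.
apply: continuous_expR_comp => u; apply: cvgB; first exact: continuous_mull.
by apply: cvgM; [exact: cvg_cst|exact: continuous_ch].
Qed.

Lemma kappaN nu x : 0 < x -> kappa (- nu) x = kappa nu x.
Proof.
move=> x0; apply: EFin_inj; rewrite -(kappaE (- nu) x0) -(kappaE nu x0).
rewrite (ge0_reflection (@continuous_kappa_integrand nu x)) => [|u]; last exact: expR_ge0.
by apply: eq_integral => u _; rewrite chN mulrN mulNr.
Qed.

Lemma ge0_line_substitution (F F' G : R -> R) :
  (forall x, is_derive x (1 : R) F (F' x)) -> continuous F' -> (forall x, 0 < F' x) ->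
  (forall y, exists n : nat, F (- n%:R) <= y <= F n%:R) -> continuous G -> (forall x, 0 <= G x) ->
  (\int[mu]_x (G x)%:E = \int[mu]_x (G (F x) * F' x)%:E)%E.
Proof.
move=> dF cF F0 cov cG G0.
apply: (@ge0_increasing_substitution R F F' setT dF cF F0) => //.
Qed.

Lemma ge0_iintZ (f : R -> R) c : continuous f -> (forall w, 0 <= f w) -> 0 <= c ->
  (\int[mu]_w (c * f w)%:E = c%:E * \int[mu]_w (f w)%:E)%E.
Proof.
move=> cf f0 c0; under eq_integral do rewrite EFinM.
apply: ge0_integralZl_EFin => //.
- by move=> w _; rewrite lee_fin.
- by apply/measurable_EFinP; apply: continuous_measurable_fun.
Qed.

Lemma is_derive_expRM c u : is_derive u (1 : R) (fun u => expR (c * u)) (c * expR (c * u)).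
Proof.
have d1 : is_derive u (1 : R) (fun u => c * u) (c * 1) by exact: (is_deriveZ c (is_derive_id u (1 : R))).
have := @is_derive1_comp _ expR (fun u => c * u) u _ _ (is_derive_expR (c * u)) d1.
by move/is_derive_eq; apply; rewrite mulr1 mulrC.
Qed.

Lemma archimedean_bound t : exists n : nat, t <= n%:R.
Proof. by exists (Num.truncn t).+1; rewrite ltW// truncnS_gt. Qed.

(* The substitution [t = sqrt (2 x) sinh (u / 2)] reduces to the Gaussian integral. *)
Lemma kappa_half x : 0 < x -> kappa (- 2^-1) x = expR (- x) * Num.sqrt (2 * pi / x).
Proof.
move=> x0; pose c := Num.sqrt (x / 2).
have c0 : 0 < c by rewrite sqrtr_gt0 divr_gt0.
have c2 : c ^+ 2 = x / 2 by rewrite sqr_sqrtr// divr_ge0// ltW.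
pose F u := c * (expR (2^-1 * u) - expR (- 2^-1 * u)).
pose F' u := c * (2^-1 * expR (2^-1 * u) - - 2^-1 * expR (- 2^-1 * u)).
have dF u : is_derive u (1 : R) F (F' u).
  exact: (is_deriveZ c (is_deriveB (is_derive_expRM 2^-1 u) (is_derive_expRM (- 2^-1) u))).
have cF' : continuous F'.
  move=> u; apply: cvgM; first exact: cvg_cst.
  by apply: cvgB; apply: cvgM; try exact: cvg_cst; apply: continuous_expR_comp; exact: continuous_mull.
have F'0 u : 0 < F' u.
  rewrite mulr_gt0// mulNr opprK -mulrDr mulr_gt0 ?invr_gt0// addr_gt0 ?expR_gt0//.
have cov t : exists n : nat, F (- n%:R) <= t <= F n%:R.
  have [n hn] := archimedean_bound (2 * `|t| / c); exists n.
  have n0 : (0 : R) <= n%:R by rewrite ler0n.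
  have FN : F (- n%:R) = - F n%:R by rewrite /F !mulrN !mulNr !opprK; ring.
  rewrite FN -ler_norml.
  have h1 := expR_ge1Dx (2^-1 * n%:R : R).
  have h2 : expR (- 2^-1 * n%:R) <= 1 :> R.
    by rewrite -expR0 ler_expR mulNr oppr_le0 mulr_ge0.
  rewrite ler_pdivrMr// in hn.
  have : c * (2^-1 * n%:R) <= F n%:R by rewrite /F ler_wpM2l ?(ltW c0)//; lra.
  lra.
(* The Jacobian F' is a sum of two exponentials, so the Gaussian integral produces kappa at 1/2 plus
   kappa at -1/2; these agree by evenness in nu. *)
have key u : expR (2^-1 * u - x * ch u) + expR (- 2^-1 * u - x * ch u) =
    (2 / c * expR (- x)) * (gauss_fun (F u) * F' u).
  have -> : gauss_fun (F u) = expR (x - x * ch u).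
    rewrite /gauss_fun /F exprMn c2; congr expR.
    have e1 : expR (2^-1 * u) * expR (2^-1 * u) = expR u by rewrite -expRD; congr expR; field.
    have e2 : expR (- 2^-1 * u) * expR (- 2^-1 * u) = expR (- u) by rewrite -expRD; congr expR; field.
    have e3 : expR (2^-1 * u) * expR (- 2^-1 * u) = 1 by rewrite -expRD mulNr subrr expR0.
    rewrite /ch -e1 -e2; move: e3; move: (expR _) (expR _) => A B AB.
    by field: AB.
  have e4 : expR (- x) * expR (x - x * ch u) = expR (- (x * ch u)).
    by rewrite -expRD; congr expR; ring.
  rewrite (expRD (2^-1 * u)) (expRD (- 2^-1 * u)) -e4 /F'; field.
  by rewrite gt_eqF.
have sumE : ((kappa 2^-1 x)%:E + (kappa (- 2^-1) x)%:E = (2 / c * expR (- x) * Num.sqrt pi)%:E)%E.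
  rewrite -!kappaE// -ge0_integralD//; first last.
  - by apply/measurable_EFinP; apply: continuous_measurable_fun; exact: continuous_kappa_integrand.
  - by apply/measurable_EFinP; apply: continuous_measurable_fun; exact: continuous_kappa_integrand.
  have cg : continuous (@gauss_fun R).
    apply: continuous_expR_comp => u; apply: cvgN; rewrite expr2; exact: cvgM.
  rewrite EFinM -integralT_gauss (ge0_line_substitution dF cF' F'0 cov cg) => [|u]; last exact: expR_ge0.
  have cFF : continuous F by move=> u; exact: is_derive_continuous (dF u).
  rewrite -ge0_iintZ; first last.
  - by rewrite mulr_ge0 ?expR_ge0// divr_ge0// ltW.
  - by move=> u; rewrite mulr_ge0 ?expR_ge0// ltW.
  - by move=> u; apply: cvgM; [exact: (continuous_comp (cFF u) (cg _))|exact: cF'].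
  by apply: eq_integral => u _; rewrite -EFinD key.
move: sumE; rewrite -EFinD => -[]; rewrite kappaN// -mulr2n => h.
have -> : Num.sqrt (2 * pi / x) = Num.sqrt pi / c.
  rewrite -sqrtrV ?divr_ge0 ?(ltW x0)// -sqrtrM ?pi_ge0// invf_div; congr Num.sqrt; ring.
apply: (mulfI (_ : 2 != 0 :> R)) => //; rewrite mulr_natl h; ring.
Qed.

(** This is [kappa_half] at x r after translating by ln r. In this form r enters the integrand only
    through r^2 in the exponent, so exp (- x r) / r becomes an integral that can be exchanged with
    another one. *)
Lemma kappa_half_shift x r : 0 < x -> 0 < r ->
  (\int[mu]_w (expR (- 2^-1 * w - x / 2 * (expR w + r ^+ 2 * expR (- w))))%:E =
   (expR (- (x * r)) * Num.sqrt (2 * pi / x) / r)%:E)%E.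
Proof.
move=> x0 r0; have xr0 : 0 < x * r by rewrite mulr_gt0.
pose s := expR (2^-1 * ln r).
have s0 : 0 < s by rewrite expR_gt0.
have s2 : s * s = r by rewrite -expRD -mulrDl [2^-1 + _](_ : _ = 1) ?mul1r ?lnK ?posrE//; field.
pose g w := expR (- 2^-1 * w - x / 2 * (expR w + r ^+ 2 * expR (- w))).
have cg : continuous g.
  apply: continuous_expR_comp => w; apply: cvgB; first exact: continuous_mull.
  apply: cvgM; first exact: cvg_cst.
  apply: cvgD; first exact: continuous_expR.
  apply: cvgM; first exact: cvg_cst.
  by apply: continuous_expR_comp; exact: oppr_continuous.
have := kappaE (- 2^-1) xr0; rewrite kappa_half//.
rewrite (substitution_affine (- ln r) ltr01 (@continuous_kappa_integrand (- 2^-1) (x * r))).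
have E w : expR (- 2^-1 * (1 * w + - ln r) - x * r * ch (1 * w + - ln r)) * 1 = s * g w.
  rewrite mulr1 mul1r /g /s -expRD; congr expR.
  have -> : ch (w + - ln r) = (expR w / r + r * expR (- w)) / 2.
    by rewrite /ch opprD opprK !expRD expRN lnK ?posrE//; field; rewrite gt_eqF.
  by field; rewrite gt_eqF.
under eq_integral do rewrite E.
rewrite (ge0_iintZ cg) => [|w|]; [|exact: expR_ge0|exact: ltW].
move=> h; have : ((s^-1)%:E * (s%:E * \int[mu]_w (g w)%:E) = \int[mu]_w (g w)%:E)%E.
  by rewrite muleA -EFinM mulVf ?gt_eqF// mul1e.
rewrite h => <-; rewrite -EFinM; congr (_%:E).
have -> : Num.sqrt (2 * pi / (x * r)) = Num.sqrt (2 * pi / x) / s.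
  rewrite -[s]ger0_norm ?(ltW s0)// -sqrtr_sqr expr2 s2 -sqrtrV ?(ltW r0)// -sqrtrM.
    by rewrite invfM mulrA.
  by rewrite divr_ge0 ?mulr_ge0 ?pi_ge0// ltW.
by rewrite -s2; field; rewrite gt_eqF.
Qed.

(** With t = exp v this is exp (- t) t^(nu - 1/2) (1 + t / (2 x))^(nu - 1/2) dt, the classical
    integrand for K_nu. *)
Definition laguerre_weight nu x v : R := expR ((nu + 2^-1) * v - expR v) * pow1 (nu - 2^-1) (expR v / (2 * x)).

Lemma continuous_pow1_expR a x : 0 < x -> continuous (fun v => pow1 a (expR v / (2 * x))).
Proof.
move=> x0; apply: continuous_expR_comp => v; apply: cvgM; first exact: cvg_cst.
apply: (@continuous_comp _ _ _ (fun v => 1 + expR v / (2 * x)) (@ln R)).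
  apply: cvgD; first exact: cvg_cst.
  by apply: cvgM; [exact: continuous_expR|exact: cvg_cst].
by apply: continuous_ln; rewrite ltr_pwDl// divr_ge0 ?expR_ge0// mulr_ge0// ltW.
Qed.

Lemma continuous_laguerre_weight nu x : 0 < x -> continuous (laguerre_weight nu x).
Proof.
move=> x0; have c1 : continuous (fun v => expR ((nu + 2^-1) * v - expR v)).
  by apply: continuous_expR_comp => u; apply: cvgB; [exact: continuous_mull|exact: continuous_expR].
by move=> v; apply: cvgM; [exact: c1|exact: continuous_pow1_expR].
Qed.

(* Insert [kappa_half_shift] with [r = 1 + exp v / x], exchange the integrals and
   substitute [q = v + ln (1 + exp v / (2 x))]. *)
Lemma kappa_laguerre nu x : 0 < x -> - 2^-1 < nu ->
  ((Num.sqrt (2 * pi / x) * expR (- x))%:E * \int[mu]_v (laguerre_weight nu x v)%:E =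
   ((\int[mu]_v expR ((nu + 2^-1) * v - expR v)) * kappa nu x)%:E)%E.
Proof.
move=> x0 nu0; pose a := nu + 2^-1; have a0 : 0 < a by rewrite /a; lra.
have ha : nu - 2^-1 + 1 = a by rewrite /a; lra.
pose y v := expR v / (2 * x); pose r v := 1 + 2 * y v.
have x2 : 0 < 2 * x by rewrite mulr_gt0.
have y0 v : 0 < y v by rewrite divr_gt0 ?expR_gt0.
have r0 v : 0 < r v by rewrite addr_gt0// mulr_gt0.
(* The factor r v cancels the 1 / r of [kappa_half_shift], and x r v = x + exp v restores the decay
   of the Laguerre weight. *)
pose m v := expR (a * v) * pow1 (nu - 2^-1) (y v) * r v.
pose k (q : R * R) := m q.1 * expR (- 2^-1 * q.2 - x / 2 * (expR q.2 + r q.1 ^+ 2 * expR (- q.2))).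
have cy : continuous y by move=> v; apply: cvgM; [exact: continuous_expR|exact: cvg_cst].
have cr : continuous r.
  by move=> v; apply: cvgD; [exact: cvg_cst|apply: cvgM; [exact: cvg_cst|exact: cy]].
have cm : continuous m.
  move=> v; apply: cvgM; last exact: cr.
  apply: cvgM; last exact: continuous_pow1_expR.
  by apply: continuous_expR_comp; exact: continuous_mull.
have m0 v : 0 < m v by rewrite !mulr_gt0 ?expR_gt0.
have m1 (f : R -> R) : continuous f -> measurable_fun setT (fun q : measurableTypeR R * measurableTypeR R => f q.1).
  by move=> cf; apply: (measurableT_comp (f := f)) => //; exact: continuous_measurable_fun.
have m2 (f : R -> R) : continuous f -> measurable_fun setT (fun q : measurableTypeR R * measurableTypeR R => f q.2).
  by move=> cf; apply: (measurableT_comp (f := f)) => //; exact: continuous_measurable_fun.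
have mk : measurable_fun setT (fun q : measurableTypeR R * measurableTypeR R => (k q)%:E).
  apply/measurable_EFinP; apply: measurable_funM; first exact: m1.
  apply: (measurableT_comp (f := @expR R)) => //.
  apply: measurable_funB; first by apply: m2; exact: continuous_mull.
  apply: measurable_funM; first exact: measurable_cst.
  apply: measurable_funD; first by apply: m2; exact: continuous_expR.
  apply: measurable_funM.
    by apply: (m1 (fun v => r v ^+ 2)) => v; apply: (@cvgM _ _ _ _ r r); exact: cr.
  apply: (m2 (fun w => expR (- w))).
  by apply: continuous_expR_comp; exact: oppr_continuous.
have k0 (q : R * R) : (0%R <= (k q)%:E)%E by rewrite lee_fin mulr_ge0 ?expR_ge0// ltW.
have S2 : 0 <= Num.sqrt (2 * pi / x) * expR (- x) by rewrite mulr_ge0 ?expR_ge0 ?sqrtr_ge0.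
rewrite -(ge0_iintZ (@continuous_laguerre_weight nu x x0) _ S2) => [|v]; last by rewrite mulr_ge0 ?expR_ge0.
transitivity (\int[mu]_v \int[mu]_w (k (v, w))%:E)%E.
  apply: eq_integral => v _.
  have cw : continuous (fun w => expR (- 2^-1 * w - x / 2 * (expR w + r v ^+ 2 * expR (- w)))).
    apply: continuous_expR_comp => w; apply: cvgB; first exact: continuous_mull.
    apply: cvgM; first exact: cvg_cst.
    apply: cvgD; first exact: continuous_expR.
    apply: cvgM; first exact: cvg_cst.
    by apply: continuous_expR_comp; exact: oppr_continuous.
  have kZ := ge0_iintZ cw (fun w => expR_ge0 _) (ltW (m0 v)).
  apply: etrans; last exact: (esym kZ).
  rewrite kappa_half_shift// -EFinM; congr (_%:E).
  have -> : expR (- (x * r v)) = expR (- x) * expR (- expR v).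
    by rewrite -expRD; congr expR; rewrite /r /y; field; rewrite gt_eqF.
  rewrite /laguerre_weight /m -/a -/(y v) expRD; field.
  by rewrite gt_eqF.
rewrite (fubini_tonelli _ mk k0).
have dF v : is_derive v (1 : R) (fun v => v + ln (1 + y v)) (1 + y v / (1 + y v)).
  have d1 : is_derive v (1 : R) (cst (1 : R) \+ (fun v => (2 * x)^-1 * expR (1 * v)))
     (0 + (2 * x)^-1 * (1 * expR (1 * v))).
    by apply: is_deriveD; exact: (is_deriveZ _ (is_derive_expRM 1 v)).
  have E1 : (cst (1 : R) \+ (fun v => (2 * x)^-1 * expR (1 * v))) = (fun v => 1 + y v).
    by apply/funext => t; rewrite /= mul1r mulrC.
  have y1 : 0 < 1 + y v by rewrite addr_gt0.
  rewrite E1 in d1.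
  have d2 := @is_derive1_comp _ (@ln R) (fun v => 1 + y v) v _ _ (is_derive1_ln y1) d1.
  have := is_deriveD (is_derive_id v (1 : R)) d2.
  by move/is_derive_eq; apply; rewrite /y !mul1r add0r; congr (1 + _); rewrite mulrC [_^-1 * expR _]mulrC.
pose F v := v + ln (1 + y v); pose F' v := 1 + y v / (1 + y v).
have y1 v : 0 < 1 + y v by rewrite addr_gt0.
have cF' : continuous F'.
  move=> v; apply: cvgD; first exact: cvg_cst.
  apply: cvgM; first exact: cy.
  apply: cvgV; first by rewrite gt_eqF.
  by apply: cvgD; [exact: cvg_cst|exact: cy].
have F'0 v : 0 < F' v by rewrite addr_gt0// divr_gt0.
have ln_ge v : 0 <= ln (1 + y v) by rewrite ln_ge0// lerDl ltW.
have cov t : exists n : nat, F (- n%:R) <= t <= F n%:R.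
  have [n hn] := archimedean_bound (`|t| + (2 * x)^-1); exists n.
  have x2i : 0 < (2 * x)^-1 by rewrite invr_gt0.
  have n0 : (0 : R) <= n%:R by rewrite ler0n.
  have := ler_norm t; have := ler_norm (- t); rewrite normrN => t1 t2.
  have l1 := ln_ge n%:R.
  have l2 : ln (1 + y (- n%:R)) <= (2 * x)^-1.
    rewrite -ler_expR lnK ?posrE// (le_trans _ (expR_ge1Dx _))// lerD2l.
    by rewrite /y ler_piMl ?(ltW x2i)// -expR0 ler_expR oppr_le0.
  by rewrite /F; apply/andP; split; lra.
have expF v : expR (F v) = expR v * (1 + y v) by rewrite expRD lnK ?posrE.
(* With y = exp v / (2 x), x (r^2 - 1) / 2 = exp v (1 + y) = exp (F v). In q = F v the integrand is
   thus a Gamma integrand translated by w; translating back yields exp ((nu + 1/2) w), which turns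
   exp (- w / 2) into exp (nu w). *)
have kE v w : k (v, w) = expR (- 2^-1 * w - x * ch w) * (expR (a * F v - expR (F v - w)) * F' v).
  have vy : expR v = 2 * x * y v by rewrite /y mulrC divfK// gt_eqF.
  have e1 : expR (a * F v) = expR (a * v) * pow1 (nu - 2^-1) (y v) * (1 + y v).
    rewrite /F mulrDr expRD -mulrA; congr (_ * _).
    have p1 := pow1D (nu - 2^-1) 1 (y v).
    by rewrite ha (pow1_1 (ltW (y0 v))) in p1; rewrite -p1.
  have e2 : expR (- 2^-1 * w - x / 2 * (expR w + r v ^+ 2 * expR (- w))) =
      expR (- 2^-1 * w - x * ch w) * expR (- expR (F v - w)).
    rewrite -expRD expRD [expR (F v - w)]expRD expF vy -[RHS]expRD; congr expR.
    by rewrite /ch /r; field.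
  rewrite /k [fst _]/= [snd _]/= e2 (expRD (a * F v)) e1 /m.
  have -> : F' v = r v / (1 + y v) by rewrite /F' /r; field; rewrite gt_eqF.
  by field; rewrite gt_eqF.
have cs w : continuous (fun q : R => expR (q - w)).
  by apply: continuous_expR_comp => t; apply: cvgB; [exact: cvg_id|exact: cvg_cst].
have cG w : continuous (fun q => expR (a * q - expR (q - w))).
  by apply: continuous_expR_comp => q; apply: cvgB; [exact: continuous_mull|exact: cs].
have cF v : {for v, continuous F} by exact: is_derive_continuous (dF v).
have rgamma : rintg mu (fun v => expR (a * v - expR v)).
  have [+ _] := lap_cintg (strip_gamma (a0 : 0 < Re (a%:C : R[i]))) (ltr01 : 0 < Re (1 : R[i])).
  by apply: eq_integrable => // v _; rewrite /comp gexp_integrand_real.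
have inner w : (\int[mu]_v (k (v, w))%:E =
    (expR (nu * w - x * ch w) * \int[mu]_v expR (a * v - expR v))%:E)%E.
  under eq_integral do rewrite kE.
  rewrite ge0_iintZ; first last.
  - exact: expR_ge0.
  - by move=> v; rewrite mulr_ge0 ?expR_ge0// ltW.
  - by move=> v; apply: cvgM; [exact: (continuous_comp (cF v) (cG w _))|exact: cF'].
  rewrite -(ge0_line_substitution dF cF' F'0 cov (cG w)) => [|q]; last exact: expR_ge0.
  rewrite (substitution_affine w ltr01 (cG w)).
  have E2 q : expR (a * (1 * q + w) - expR (1 * q + w - w)) * 1 = expR (a * w) * expR (a * q - expR q).
    by rewrite mulr1 mul1r addrK -expRD; congr expR; ring.
  under eq_integral do rewrite E2.
  have cg : continuous (fun q => expR (a * q - expR q)).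
    by apply: continuous_expR_comp => q; apply: cvgB; [exact: continuous_mull|exact: continuous_expR].
  rewrite (ge0_iintZ cg) => [|q|]; [|exact: expR_ge0|exact: expR_ge0].
  rewrite (Rintegral_EFin rgamma) -!EFinM mulrA -expRD; congr (expR _ * _)%:E.
  by rewrite /a; field.
under eq_integral do rewrite inner EFinM muleC -EFinM.
rewrite ge0_iintZ; first last.
- by apply: ltW; exact: gexp_real_gt0.
- by move=> w; exact: expR_ge0.
- exact: continuous_kappa_integrand.
by rewrite kappaE// -EFinM.
Qed.



End BesselIntegral.

(** * Enveloping remainders for K_nu and its derivative *)

Section BesselEnvelope.
Variable R : realType.
Local Notation mu := (@lebesgue_measure R).
Implicit Types (x y t a b c e u v w r nu : R).

Lemma bessel_aN m nu : bessel_a m (- nu) = bessel_a m nu.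
Proof. by rewrite /bessel_a sqrrN. Qed.

(** Each factor splits as 4 (nu - 1/2 - j) (nu + 1/2 + j): the first parts form a binomial
    coefficient, the second the rising factorial produced by a Gamma integral. *)
Lemma bessel_a_gbin m nu : bessel_a m nu =
  gbin (nu - 2^-1) m * (\prod_(0 <= j < m) (nu + 2^-1 + j%:R)) / 2 ^+ m.
Proof.
rewrite /bessel_a /gbin.
have -> : \prod_(1 <= k < m.+1) (4 * nu ^+ 2 - (2 * k%:R - 1) ^+ 2) =
    4 ^+ m * (\prod_(0 <= j < m) (nu - 2^-1 - j%:R) * \prod_(0 <= j < m) (nu + 2^-1 + j%:R)).
  elim: m => [|m IH]; first by rewrite !big_geq// expr0 !mul1r.
  rewrite !(big_nat_recr m)//= (big_nat_recr m.+1)//= IH [4 ^+ m.+1]exprS -[m.+1%:R]natr1.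
  move: (\prod_(_ <= _ < _) _) (\prod_(_ <= _ < _) _) (m%:R) (4 ^+ m) => A B C D.
  by field.
have f0 : m`!%:R != 0 :> R by rewrite pnatr_eq0 -lt0n fact_gt0.
have -> : 8 ^+ m = 4 ^+ m * 2 ^+ m :> R by rewrite -exprMn; congr (_ ^+ _); ring.
have p4 : 4 ^+ m != 0 :> R by rewrite expf_neq0.
have p2 : 2 ^+ m != 0 :> R by rewrite expf_neq0.
move: (\prod_(_ <= _ < _) _) (\prod_(_ <= _ < _) _) f0 p4 p2.
move: (m`!%:R) (4 ^+ m) (2 ^+ m) => f p q A B f0 p0 q0.
by field; rewrite f0 p0 q0.
Qed.

Definition rgamma a : R := \int[mu]_v expR (a * v - expR v).

Lemma rintg_rgamma a : 0 < a -> rintg mu (fun v => expR (a * v - expR v)).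
Proof.
move=> a0.
have [+ _] := lap_cintg (strip_gamma (a0 : 0 < Re (a%:C : R[i]))) (ltr01 : 0 < Re (1 : R[i])).
by apply: eq_integrable => // v _; rewrite /comp gexp_integrand_real.
Qed.

Lemma rgamma_gt0 a : 0 < a -> 0 < rgamma a. Proof. exact: gexp_real_gt0. Qed.

Lemma rgamma_rising a k : 0 < a -> rgamma (a + k%:R) = \prod_(0 <= j < k) (a + j%:R) * rgamma a.
Proof.
move=> a0; have := @gexp_rising R a%:C k a0.
have e : a%:C + k%:R = (a + k%:R)%:C :> R[i] by rewrite rmorphD rmorph_nat.
have -> : \prod_(0 <= j < k) (a%:C + j%:R) = (\prod_(0 <= j < k) (a + j%:R))%:C :> R[i].
  by rewrite rmorph_prod; apply: eq_bigr => j _; rewrite rmorphD rmorph_nat.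
rewrite e !gexp_real ?ltr_wpDr// -rmorphM.
by move/(@complexI R).
Qed.

Lemma Rintegral_sum (I : Type) (s : seq I) (f : I -> R -> R) :
  (forall i, rintg mu (f i)) ->
  rintg mu (fun v => \sum_(i <- s) f i v) /\
  \int[mu]_v (\sum_(i <- s) f i v) = \sum_(i <- s) \int[mu]_v f i v.
Proof.
move=> fi; elim: s => [|i s [IH1 IH2]].
  split; first by under eq_fun do rewrite big_nil; exact: integrable0.
  by under eq_Rintegral do rewrite big_nil; rewrite big_nil /Rintegral integral0.
split; first by under eq_fun do rewrite big_cons; exact: rintgD.
transitivity (\int[mu]_v (f i v + \sum_(j <- s) f j v)).
  by congr Rintegral; apply/funext => v; rewrite big_cons.
rewrite big_cons -IH2; apply: RintegralD => //; exact: fi.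
Qed.

Lemma laguerre_weight_ge0 nu x v : 0 <= laguerre_weight nu x v.
Proof. by rewrite mulr_ge0 ?expR_ge0. Qed.

(** Twice the leading factor of K_nu, in keeping with [kappa] being 2 K_nu. *)
Definition kappa_scale x : R := Num.sqrt (2 * pi / x) * expR (- x).

Lemma kappa_scale_gt0 x : 0 < x -> 0 < kappa_scale x.
Proof. by move=> x0; rewrite mulr_gt0 ?expR_gt0// sqrtr_gt0 divr_gt0// mulr_gt0// pi_gt0. Qed.

(** Integrability is read off from [kappa_laguerre]: an infinite integral, multiplied by a positive
    scale, could not equal a finite right side. *)
Lemma rintg_laguerre_weight nu x : 0 < x -> - 2^-1 < nu -> rintg mu (laguerre_weight nu x) /\
  kappa_scale x * \int[mu]_v laguerre_weight nu x v = rgamma (nu + 2^-1) * kappa nu x.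
Proof.
move=> x0 nu0; have := kappa_laguerre x0 nu0; rewrite -/(kappa_scale x) -/(rgamma _) => h.
have k0 := kappa_scale_gt0 x0.
have il : rintg mu (laguerre_weight nu x).
  apply/integrableP; split.
    apply/measurable_EFinP; apply: continuous_measurable_fun; exact: continuous_laguerre_weight.
  under eq_integral do rewrite /comp gee0_abs ?lee_fin ?laguerre_weight_ge0//.
  rewrite ltey; apply/eqP => hi; move: h; rewrite hi.
  by rewrite mulry gtr0_sg// mul1e.
split => //.
by move: h; rewrite (Rintegral_EFin il) -EFinM => -[].
Qed.

(** Dividing by the coefficient removes its sign. When the coefficient is 0, as happens for
    half-integer nu, the remainder vanishes too and any theta serves; 1/2 is taken. *)
Lemma ratio_between (t T c : R) : (if c == 0 then t = 0 else 0 < t / c < T) ->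
  exists2 th : R, 0 < th < 1 & t = c * T * th.
Proof.
case: ifPn => [/eqP -> ->|c0 /andP[h1 h2]].
  by exists 2^-1; [apply/andP; split; lra|rewrite !mul0r].
have T0 := lt_trans h1 h2; exists (t / c / T).
  by rewrite divr_gt0//= ltr_pdivrMr// mul1r.
by field; rewrite c0 gt_eqF.
Qed.

(** Integrate [bintail_bounds] against the Gamma weight. The normalised tail is pointwise strictly
    between 0 and the normalised first omitted term, whose integral is identified by
    [bessel_a_gbin]; strictness survives integration. *)
Lemma kappa_envelope_nonneg M nu x : 0 < x -> - 2^-1 < nu -> nu - 2^-1 < M%:R ->
  exists2 th : R, 0 < th < 1 &
  kappa nu x = kappa_scale x * (\sum_(0 <= m < M) bessel_a m nu / x ^+ m + bessel_a M nu / x ^+ M * th).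
Proof.
move=> x0 nu0 nuM; pose a := nu + 2^-1; have a0 : 0 < a by rewrite /a; lra.
have x20 : 0 < 2 * x by rewrite mulr_gt0.
have aj j : 0 < a + j%:R by rewrite ltr_wpDr.
pose c m := gbin (nu - 2^-1) m.
pose y v := expR v / (2 * x).
pose f m v := c m / (2 * x) ^+ m * expR ((a + m%:R) * v - expR v).
have fE m v : expR (a * v - expR v) * (c m * y v ^+ m) = f m v.
  rewrite /f /y expr_div_n.
  have -> : expR ((a + m%:R) * v - expR v) = expR (a * v - expR v) * expR v ^+ m.
    by rewrite -expRM_natl -expRD; congr expR; ring.
  ring.
have fi m : rintg mu (f m) by apply: rintgZ; exact: rintg_rgamma.
have fI m : \int[mu]_v f m v = bessel_a m nu / x ^+ m * rgamma a.
  rewrite (RintegralZl _ measurableT (rintg_rgamma (aj m))) -/(rgamma (a + m%:R)) rgamma_rising// bessel_a_gbin -/(c m) -/a exprMn.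
  move: (rgamma a) (\prod_(_ <= _ < _) _) (c m) => g A B.
  have h1 : 2 ^+ m != 0 :> R by rewrite expf_neq0.
  have h2 : x ^+ m != 0 :> R by rewrite expf_neq0// gt_eqF.
  by move: (2 ^+ m) (x ^+ m) h1 h2 => p q h1 h2; field; rewrite h1 h2.
have [il lE] := rintg_laguerre_weight x0 nu0.
have [si sE] := Rintegral_sum (index_iota 0 M) fi.
pose tail v := expR (a * v - expR v) * bintail (nu - 2^-1) M (y v).
have lagE v : laguerre_weight nu x v = \sum_(0 <= m < M) f m v + tail v.
  rewrite /tail /bintail mulrBr mulr_sumr.
  have -> : \sum_(0 <= m < M) f m v = \sum_(0 <= i < M) expR (a * v - expR v) * (gbin (nu - 2^-1) i * y v ^+ i).
    by apply: eq_bigr => m _; rewrite -fE.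
  by rewrite addrC subrK.
have ti : rintg mu tail.
  have := rintgB il si; congr (rintg _ _); apply/funext => v.
  by rewrite lagE addrAC subrr add0r.
have intE : \int[mu]_v laguerre_weight nu x v = \sum_(0 <= m < M) bessel_a m nu / x ^+ m * rgamma a + \int[mu]_v tail v.
  under eq_Rintegral do rewrite lagE.
  by rewrite RintegralD// sE; congr (_ + _); apply: eq_bigr => m _; exact: fI.
have yM v : expR (a * v - expR v) * y v ^+ M = (2 * x) ^- M * expR ((a + M%:R) * v - expR v).
  rewrite /y expr_div_n.
  have -> : expR ((a + M%:R) * v - expR v) = expR (a * v - expR v) * expR v ^+ M.
    by rewrite -expRM_natl -expRD; congr expR; ring.
  ring.
pose T := (2 * x) ^- M * rgamma (a + M%:R).
have bnd v := bintail_bounds nuM (divr_gt0 (expR_gt0 v) x20).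
have [th th01 thE] : exists2 th : R, 0 < th < 1 & \int[mu]_v tail v = c M * T * th.
  apply: ratio_between; rewrite /c; case: ifPn => [/eqP c0|c0].
    have -> : tail = fun=> 0.
      by apply/funext => v; have := bnd v; rewrite c0 eqxx /tail /y => ->; rewrite mulr0.
    by rewrite /Rintegral integral0.
  have t1 v : 0 < (gbin (nu - 2^-1) M)^-1 * tail v < expR (a * v - expR v) * y v ^+ M.
    have := bnd v; rewrite (negPf c0) -/(y v) => /andP[h1 h2].
    by rewrite /tail mulrCA [_^-1 * _]mulrC mulr_gt0 ?expR_gt0//= ltr_pM2l ?expR_gt0.
  have i1 := rintgZ (gbin (nu - 2^-1) M)^-1 ti.
  have i2 : rintg mu (fun v => expR (a * v - expR v) * y v ^+ M).
    under eq_fun do rewrite yM; apply: rintgZ; exact: rintg_rgamma.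
  have p1 := rintg_gt0 i1 (fun v => proj1 (andP (t1 v))) (lebesgue_setT_neq0 R).
  have t2 v : 0 < expR (a * v - expR v) * y v ^+ M - (gbin (nu - 2^-1) M)^-1 * tail v.
    by rewrite subr_gt0; case/andP: (t1 v).
  have p2 := rintg_gt0 (rintgB i2 i1) t2 (lebesgue_setT_neq0 R).
  have TE : \int[mu]_v (expR (a * v - expR v) * y v ^+ M) = T.
    under eq_Rintegral do rewrite yM.
    by rewrite RintegralZl//; exact: rintg_rgamma.
  rewrite RintegralB// TE RintegralZl// subr_gt0 in p2.
  rewrite RintegralZl// in p1.
  by rewrite mulrC p1 p2.
exists th => //.
have g0 := rgamma_gt0 a0.
apply: (mulfI (lt0r_neq0 g0)); rewrite -/a in lE; rewrite -lE intE thE -mulr_suml.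
have := fI M; rewrite /f RintegralZl//; last exact: rintg_rgamma.
rewrite -/(rgamma (a + M%:R)) => h.
have -> : c M * T = bessel_a M nu / x ^+ M * rgamma a by rewrite -h /T; ring.
ring.
Qed.

(** Evenness in nu of both sides reduces the claim to |nu|, which meets the one-sided conditions. *)
Lemma kappa_envelope M nu x : 0 < x -> `|nu| < M%:R + 2^-1 ->
  exists2 th : R, 0 < th < 1 &
  kappa nu x = kappa_scale x * (\sum_(0 <= m < M) bessel_a m nu / x ^+ m + bessel_a M nu / x ^+ M * th).
Proof.
move=> x0 nuM; have nn := normr_ge0 nu.
have [|th th01 E] := @kappa_envelope_nonneg M `|nu| x x0 (ltac:(lra)).
  by lra.
exists th => //; have [n0|n0] := leP 0 nu; first by rewrite ger0_norm in E.
move: E; rewrite ltr0_norm// kappaN// bessel_aN => ->.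
by congr (_ * (_ + _)); apply: eq_bigr => m _; rewrite bessel_aN.
Qed.

(** Raising nu by 1 slides both chains of linear factors by one step. All but two of the resulting
    factors are those of the product for nu up to m. *)
Lemma bessel_a_shift m nu : bessel_a m.+1 (nu + 1) =
  (\prod_(1 <= k < m.+1) (4 * nu ^+ 2 - (2 * k%:R - 1) ^+ 2)) *
  ((2 * nu + 2 * m.+1%:R - 1) * (2 * nu + 2 * m.+1%:R + 1)) / (m.+1`!%:R * 8 ^+ m.+1).
Proof.
rewrite /bessel_a; congr (_ / _).
elim: m => [|m IH].
  rewrite big_nat1 big_geq//; ring.
rewrite (big_nat_recr m.+2)//= IH [in RHS](big_nat_recr m.+1)//= -[m.+2%:R]natr1.
move: (\prod_(_ <= _ < _) _) (m.+1%:R) => A C; ring.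
Qed.

Definition kappa1 nu x : R := (kappa (nu + 1) x + kappa (nu - 1) x) / 2.

(** The coefficient form of - 2 K_nu' = K_(nu+1) + K_(nu-1). *)
Lemma bessel_bE m nu : bessel_b m nu = (bessel_a m (nu + 1) + bessel_a m (nu - 1)) / 2.
Proof.
case: m => [|m]; first by rewrite /bessel_b /bessel_a eqxx !big_geq// fact0 expr0 mulr1 !divr1; field.
have -> : nu - 1 = - (- nu + 1) by ring.
rewrite bessel_aN !bessel_a_shift sqrrN /bessel_b /=.
move: (\prod_(_ <= _ < _) _) (m.+1%:R) (m.+1`!%:R * 8 ^+ m.+1)^-1 => A C D; by field.
Qed.

(* [bessel_a M (nu + 1)] and [bessel_a M (nu - 1)] are positive multiples of a
   common factor, so a convex combination of the two remainders is a remainder. *)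
Lemma kappa1_envelope M nu x : (0 < M)%N -> 0 < x -> `|nu| < M%:R - 2^-1 ->
  exists2 th : R, 0 < th < 1 &
  kappa1 nu x = kappa_scale x * (\sum_(0 <= m < M) bessel_b m nu / x ^+ m + bessel_b M nu / x ^+ M * th).
Proof.
case: M => // M _ x0; rewrite ltr_norml => /andP[n1 n2].
have [|t1 /andP[t10 t11] E1] := @kappa_envelope M.+1 (nu + 1) x x0.
  by rewrite ltr_norml; apply/andP; split; lra.
have [|t2 /andP[t20 t21] E2] := @kappa_envelope M.+1 (nu - 1) x x0.
  by rewrite ltr_norml; apply/andP; split; lra.
(* The bound on nu has two effects: it places nu + 1 and nu - 1 in the range of [kappa_envelope],
   and it makes the weights P1 and P2 positive. The witness is the average of t1 and t2 with these
   weights. *)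
pose P1 := (2 * nu + 2 * M.+1%:R - 1) * (2 * nu + 2 * M.+1%:R + 1).
pose P2 := (2 * - nu + 2 * M.+1%:R - 1) * (2 * - nu + 2 * M.+1%:R + 1).
have P10 : 0 < P1 by apply: mulr_gt0; lra.
have P20 : 0 < P2 by apply: mulr_gt0; lra.
have a1 : exists C, bessel_a M.+1 (nu + 1) = C * P1 /\ bessel_a M.+1 (nu - 1) = C * P2.
  eexists; split; first by rewrite bessel_a_shift mulrAC.
  have -> : nu - 1 = - (- nu + 1) by ring.
  by rewrite bessel_aN bessel_a_shift sqrrN mulrAC.
have [C [C1 C2]] := a1.
exists ((P1 * t1 + P2 * t2) / (P1 + P2)).
  have P12 : 0 < P1 + P2 by apply: addr_gt0.
  apply/andP; split.
    by apply: divr_gt0 => //; apply: addr_gt0; apply: mulr_gt0.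
  rewrite ltr_pdivrMr// mul1r ltrD// -[ltRHS]mulr1 ltr_pM2l//.
rewrite /kappa1 E1 E2 bessel_bE C1 C2.
have -> : \sum_(0 <= m < M.+1) bessel_b m nu / x ^+ m =
   (\sum_(0 <= m < M.+1) bessel_a m (nu + 1) / x ^+ m + \sum_(0 <= m < M.+1) bessel_a m (nu - 1) / x ^+ m) / 2.
  rewrite -big_split/= mulr_suml; apply: eq_bigr => m _.
  by rewrite bessel_bE; field; rewrite expf_neq0// gt_eqF.
have P12 : P1 + P2 != 0 by rewrite gt_eqF// addr_gt0.
have xM : x ^+ M.+1 != 0 by rewrite expf_neq0// gt_eqF.
move: (\sum_(_ <= _ < _) _) (\sum_(_ <= _ < _) _) (x ^+ M.+1) (kappa_scale x) xM => A B X K xM.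
by field; rewrite P12 xM.
Qed.

End BesselEnvelope.

(** * Re-expansion of the remainder *)

Section Reexpansion.
Variable R : realType.
Local Notation leb := (@lebesgue_measure R).
Implicit Types (t a b e u v w : R) (z q s : R[i]).

(** The root of 2 is written as an exponential to match [cpow] of 2 in the prefactor. *)
Definition sqrt_2pi : R := expR (2^-1 * ln 2) * Num.sqrt pi.

Lemma sqrt_2pi_gt0 : 0 < sqrt_2pi.
Proof. by rewrite mulr_gt0 ?expR_gt0// sqrtr_gt0 pi_gt0. Qed.

Lemma kappa_scale_expR v : kappa_scale (expR v) = sqrt_2pi * (expR (- 2^-1 * v) * expR (- expR v)).
Proof.
rewrite /kappa_scale /sqrt_2pi mulrA; congr (_ * _).
have e1 : expR (2^-1 * ln 2) = Num.sqrt 2 :> R.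
  have h : expR (2^-1 * ln 2) ^+ 2 = 2 :> R.
    by rewrite -expRM_natl mulrA divff ?mul1r ?lnK// posrE.
  by rewrite -[in RHS]h sqrtr_sqr ger0_norm ?expR_ge0.
have e2 : expR (- 2^-1 * v) = Num.sqrt (expR v)^-1.
  have h : expR (- 2^-1 * v) ^+ 2 = (expR v)^-1 :> R.
    by rewrite -expRN -expRM_natl; congr expR; field.
  by rewrite -[in RHS]h sqrtr_sqr ger0_norm ?expR_ge0.
rewrite e1 e2 -!sqrtrM ?mulr_ge0 ?pi_ge0//.
Qed.

Variables (x : R) (k : R -> R) (c : nat -> R) (M : nat).
Hypothesis x0 : 0 < x.
Hypothesis ck : continuous (fun v => k (expR v)).
Hypothesis envelope : forall t, 0 < t -> exists2 th : R, 0 < th < 1 &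
  k t = kappa_scale t * (\sum_(0 <= m < M) c m / t ^+ m + c M / t ^+ M * th).

Definition termint_weight v : R := expR (- expR v) / (1 + expR v ^+ 2 / x ^+ 2).
Definition relative_tail v : R :=
  k (expR v) / kappa_scale (expR v) - \sum_(0 <= m < M) c m * expR (- (m%:R * v)).
Definition tail_weight v : R := termint_weight v * relative_tail v.
(** At s = 2 N - mu + 1/2 (or 3/2 for the derivative) this turns out to be the re-expansion
    remainder. Neither S nor the prefactor occurs in it and it is continuous for Re s > M, so it
    gives the value at an exceptional mu. *)
Definition tail_transform s : R[i] := cint leb (fun v => cex (s * v%:C) * (tail_weight v)%:C).

Let den_gt0 v : 0 < 1 + expR v ^+ 2 / x ^+ 2.
Proof. by rewrite ltr_pwDl// divr_ge0 ?sqr_ge0. Qed.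

Lemma termint_weight_gt0 v : 0 < termint_weight v.
Proof. by rewrite divr_gt0 ?expR_gt0. Qed.

Lemma termint_weight_le v : termint_weight v <= expR (- expR v).
Proof.
rewrite ler_pdivrMr// ler_peMr ?expR_ge0// lerDl divr_ge0 ?sqr_ge0//.
Qed.

(** Stated without theta: the theta of [envelope] depends on v in an unspecified way, so it cannot
    be carried under an integral. *)
Lemma relative_tail_bounds v :
  if c M == 0 then relative_tail v = 0 else 0 < relative_tail v / c M < expR (- (M%:R * v)).
Proof.
have [th /andP[t0 t1] E] := envelope (expR_gt0 v).
have k0 := kappa_scale_gt0 (expR_gt0 v).
have eM m : c m / expR v ^+ m = c m * expR (- (m%:R * v)).
  by rewrite expRN -expRM_natl.
have -> : relative_tail v = c M * expR (- (M%:R * v)) * th.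
  rewrite /relative_tail E mulrC mulKf ?gt_eqF// eM.
  have -> : \sum_(0 <= m < M) c m / expR v ^+ m = \sum_(0 <= m < M) c m * expR (- (m%:R * v)).
    by apply: eq_bigr => m _; exact: eM.
  by rewrite addrAC subrr add0r.
case: ifPn => [/eqP ->|c0]; first by rewrite !mul0r.
have -> : c M * expR (- (M%:R * v)) * th / c M = expR (- (M%:R * v)) * th by field.
by rewrite mulr_gt0 ?expR_gt0//= -[ltRHS]mulr1 ltr_pM2l ?expR_gt0.
Qed.

Lemma tail_weight_le v : `|tail_weight v| <= `|c M| * expR (- (M%:R * v) - expR v).
Proof.
rewrite normrM (gtr0_norm (termint_weight_gt0 v)) addrC expRD mulrCA.
apply: ler_pM; [exact: ltW (termint_weight_gt0 v)|exact: normr_ge0|exact: termint_weight_le|].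
have := relative_tail_bounds v; case: ifPn => [/eqP -> ->|c0 /andP[h1 h2]].
  by rewrite !normr0 mul0r.
have -> : relative_tail v = c M * (relative_tail v / c M) by field.
by rewrite normrM ler_wpM2l// gtr0_norm// ltW.
Qed.

Lemma continuous_termint_weight : continuous termint_weight.
Proof.
move=> v; apply: cvgM.
  apply: continuous_comp; last exact: continuous_expR.
  by apply: cvgN; exact: continuous_expR.
apply: cvgV; first by rewrite gt_eqF.
apply: cvgD; first exact: cvg_cst.
apply: cvgM; last exact: cvg_cst.
by rewrite expr2; apply: cvgM; exact: continuous_expR.
Qed.

Lemma continuous_tail_weight : continuous tail_weight.
Proof.
have ce a : continuous (fun v : R => expR (a * v)).
  by apply: continuous_expR_comp; exact: continuous_mull.
have cs : continuous (fun v : R => \sum_(0 <= m < M) c m * expR (- (m%:R * v))).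
  elim: M => [|n IH].
    by under eq_fun do rewrite big_geq//; move=> v; exact: cvg_cst.
  have -> : (fun v : R => \sum_(0 <= m < n.+1) c m * expR (- (m%:R * v))) =
      (fun v => \sum_(0 <= m < n) c m * expR (- (m%:R * v)) + c n * expR (- n%:R * v)).
    by apply/funext => v; rewrite big_nat_recr//= mulNr.
  move=> v; apply: cvgD; first exact: IH.
  by apply: cvgM; [exact: cvg_cst|exact: ce].
have cN : continuous (fun v : R => expR (- expR v)).
  by apply: continuous_expR_comp => v; apply: cvgN; exact: continuous_expR.
have ckp : continuous (fun v : R => kappa_scale (expR v)).
  have -> : (fun v : R => kappa_scale (expR v)) = (fun v => sqrt_2pi * (expR (- 2^-1 * v) * expR (- expR v))).
    by apply/funext => v; rewrite kappa_scale_expR.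
  move=> v; apply: cvgM; first exact: cvg_cst.
  by apply: cvgM; [exact: ce|exact: cN].
move=> v; apply: cvgM; first exact: continuous_termint_weight.
apply: cvgB; last exact: cs.
apply: cvgM; first exact: ck.
by apply: cvgV; [rewrite gt_eqF// kappa_scale_gt0 ?expR_gt0|exact: ckp].
Qed.

(** [lap] carries exp (- z v), so z = - s and Re s > M becomes y < - M. The bound is dictated by v
    -> -oo, where the majorant of the tail grows like exp (- M v). *)
Lemma strip_tail_weight : strip leb (id : R -> R) (fun v => (tail_weight v)%:C) [set y | y < - M%:R].
Proof.
split.
- by apply: ccont_meas; apply: ccont_real; exact: continuous_tail_weight.
- exact: measurable_id.
- move=> y; rewrite /mkset => yM; exists ((- M%:R - y) / 2); first by rewrite divr_gt0// subr_gt0.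
  by split; rewrite /mkset; lra.
move=> y; rewrite /mkset => yM.
have s0 : 0 < - y - M%:R by rewrite subr_gt0 ltrNr.
apply: (rintg_dom _ (rintgZ `|c M| (rintg_rgamma s0))).
  apply: measurable_funM.
    by apply: cmeas_cmod; apply: ccont_meas; apply: ccont_real; exact: continuous_tail_weight.
  apply: continuous_measurable_fun => v; apply: continuous_comp; last exact: continuous_expR.
  by apply: cvgN; exact: continuous_mull.
move=> v; rewrite normrM (ger0_norm (cmod_ge0 _)) (ger0_norm (expR_ge0 _)) cmod_real.
rewrite (le_trans (ler_wpM2r (expR_ge0 _) (tail_weight_le v)))// -mulrA -expRD.
by rewrite ler_wpM2l// ler_expR; lra.
Qed.

Lemma tail_transform_lap s : tail_transform s = lap leb (id : R -> R) (fun v => (tail_weight v)%:C) (- s).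
Proof. by apply: eq_cint => v; rewrite mulNr opprK mulrC. Qed.

Lemma tail_transform_cintg s : M%:R < Re s -> cintg leb (fun v => cex (s * v%:C) * (tail_weight v)%:C).
Proof.
move=> sM; have h : Re (- s) < - M%:R by rewrite ReN ltrN2.
have := lap_cintg strip_tail_weight h; congr (cintg _ _); apply/funext => v.
by rewrite mulNr opprK mulrC.
Qed.

Lemma tail_transform_lip s : M%:R < Re s -> exists (L d : R), 0 < d /\
  forall h, cmod h < d -> cmod (tail_transform (s + h) - tail_transform s) <= L * cmod h.
Proof.
move=> sM; have h0 : Re (- s) < - M%:R by rewrite ReN ltrN2.
have [d [d0 H]] := cdiff_lip (lap_cdiff strip_tail_weight h0).
move: H; set L := (_ + 1) => H; exists L, d; split => // h hd.
by have := H (- h); rewrite cmodN !tail_transform_lap opprD; apply.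
Qed.

Lemma termint_cintg s : 0 < Re s -> cintg leb (fun v => cex (s * v%:C) * (termint_weight v)%:C).
Proof.
move=> s0; apply: cintg_edom.
  apply: ccont_meas; apply: ccontM; first exact: ccont_cexM.
  by apply: ccont_real; exact: continuous_termint_weight.
apply: (@edom_gamma _ (Re s) 1 1) => // v.
rewrite cmodM cmod_cex cmod_real (gtr0_norm (termint_weight_gt0 v)) mul1r.
rewrite (le_trans (ler_wpM2l (expR_ge0 _) (termint_weight_le v)))// -expRD ler_expR !ReImE; lra.
Qed.

(** Replace k by its scale times partial sum plus relative tail. The scale brings exp (- v / 2),
    which accounts for the shift of s by 1/2, and exp (- exp v), which completes the kernel to the
    weight of [termint]. *)
Lemma reexpansion s : M%:R < Re s ->
  cintg leb (fun v => cex ((s + 2%:R^-1) * v%:C) * ((1 + expR v ^+ 2 / x ^+ 2)^-1)%:C * (k (expR v))%:C) /\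
  cint leb (fun v => cex ((s + 2%:R^-1) * v%:C) * ((1 + expR v ^+ 2 / x ^+ 2)^-1)%:C * (k (expR v))%:C) =
  sqrt_2pi%:C * (\sum_(0 <= m < M) (c m)%:C * termint (s - m%:R) x + tail_transform s).
Proof.
move=> sM; have s0 m : (m <= M)%N -> 0 < Re (s - m%:R).
  by move=> mM; rewrite ReB Re_nat subr_gt0 (le_lt_trans _ sM)// ler_nat.
(* Cut off at M because only for m <= M does s - m have positive real part, while [cint_sum] wants
   integrability for every index. *)
pose g m v := if (m < M)%N then (c m)%:C * (cex ((s - m%:R) * v%:C) * (termint_weight v)%:C) else 0.
have gi m : cintg leb (g m).
  rewrite /g; have [mM|_] := ltnP m M; first by apply/cintgZ/termint_cintg/s0/ltnW.
  by have := cintgZ 0 (tail_transform_cintg sM); congr (cintg _ _); apply/funext => v; rewrite mul0r.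
have iP := tail_transform_cintg sM.
have gs := cintg_sum (index_iota 0 M) gi.
have -> : \sum_(0 <= m < M) (c m)%:C * termint (s - m%:R) x =
    \sum_(0 <= m < M) cint leb (g m).
  rewrite big_nat [RHS]big_nat; apply: eq_bigr => m /andP[_ mM].
  by rewrite /termint -(cintZ _ (termint_cintg (s0 _ (ltnW mM)))) /g mM.
rewrite -(cint_sum _ gi) /tail_transform -(cintD gs iP) -(cintZ _ (cintgD gs iP)).
have half : (2^-1 : R)%:C = 2%:R^-1 by rewrite fmorphV rmorph_nat.
have pt v : cex ((s + 2%:R^-1) * v%:C) * ((1 + expR v ^+ 2 / x ^+ 2)^-1)%:C * (k (expR v))%:C =
    sqrt_2pi%:C * (\sum_(0 <= m < M) g m v + cex (s * v%:C) * (tail_weight v)%:C).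
  have -> : \sum_(0 <= m < M) g m v =
     cex (s * v%:C) * (termint_weight v)%:C * (\sum_(0 <= m < M) c m * expR (- (m%:R * v)))%:C.
    have -> : (\sum_(0 <= m < M) c m * expR (- (m%:R * v)))%:C =
        \sum_(0 <= m < M) ((c m)%:C * (expR (- (m%:R * v)))%:C) :> R[i].
      by rewrite rmorph_sum; apply: eq_bigr => m _; exact: rmorphM.
    rewrite mulr_sumr big_nat [RHS]big_nat; apply: eq_bigr => m /andP[_ mM].
    rewrite /g mM mulrBl cexD; have -> : - (m%:R * v%:C) = (- (m%:R * v))%:C :> R[i].
      by rewrite rmorphN rmorphM rmorph_nat.
    by rewrite cex_real; ring.
  have -> : cex ((s + 2%:R^-1) * v%:C) = cex (s * v%:C) * (expR (2^-1 * v))%:C.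
    by rewrite mulrDl cexD -half -rmorphM cex_real.
  have -> : cex (s * v%:C) * (termint_weight v)%:C * (\sum_(0 <= m < M) c m * expR (- (m%:R * v)))%:C +
      cex (s * v%:C) * (tail_weight v)%:C = cex (s * v%:C) * (termint_weight v * (k (expR v) / kappa_scale (expR v)))%:C.
    rewrite -mulrA -rmorphM -mulrDr -rmorphD; congr (_ * _%:C).
    by rewrite /tail_weight /relative_tail mulrBr addrC subrK.
  have rf : expR (2^-1 * v) * (1 + expR v ^+ 2 / x ^+ 2)^-1 * k (expR v) =
      sqrt_2pi * (termint_weight v * (k (expR v) / kappa_scale (expR v))).
    have e : expR (- 2^-1 * v) = (expR (2^-1 * v))^-1 by rewrite mulNr expRN.
    rewrite kappa_scale_expR e /termint_weight.
    have := den_gt0 v; move: (1 + expR v ^+ 2 / x ^+ 2) (k (expR v)) => d kv d0.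
    have := expR_gt0 (2^-1 * v); have := expR_gt0 (- expR v); have := sqrt_2pi_gt0.
    move: (expR (2^-1 * v)) (expR (- expR v)) (sqrt_2pi) => A B C A0 B0 C0.
    by field; rewrite !gt_eqF.
  rewrite [RHS]mulrCA -rmorphM -rf -!mulrA; congr (_ * _).
  by rewrite -!rmorphM mulrA.
split; last by apply: eq_cint => v; exact: pt.
by have := cintgZ sqrt_2pi%:C (cintgD gs iP); congr (cintg _ _); apply/funext => v; rewrite pt.
Qed.

Lemma tail_transform_theta a : M%:R < a -> exists Theta : R, 0 < Theta < 1 /\
  tail_transform a%:C = (c M)%:C * termint (a%:C - M%:R) x * Theta%:C.
Proof.
move=> aM; have iP := tail_transform_cintg (aM : M%:R < Re a%:C).
have a0 : 0 < Re (a%:C - M%:R : R[i]) by rewrite ReB Re_nat subr_gt0.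
have iT := termint_cintg a0.
have e1 v : cex (a%:C * v%:C) * (tail_weight v)%:C = (expR (a * v) * tail_weight v)%:C.
  by rewrite -rmorphM cex_real -rmorphM.
have e2 v : cex ((a%:C - M%:R) * v%:C) * (termint_weight v)%:C = (expR ((a - M%:R) * v) * termint_weight v)%:C.
  have -> : a%:C - M%:R = (a - M%:R)%:C :> R[i] by rewrite rmorphB rmorph_nat.
  by rewrite -rmorphM cex_real -rmorphM.
have r1 : rintg leb (fun v => expR (a * v) * tail_weight v).
  by have [+ _] := iP; under eq_fun do rewrite e1.
have r2 : rintg leb (fun v => expR ((a - M%:R) * v) * termint_weight v).
  by have [+ _] := iT; under eq_fun do rewrite e2.
have PE : tail_transform a%:C = (\int[leb]_v (expR (a * v) * tail_weight v))%:C.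
  by rewrite -cint_real; apply: eq_cint => v; exact: e1.
have TE : termint (a%:C - M%:R) x = (\int[leb]_v (expR ((a - M%:R) * v) * termint_weight v))%:C.
  by rewrite -cint_real; apply: eq_cint => v; exact: e2.
have [th th01 E] : exists2 th : R, 0 < th < 1 &
    \int[leb]_v (expR (a * v) * tail_weight v) = c M * (\int[leb]_v (expR ((a - M%:R) * v) * termint_weight v)) * th.
  apply: ratio_between; case: ifPn => [/eqP c0|c0].
    have -> : (fun v => expR (a * v) * tail_weight v) = fun=> 0.
      by apply/funext => v; have := relative_tail_bounds v; rewrite /tail_weight c0 eqxx => ->; rewrite !mulr0.
    by rewrite /Rintegral integral0.
  have t1 v : 0 < (c M)^-1 * (expR (a * v) * tail_weight v) < expR ((a - M%:R) * v) * termint_weight v.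
    have := relative_tail_bounds v; rewrite (negPf c0) => /andP[h1 h2].
    have -> : (c M)^-1 * (expR (a * v) * tail_weight v) = expR (a * v) * termint_weight v * (relative_tail v / c M).
      by rewrite /tail_weight; ring.
    have -> : expR ((a - M%:R) * v) * termint_weight v = expR (a * v) * termint_weight v * expR (- (M%:R * v)).
      by rewrite mulrBl expRD; ring.
    have q : 0 < expR (a * v) * termint_weight v by rewrite mulr_gt0 ?expR_gt0 ?termint_weight_gt0.
    by rewrite mulr_gt0//= ltr_pM2l.
  have i1 := rintgZ (c M)^-1 r1.
  have p1 := rintg_gt0 i1 (fun v => proj1 (andP (t1 v))) (lebesgue_setT_neq0 R).
  have t2 v : 0 < expR ((a - M%:R) * v) * termint_weight v - (c M)^-1 * (expR (a * v) * tail_weight v).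
    by rewrite subr_gt0; case/andP: (t1 v).
  have p2 := rintg_gt0 (rintgB r2 i1) t2 (lebesgue_setT_neq0 R).
  rewrite (RintegralB measurableT r2 i1) (RintegralZl _ measurableT r1) subr_gt0 in p2.
  rewrite (RintegralZl _ measurableT r1) in p1.
  by rewrite mulrC p1 p2.
by exists th; split => //; rewrite PE TE E !rmorphM.
Qed.

End Reexpansion.

(** * Prefactor and first-level remainders in terms of F and H *)

Section RemainderIntegral.
Variable R : realType.
Local Notation leb := (@lebesgue_measure R).
Implicit Types (t a b e u v w nu x : R) (z s p mu : R[i]).

(** The first omitted term of the asymptotic series is a multiple of z^(- p) for this p. *)
Definition lommel_exponent N mu : R[i] := 1 - (mu - (2 * N)%:R).

Lemma Re_half p : Re (p / 2%:R) = Re p / 2.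
Proof.
have -> : (2%:R^-1 : R[i]) = (2^-1)%:C by rewrite fmorphV rmorph_nat.
by rewrite Re_mul Re_real Im_real mulr0 subr0.
Qed.

Lemma lommel_exponent_half_gt0 p nu : `|nu| < Re p ->
  0 < Re ((p + nu%:C) / 2%:R) /\ 0 < Re ((p - nu%:C) / 2%:R).
Proof.
rewrite ltr_norml => /andP[n1 n2].
by rewrite !Re_half ReD ReB Re_real !divr_gt0//; lra.
Qed.

(** Each pair of factors is a difference of squares, ((- mu + 2 j + 1)^2 - s^2) / 4. *)
Lemma rising_lommel_a N mu s : 
  (\prod_(0 <= j < N) ((- mu + s + 1) / 2%:R + j%:R)) *
  (\prod_(0 <= j < N) ((- mu - s + 1) / 2%:R + j%:R)) = lommel_a N (- mu) s / 4%:R ^+ N.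
Proof.
rewrite /lommel_a; elim: N => [|N IH]; first by rewrite !big_geq// expr0 divr1 mul1r.
rewrite (big_nat_recr N)//= (big_nat_recr N _ (fun j => (- mu - s + 1) / 2%:R + j%:R))//=.
rewrite (big_nat_recr N.+1)//= mulrACA IH [4%:R ^+ N.+1]exprS invfM -[N.+1%:R]natr1.
have : 4%:R ^+ N != 0 :> R[i] by rewrite expf_neq0// pnatr_eq0.
move: (\prod_(_ <= _ < _) _) (4%:R ^+ N) (N%:R) => A B C B0.
by field.
Qed.

(** Shift both Gamma factors N times: the rising factorials combine to a_N and the shifted Gammas to
    a power of 2 times H 1. Hence the prefactor carries the same quotient a_N / H 1 as the
    remainder. *)
Lemma prefactorE N mu nu : `|nu| < Re (lommel_exponent N mu) ->
  prefactor mu nu%:C = (sqrt_2pi R)%:C * lommel_a N (- mu) nu%:C / lomH (lommel_exponent N mu) nu 1.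
Proof.
move=> nup; set p := lommel_exponent N mu in nup *.
have [g1 g2] := lommel_exponent_half_gt0 nup.
have e1 : (- mu + nu%:C + 1) / 2%:R + N%:R = (p + nu%:C) / 2%:R by rewrite /p /lommel_exponent natrM; field.
have e2 : (- mu - nu%:C + 1) / 2%:R + N%:R = (p - nu%:C) / 2%:R by rewrite /p /lommel_exponent natrM; field.
have r1 : 0 < Re ((- mu + nu%:C + 1) / 2%:R) + N%:R by rewrite -(Re_nat R N) -ReD e1.
have r2 : 0 < Re ((- mu - nu%:C + 1) / 2%:R) + N%:R by rewrite -(Re_nat R N) -ReD e2.
rewrite /prefactor (gammaE r1) (gammaE r2) e1 e2 mulrACA -invfM rising_lommel_a.
rewrite [gexp _ 1 * _]mulrC gexp_product1//.
have t0 : 0 < Re (2%:R : R[i]) by rewrite Re_nat ltr0n.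
have -> : cpow 2%:R (1 - p) = cpow 2%:R mu / 4%:R ^+ N.
  have -> : 1 - p = mu - (2 * N)%:R by rewrite /p /lommel_exponent; ring.
  by rewrite cpowB cpow_nat// exprM; congr (_ / _ ^+ _); ring.
rewrite cpowD.
have c0 := cpow_neq0 2%:R mu.
have p0 : 4%:R ^+ N != 0 :> R[i] by rewrite expf_neq0// pnatr_eq0.
rewrite -(mulrA (cpow 2%:R mu)).
have -> : cpow 2%:R 2%:R^-1 * (Num.sqrt pi)%:C = (sqrt_2pi R)%:C :> R[i].
  have -> : 2%:R = 2%:C :> R[i] by rewrite rmorph_nat.
  by rewrite -fmorphV cpow_real// -rmorphM.
(* L stands for a_N, which may be 0. Only A and B are cancelled; the other inversions are valid with
   0^-1 = 0. *)
have gen (A B H L K : R[i]) : A != 0 -> B != 0 -> A * K / (A / B * H / (L / B)) = K * L / H.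
  move=> A0 B0; have -> : (A / B * H / (L / B))^-1 = A^-1 * B * H^-1 * (L / B).
    by rewrite !invfM !invrK.
  by move: (H^-1) => h; field; rewrite A0 B0.
exact: gen.
Qed.

Variables (S : R[i] -> R[i] -> R[i] -> R[i]).
Hypothesis HS : forall mu nu : R[i], is_lommel mu nu (S mu nu).
Variables (N : nat) (x nu : R).
Hypothesis x0 : 0 < x.

Let xC : 0 < Re (x%:C : R[i]). Proof. by []. Qed.
Let xn0 : x%:C != 0 :> R[i]. Proof. by rewrite (inj_eq (@complexI R)) gt_eqF. Qed.

Lemma lommel_remE mu : `|nu| < Re (lommel_exponent N mu) -> lomH (lommel_exponent N mu) nu 1 != 0 ->
  lommel_rem S N x%:C mu nu%:C = (-1) ^+ N * lommel_a N (- mu) nu%:C / lomH (lommel_exponent N mu) nu 1 *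
    lomF (lommel_exponent N mu) nu x%:C / cpow x%:C (mu - 1).
Proof.
move=> nup H0; rewrite /lommel_rem; have [-> _] := lommel_representation nup H0 (HS mu nu%:C) x0.
rewrite /lomW mulrDl addrAC -[RHS]add0r; congr (_ + _).
apply/eqP; rewrite subr_eq0 mulr_suml; apply/eqP; apply: eq_bigr => n _.
rewrite (cpowB _ (mu - 1)) (cpow_nat _ xC).
have c0 := cpow_neq0 x%:C (mu - 1).
by field; rewrite c0 expf_neq0.
Qed.

Lemma lommel_remE' mu : `|nu| < Re (lommel_exponent N mu) -> lomH (lommel_exponent N mu) nu 1 != 0 ->
  lommel_rem' S N x%:C mu nu%:C = (-1) ^+ N * lommel_a N (- mu) nu%:C / lomH (lommel_exponent N mu) nu 1 *
    lomF1 (lommel_exponent N mu) nu x%:C / cpow x%:C (mu - 2%:R).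
Proof.
move=> nup H0; have [_ E] := lommel_representation nup H0 (HS mu nu%:C) x0.
rewrite /lommel_rem' E /lomW1 mulrDl addrAC -[RHS]add0r; congr (_ + _).
apply/eqP; rewrite subr_eq0 mulr_suml; apply/eqP; apply: eq_bigr => n _.
have -> : mu - 1 - (2 * n)%:R - 1 = mu - 2%:R - (2 * n)%:R by ring.
(* The factor in [lommel_b n (- mu)] is - (- mu + 2 n + 1) = mu - 1 - 2 n, the exponent brought down
   by differentiating the n-th term. *)
rewrite (cpowB _ (mu - 2%:R)) (cpow_nat _ xC) /lommel_b [(2 * n)%:R]natrM.
have c0 := cpow_neq0 x%:C (mu - 2%:R).
have h : x%:C ^+ (2 * n) != 0 by rewrite expf_neq0.
move: (x%:C ^+ (2 * n)) h (cpow x%:C (mu - 2%:R)) c0 ((-1) ^+ n) (lommel_a n (- mu) nu%:C) (n%:R) => X X0 Y Y0 A B C.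
by field; rewrite X0 Y0.
Qed.

Let wgt v := ((1 + expR v ^+ 2 / x ^+ 2)^-1)%:C : R[i].

Lemma lomF_real p : `|nu| < Re p -> lomF p nu x%:C = cpow x%:C (- p) *
  cint leb (fun v => cex (p * v%:C) * wgt v * (kappa nu (expR v))%:C).
Proof.
move=> nup; have := lap_phi_real x0 (strip_ch nu) (lap_cintg (strip_weightF nup) xC).
move=> E; rewrite [LHS]E; congr (_ * _); apply: eq_cint => v.
by rewrite (kappa_lap nu (expR_gt0 v)).
Qed.

Lemma kappa1_lap t : 0 < t ->
  lap leb (@ch R) (fun u => - (ch u)%:C * (expR (nu * u))%:C) t%:C = (- kappa1 nu t)%:C.
Proof.
move=> t0; have tC : 0 < Re (t%:C : R[i]) by [].
have i1 := lap_cintg (strip_ch (nu + 1)) tC; have i2 := lap_cintg (strip_ch (nu - 1)) tC.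
have -> : (- kappa1 nu t)%:C = (- 2^-1)%:C * ((kappa (nu + 1) t)%:C + (kappa (nu - 1) t)%:C) :> R[i].
  by rewrite -rmorphD -rmorphM; congr (_%:C); rewrite /kappa1; field.
rewrite -!kappa_lap// /lap -(cintD i1 i2) -(cintZ _ (cintgD i1 i2)); apply: eq_cint => u.
rewrite -mulrDl [RHS]mulrA -rmorphD -!rmorphM -rmorphN -rmorphM; congr (_%:C * _).
have -> : expR ((nu + 1) * u) = expR (nu * u) * expR u by rewrite -expRD; congr expR; ring.
have -> : expR ((nu - 1) * u) = expR (nu * u) * expR (- u) by rewrite -expRD; congr expR; ring.
by rewrite /ch; field.
Qed.

(** Differentiation brings down - exp v cosh u: exp v raises p to p + 1, and - cosh u turns K_nu
    into K_nu'. *)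
Lemma lomF1_real p : `|nu| < Re p -> lomF1 p nu x%:C = cpow x%:C (- (p + 1)) *
  cint leb (fun v => cex ((p + 1) * v%:C) * wgt v * (- kappa1 nu (expR v))%:C).
Proof.
move=> nup; pose h (u : R) : R[i] := - (ch u)%:C * (expR (nu * u))%:C.
have sh := strip_mul (strip_ch nu).
have E (q : R * R) : - (phi q)%:C * weightF p nu q * cex (- (x%:C * (phi q)%:C)) =
   cex ((p + 1) * q.1%:C) * (damp q.1)%:C * h q.2 * cex (- (x%:C * (phi q)%:C)).
  congr (_ * _); rewrite /h /weightF /phi mulrDl cexD mul1r cex_real [(expR q.1 * ch q.2)%:C]rmorphM; ring.
have ci : cintg (leb \x leb)%E (fun q => cex ((p + 1) * q.1%:C) * (damp q.1)%:C * h q.2 * cex (- (x%:C * (phi q)%:C))).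
  have := lap_cintg (strip_mul (strip_weightF nup)) xC; congr (cintg _ _).
  by apply/funext => q; exact: E.
have F := lap_phi_real x0 sh ci.
transitivity (cint (leb \x leb)%E (fun q => cex ((p + 1) * q.1%:C) * (damp q.1)%:C * h q.2 * cex (- (x%:C * (phi q)%:C)))).
  by apply: eq_cint => q; exact: E.
rewrite F; congr (_ * _); apply: eq_cint => v.
by rewrite (kappa1_lap (expR_gt0 v)).
Qed.

End RemainderIntegral.

(** * Cancellation of the prefactor, and admissible neighbourhoods of mu *)

Section Assembly.
Variable R : realType.
Local Notation leb := (@lebesgue_measure R).
Implicit Types (t a b d e u v w nu x : R) (z s q p mu : R[i]).

(** The cancellation of a_N / H 1 between remainder and prefactor. It needs a_N != 0, which is why
    exceptional mu are reached only by a limit. *)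
Lemma rem_algebra (F : fieldType) (sg aN H c X K T : F) : sg != 0 -> aN != 0 -> H != 0 ->
  c != 0 -> X != 0 -> K != 0 ->
  (sg * aN / H * (c / X * (K * T)) / c) / (sg * (K * aN / H) / X) = T.
Proof. by move=> h1 h2 h3 h4 h5 h6; field; rewrite h1 h2 h3 h4 h5 h6. Qed.

(** As a function of q this is a Laplace transform with the identity as phase, hence continuous; at
    real a it is the integral of a positive function. *)
Lemma gexp_near a : 0 < a -> exists2 d : R, 0 < d &
  forall q, cmod (q - a%:C) < d -> gexp q 1 != 0.
Proof.
move=> a0; pose h v : R[i] := cex (- (1 * (expR v)%:C)).
have ch : ccont h.
  by apply: ccont_cex; apply: ccontN; apply: ccontM; [exact: ccont_cst|exact: ccont_expR].
have hs : strip leb (id : R -> R) h [set y | y < 0].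
  split.
  - exact: ccont_meas.
  - exact: measurable_id.
  - move=> y; rewrite /mkset => y0; exists (- y / 2); first by rewrite divr_gt0// oppr_gt0.
    by split; rewrite /mkset; lra.
  move=> y; rewrite /mkset => y0.
  have y0' : 0 < - y by rewrite oppr_gt0.
  have := rintg_rgamma y0'; congr (rintg _ _); apply/funext => v.
  by rewrite cmod_cex -expRD !ReImE; congr expR; ring.
have E q : gexp q 1 = lap leb (id : R -> R) h (- q).
  by apply: eq_cint => v; rewrite mulNr opprK mulrC.
have a0' : Re (- a%:C) < 0 by rewrite ReN Re_real oppr_lt0.
have [d [d0]] := cdiff_lip (lap_cdiff hs a0'); set L := (_ + 1) => H.
have L0 : 0 < L by rewrite ltr_wpDl ?cmod_ge0.
have g0 := gexp_real_gt0 a0; set g := (\int[leb]_v _) in g0.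
have ga : gexp a%:C 1 = g%:C by exact: gexp_real.
exists (Num.min d (g / L)); first by rewrite lt_min d0 divr_gt0.
move=> q; rewrite lt_min => /andP[h1 h2]; apply/eqP => q0.
have := H (a%:C - q); rewrite -cmodN opprB => /(_ h1).
rewrite addrA addNr add0r -!E q0 ga add0r cmodN cmod_real gtr0_norm//.
by rewrite leNgt mulrC -ltr_pdivlMr// h2.
Qed.

Lemma root_near (r mu : R[i]) : exists2 d : R, 0 < d &
  forall mu', mu' != mu -> cmod (mu' - mu) < d -> mu' != r.
Proof.
have [->|rmu] := eqVneq r mu; first by exists 1.
exists (cmod (r - mu)); first by rewrite cmod_gt0 subr_eq0.
by move=> mu' _; apply: contraTneq => ->; rewrite ltxx.
Qed.

(** A product of finitely many linear factors in mu'. The centre may be a root, so only punctured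
    discs are claimed. *)
Lemma lommel_a_near N mu s : exists2 d : R, 0 < d &
  forall mu', mu' != mu -> cmod (mu' - mu) < d -> lommel_a N (- mu') s != 0.
Proof.
elim: N => [|N [d d0 IH]].
  by exists 1 => // mu' _ _; rewrite /lommel_a big_geq// oner_neq0.
have [d1 d10 H1] := root_near (2%:R * N.+1%:R - 1 - s) mu.
have [d2 d20 H2] := root_near (2%:R * N.+1%:R - 1 + s) mu.
exists (Num.min d (Num.min d1 d2)); first by rewrite !lt_min d0 d10.
move=> mu' ne; rewrite !lt_min => /and3P[h h1 h2].
rewrite /lommel_a big_nat_recr//= mulf_neq0//; first exact: IH.
rewrite subr_sqr mulf_neq0//.
  have := H1 mu' ne h1; apply: contraNneq => /eqP; rewrite -subr_eq0 => e.
  by rewrite -subr_eq0 -oppr_eq0; apply: etrans e; congr (_ == 0); ring.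
have := H2 mu' ne h2; apply: contraNneq => /eqP; rewrite -subr_eq0 => e.
by rewrite -subr_eq0 -oppr_eq0; apply: etrans e; congr (_ == 0); ring.
Qed.

Lemma nonexceptional_lommel_a N mu s : ~ exceptional mu s -> lommel_a N (- mu) s != 0.
Proof.
move=> ex; rewrite /lommel_a prodf_seq_neq0; apply/allP => -[|k].
  by rewrite mem_index_iota.
move=> _; apply/implyP => _; rewrite subr_sqr mulf_neq0//; apply/eqP => e; apply: ex; exists k.
  left; apply/eqP; rewrite -subr_eq0 -oppr_eq0 -e natrD natrM -[k.+1%:R]natr1; apply/eqP; ring.
right; apply/eqP; rewrite -subr_eq0 -oppr_eq0 -e natrD natrM -[k.+1%:R]natr1; apply/eqP; ring.
Qed.

(** H 1 is nonzero because, by [gexp_product1], it divides a product of two Gamma integrals that are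
    positive at the real centre; the remaining conditions are open. *)
Lemma lomH_near N (mu0 nu b : R) : mu0 < b -> `|nu| < Re (lommel_exponent N mu0%:C) -> exists2 d : R, 0 < d &
  forall mu, cmod (mu - mu0%:C) < d ->
  [/\ Re mu < b, `|nu| < Re (lommel_exponent N mu), lomH (lommel_exponent N mu) nu 1 != 0 &
     mu != mu0%:C -> lommel_a N (- mu) nu%:C != 0].
Proof.
move=> mb nup.
have RepN mu : Re (lommel_exponent N mu) = 1 - Re mu + (2 * N)%:R.
  by rewrite /lommel_exponent !(ReB, Re1, Re_nat); ring.
have [g1 g2] := lommel_exponent_half_gt0 nup.
have E1 mu : (lommel_exponent N mu + nu%:C) / 2%:R - (Re ((lommel_exponent N mu0%:C + nu%:C) / 2%:R))%:C = - ((mu - mu0%:C) / 2%:R).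
  rewrite Re_half ReD RepN !Re_real rmorphM fmorphV !rmorphD rmorphN rmorph1 !rmorph_nat /lommel_exponent.
  by field.
have E2 mu : (lommel_exponent N mu - nu%:C) / 2%:R - (Re ((lommel_exponent N mu0%:C - nu%:C) / 2%:R))%:C = - ((mu - mu0%:C) / 2%:R).
  rewrite Re_half ReB RepN !Re_real rmorphM fmorphV !rmorphD !rmorphN rmorph1 !rmorph_nat /lommel_exponent.
  by field.
have [d1 d10 H1] := gexp_near g1; have [d2 d20 H2] := gexp_near g2.
have [d3 d30 H3] := lommel_a_near N mu0%:C nu%:C.
exists (Num.min (Num.min d1 d2) (Num.min d3 (Num.min (b - mu0) (Re (lommel_exponent N mu0%:C) - `|nu|)))).
  by rewrite !lt_min d10 d20 d30 !subr_gt0 mb nup.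
move=> mu; rewrite !lt_min => /andP[/andP[h1 h2] /and3P[h3 h4 h5]].
have Rd := Re_cmod (mu - mu0%:C); rewrite ReB Re_real in Rd.
have [Rd1 Rd2] := (ler_norm (Re mu - mu0), Rd).
have nup' : `|nu| < Re (lommel_exponent N mu) by move: h5; rewrite !RepN Re_real; lra.
have half : cmod ((mu - mu0%:C) / 2%:R) <= cmod (mu - mu0%:C).
  have -> : (2%:R^-1 : R[i]) = (2^-1)%:C by rewrite fmorphV rmorph_nat.
  rewrite cmodM cmod_real ger0_norm ?invr_ge0// ler_piMr ?cmod_ge0//; lra.
split => //; first lra; last by move=> ne; exact: H3.
have q1 := H1 ((lommel_exponent N mu + nu%:C) / 2%:R); rewrite E1 cmodN in q1.
have q2 := H2 ((lommel_exponent N mu - nu%:C) / 2%:R); rewrite E2 cmodN in q2.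
have := mulf_neq0 (q2 (le_lt_trans half h2)) (q1 (le_lt_trans half h1)).
by rewrite gexp_product1//; apply: contraNneq => ->; rewrite mulr0.
Qed.

Lemma bessel_a_real m nu : bessel_a m nu%:C = (bessel_a m nu)%:C :> R[i].
Proof.
rewrite /bessel_a rmorphM fmorphV rmorphM rmorphXn !rmorph_nat rmorph_prod; congr (_ / _).
by apply: eq_bigr => k _; rewrite !(rmorphB, rmorphM, rmorphXn, rmorph_nat, rmorph1).
Qed.

Lemma bessel_b_real m nu : bessel_b m nu%:C = (bessel_b m nu)%:C :> R[i].
Proof.
rewrite /bessel_b; case: ifPn => _; first by rewrite rmorph1.
rewrite !rmorphM fmorphV rmorphM rmorphXn !rmorph_nat rmorph_prod; congr (_ * _ / _).
  by apply: eq_bigr => k _; rewrite !(rmorphB, rmorphM, rmorphXn, rmorph_nat, rmorph1).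
by rewrite !(rmorphB, rmorphD, rmorphM, rmorphXn, rmorph_nat, rmorph1).
Qed.

Lemma continuous_kappa nu : continuous (fun v : R => kappa nu (expR v)).
Proof.
have [+ _] : ccont (fun v : R => (kappa nu (expR v))%:C).
  have -> : (fun v : R => (kappa nu (expR v))%:C) =
      (fun v => lap leb (@ch R) (fun u => (expR (nu * u))%:C) (expR v)%:C).
    by apply/funext => v; rewrite kappa_lap ?expR_gt0.
  apply: (@ccont_cdiff _ (lap leb (@ch R) (fun u => (expR (nu * u))%:C)) (fun v => (expR v)%:C)).
    by move=> v; eexists; apply: (lap_cdiff (strip_ch nu)); rewrite /mkset Re_real expR_gt0.
  exact: ccont_expR.
by under eq_fun do rewrite Re_real.
Qed.

Lemma continuous_kappa1 nu : continuous (fun v : R => kappa1 nu (expR v)).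
Proof.
move=> v; apply: cvgM; last exact: cvg_cst.
by apply: cvgD; exact: continuous_kappa.
Qed.

Variables (S : R[i] -> R[i] -> R[i] -> R[i]).
Hypothesis HS : forall mu nu : R[i], is_lommel mu nu (S mu nu).
Variables (N M : nat) (x nu : R).
Hypothesis x0 : 0 < x.

Let xC : 0 < Re (x%:C : R[i]). Proof. by []. Qed.
Let xN0 : x%:C ^+ (2 * N) != 0 :> R[i].
Proof. by rewrite expf_neq0// (inj_eq (@complexI R)) gt_eqF. Qed.
Let sqrt_2pi_neq0 : (sqrt_2pi R)%:C != 0 :> R[i].
Proof. by rewrite (inj_eq (@complexI R)) gt_eqF// sqrt_2pi_gt0. Qed.

Lemma reexp_rem_genE mu : `|nu| < Re (lommel_exponent N mu) -> lomH (lommel_exponent N mu) nu 1 != 0 ->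
  lommel_a N (- mu) nu%:C != 0 -> `|nu| < M%:R + 2^-1 -> M%:R < Re (expS N 0 mu) ->
  reexp_rem_gen S N M x%:C mu nu%:C =
  tail_transform x (kappa nu) (fun m => bessel_a m nu) M (expS N 0 mu).
Proof.
move=> nup H0 a0 nuM sM; set s := expS N 0 mu in sM *.
have [_ I] := @reexpansion R x _ (fun m => bessel_a m nu) M (@continuous_kappa nu) (fun t ht => kappa_envelope ht nuM) _ sM.
have sp : s + 2%:R^-1 = lommel_exponent N mu by rewrite /s /expS /lommel_exponent; field.
rewrite /reexp_rem_gen (lommel_remE HS x0 nup H0) (prefactorE nup) (lomF_real x0 nup) -sp I sp.
have -> : cpow x%:C (- lommel_exponent N mu) = cpow x%:C (mu - 1) / x%:C ^+ (2 * N).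
  by rewrite -(cpow_nat _ xC) -cpowB; congr cpow; rewrite /lommel_exponent; ring.
rewrite rem_algebra//; [|by rewrite signr_eq0|exact: cpow_neq0].
have -> : \sum_(0 <= m < M) (bessel_a m nu)%:C * termint (s - m%:R) x =
    \sum_(0 <= m < M) bessel_a m nu%:C * gamma (expS N m mu) * terminant (expS N m mu) x%:C.
  rewrite big_nat [RHS]big_nat; apply: eq_bigr => m /andP[_ mM].
  have e : expS N m mu = s - m%:R by rewrite /s /expS; ring.
  rewrite e -mulrA gamma_terminant//; first by rewrite bessel_a_real.
  by rewrite ReB Re_nat subr_gt0 (lt_trans _ sM)// ltr_nat.
by rewrite addrC addKr.
Qed.

Lemma reexp_rem_gen'E mu : (0 < M)%N -> `|nu| < Re (lommel_exponent N mu) -> lomH (lommel_exponent N mu) nu 1 != 0 ->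
  lommel_a N (- mu) nu%:C != 0 -> `|nu| < M%:R - 2^-1 -> M%:R < Re (expS' N 0 mu) ->
  reexp_rem_gen' S N M x%:C mu nu%:C =
  tail_transform x (kappa1 nu) (fun m => bessel_b m nu) M (expS' N 0 mu).
Proof.
move=> M0 nup H0 a0 nuM sM; set s := expS' N 0 mu in sM *.
have [I0 I] := @reexpansion R x _ (fun m => bessel_b m nu) M (@continuous_kappa1 nu) (fun t ht => kappa1_envelope M0 ht nuM) _ sM.
have sp : s + 2%:R^-1 = lommel_exponent N mu + 1 by rewrite /s /expS' /lommel_exponent; field.
rewrite /reexp_rem_gen' (lommel_remE' HS x0 nup H0) (prefactorE nup) (lomF1_real x0 nup).
rewrite sp in I0 I.
have -> : cint leb (fun v => cex ((lommel_exponent N mu + 1) * v%:C) * ((1 + expR v ^+ 2 / x ^+ 2)^-1)%:C * (- kappa1 nu (expR v))%:C) =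
    - (sqrt_2pi R)%:C * (\sum_(0 <= m < M) (bessel_b m nu)%:C * termint (s - m%:R) x +
      tail_transform x (kappa1 nu) (fun m => bessel_b m nu) M s).
  by rewrite mulNr -I -mulN1r -(cintZ _ I0); apply: eq_cint => v; rewrite rmorphN; ring.
have -> : cpow x%:C (- (lommel_exponent N mu + 1)) = cpow x%:C (mu - 2%:R) / x%:C ^+ (2 * N).
  by rewrite -(cpow_nat _ xC) -cpowB; congr cpow; rewrite /lommel_exponent; ring.
(* The extra sign in (-1)^(N+1) matches the minus sign in front of [kappa1]. *)
have -> : (-1) ^+ N.+1 * ((sqrt_2pi R)%:C * lommel_a N (- mu) nu%:C / lomH (lommel_exponent N mu) nu 1) =
    (-1) ^+ N * (- (sqrt_2pi R)%:C * lommel_a N (- mu) nu%:C / lomH (lommel_exponent N mu) nu 1) by rewrite exprS; ring.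
rewrite rem_algebra ?oppr_eq0//; [|by rewrite signr_eq0|exact: cpow_neq0].
have -> : \sum_(0 <= m < M) (bessel_b m nu)%:C * termint (s - m%:R) x =
    \sum_(0 <= m < M) bessel_b m nu%:C * gamma (expS' N m mu) * terminant (expS' N m mu) x%:C.
  rewrite big_nat [RHS]big_nat; apply: eq_bigr => m /andP[_ mM].
  have e : expS' N m mu = s - m%:R by rewrite /s /expS'; ring.
  rewrite e -mulrA gamma_terminant//; first by rewrite bessel_b_real.
  by rewrite ReB Re_nat subr_gt0 (lt_trans _ sM)// ltr_nat.
by rewrite addrC addKr.
Qed.

End Assembly.

(** * Passage to exceptional mu and the two parts of the theorem *)

Section Conclusion.
Variable R : realType.
Implicit Types (L d e x nu a b : R) (mu s z : R[i]).

Lemma lim_punctured (G : R[i] -> R[i]) mu s L d : 0 < d ->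
  (forall mu', mu' != mu -> cmod (mu' - mu) < d -> cmod (G mu' - s) <= L * cmod (mu' - mu)) ->
  lim ((G mu' : R[i]^o) @[mu' --> (mu : R[i]^o)^']) = s.
Proof.
move=> d0 H; apply/cvg_lim; first exact: norm_hausdorff.
apply/cvgrPdist_le => e e0.
have er : e = (Re e)%:C by case: e e0 => a b; rewrite ltcE /= => /andP[/eqP -> _].
have re0 : 0 < Re e by move: e0; rewrite er ltcR.
have L0 : 0 < `|L| + 1 by rewrite ltr_wpDl.
apply: (near_cmod (fun w : R[i] => w != mu -> _) mu).2.
exists (Num.min d (Re e / (`|L| + 1))); first by rewrite lt_min d0 divr_gt0.
move=> w; rewrite lt_min => /andP[h1 h2] ne.
rewrite normrC er lecR -cmodN opprB (le_trans (H _ ne h1))//.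
rewrite ltr_pdivlMr// mulrC in h2; apply: le_trans (ltW h2).
by rewrite ler_wpM2r ?cmod_ge0// (le_trans (ler_norm L))// lerDl.
Qed.

(* Both parts of the theorem, [g] being the generic remainder and [sh] the real
   exponent shift (1/2 or 3/2). *)
Lemma reexp_conclusion (g : R[i] -> R[i]) (k : R -> R) (c : nat -> R) N M x nu (m0 sh : R) :
  0 < x -> continuous (fun v => k (expR v)) ->
  (forall t, 0 < t -> exists2 th : R, 0 < th < 1 &
    k t = kappa_scale t * (\sum_(0 <= m < M) c m / t ^+ m + c M / t ^+ M * th)) ->
  `|nu| < Re (lommel_exponent N m0%:C) -> M%:R < (2 * N)%:R - m0 + sh ->
  (forall mu, `|nu| < Re (lommel_exponent N mu) -> lomH (lommel_exponent N mu) nu 1 != 0 ->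
     lommel_a N (- mu) nu%:C != 0 -> M%:R < (2 * N)%:R - Re mu + sh ->
     g mu = tail_transform x k c M ((2 * N)%:R - mu + sh%:C)) ->
  exists Theta : R, 0 < Theta < 1 /\
    (if `[< exceptional m0%:C nu%:C >] then
       lim ((g mu' : R[i]^o) @[mu' --> (m0%:C : R[i]^o)^']) else g m0%:C) =
    (c M)%:C * termint ((2 * N)%:R - m0%:C + sh%:C - M%:R) x * Theta%:C.
Proof.
move=> x0 ck env nup Ms gE.
pose a := (2 * N)%:R - m0 + sh.
have aE : (2 * N)%:R - m0%:C + sh%:C = a%:C by rewrite /a !(rmorphD, rmorphN, rmorph_nat).
have [th [T01 PE]] := tail_transform_theta x ck env (Ms : M%:R < a).
exists th; split => //; rewrite aE -PE.
have b0 : m0 < (2 * N)%:R + sh - M%:R by lra.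
have [d d0 H] := lomH_near b0 nup.
case: asboolP => ex.
  have Ra : M%:R < Re (a%:C : R[i]) by [].
  have [L [d' [d'0 HL]]] := tail_transform_lip x ck env Ra.
  apply: (@lim_punctured _ _ _ L (Num.min d d')); first by rewrite lt_min d0.
  move=> mu ne; rewrite lt_min => /andP[h h'].
  have [hb hp weightH /(_ ne) ha] := H mu h.
  rewrite gE//; last by lra.
  have -> : (2 * N)%:R - mu + sh%:C = a%:C + (m0%:C - mu) by rewrite -aE; ring.
  by rewrite -[X in _ <= _ * X]cmodN opprB; apply: HL; rewrite -cmodN opprB.
have [|_ _ weightH _] := H m0%:C; first by rewrite subrr cmod0.
by rewrite gE// ?aE//; exact: nonexceptional_lommel_a.
Qed.


End Conclusion.

Theorem theorem1p8 (R : realType) (S : R[i] -> R[i] -> R[i] -> R[i])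
    (HS : forall mu nu : R[i], is_lommel mu nu (S mu nu)) :
  (forall (N M : nat) (z mu nu : R),
     0 < z -> mu < (2 * N)%:R - M%:R + 2%:R^-1 -> `|nu| < M%:R + 2%:R^-1 ->
     exists Theta : R, 0 < Theta < 1 /\
       reexp_rem S N M z%:C mu%:C nu%:C =
         bessel_a M nu%:C * gamma (expS N M mu%:C)
         * terminant (expS N M mu%:C) z%:C * Theta%:C)
  /\
  (forall (N M : nat) (z mu nu : R),
     (0 < M)%N ->
     0 < z -> mu < (2 * N)%:R - M%:R + 3%:R / 2%:R -> `|nu| < M%:R - 2%:R^-1 ->
     exists Theta : R, 0 < Theta < 1 /\
       reexp_rem' S N M z%:C mu%:C nu%:C =
         bessel_b M nu%:C * gamma (expS' N M mu%:C)
         * terminant (expS' N M mu%:C) z%:C * Theta%:C).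
Proof.
have RepN (N : nat) (mu : R) : Re (lommel_exponent N mu%:C) = 1 - mu + (2 * N)%:R.
  by rewrite /lommel_exponent !(ReB, Re1, Re_nat, Re_real); ring.
have half : (2^-1 : R)%:C = 2%:R^-1 by rewrite fmorphV rmorph_nat.
have half3 : (3 / 2 : R)%:C = 3%:R / 2%:R by rewrite rmorphM fmorphV !rmorph_nat.
split=> N M z mu nu; last move=> M0.
  move=> z0 muM nuM.
  (* 1 - mu + 2 N > M + 1/2 > |nu|, the convergence condition for the plane integral. *)
  have h1 : `|nu| < Re (lommel_exponent N mu%:C) by rewrite RepN; lra.
  have h2 : M%:R < (2 * N)%:R - mu + 2^-1 by lra.
  have expE (w : R[i]) : (2 * N)%:R - w + (2^-1)%:C = expS N 0 w by rewrite half /expS subr0.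
  have eM : expS N M mu%:C = (2 * N)%:R - mu%:C + (2^-1)%:C - M%:R by rewrite half /expS; ring.
  have [|th [T01 E]] := @reexp_conclusion R (fun mu => reexp_rem_gen S N M z%:C mu nu%:C)
      (kappa nu) (fun m => bessel_a m nu) N M z nu mu 2^-1 z0 (@continuous_kappa R nu)
      (fun t ht => kappa_envelope ht nuM) h1 h2.
    move=> w w1 w2 w3 w4; rewrite expE; apply: reexp_rem_genE => //.
    by rewrite -expE !(ReD, ReN, Re_nat, Re_real).
  exists th; split => //; rewrite /reexp_rem E bessel_a_real -eM -(mulrA (bessel_a M nu)%:C (gamma _)).
  rewrite gamma_terminant// eM; rewrite !(ReD, ReN, Re_nat, Re_real); lra.
move=> z0 muM nuM.
(* Here 1 - mu + 2 N > M - 1/2 > |nu|. *)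
have h1 : `|nu| < Re (lommel_exponent N mu%:C) by rewrite RepN; lra.
have h2 : M%:R < (2 * N)%:R - mu + 3 / 2 by lra.
have expE (w : R[i]) : (2 * N)%:R - w + (3 / 2)%:C = expS' N 0 w by rewrite half3 /expS' subr0.
have eM : expS' N M mu%:C = (2 * N)%:R - mu%:C + (3 / 2)%:C - M%:R by rewrite half3 /expS'; ring.
have [|th [T01 E]] := @reexp_conclusion R (fun mu => reexp_rem_gen' S N M z%:C mu nu%:C)
    (kappa1 nu) (fun m => bessel_b m nu) N M z nu mu (3 / 2) z0 (@continuous_kappa1 R nu)
    (fun t ht => kappa1_envelope M0 ht nuM) h1 h2.
  move=> w w1 w2 w3 w4; rewrite expE; apply: reexp_rem_gen'E => //.
  by rewrite -expE !(ReD, ReN, Re_nat, Re_real).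
exists th; split => //; rewrite /reexp_rem' E bessel_b_real -eM -(mulrA (bessel_b M nu)%:C (gamma _)).
rewrite gamma_terminant// eM; rewrite !(ReD, ReN, Re_nat, Re_real); lra.
Qed.
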